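(* Let $(\mathcal{A},\mu_1)$ and $(\mathcal{H},\nu_1)$ be chain complexes of $\mathbb{C}[\partial]$-modules together with contraction data $(p,i,h)$ from $(\mathcal{A},\mu_1)$ to $(\mathcal{H},\nu_1)$. If $(\mathcal{A},\{\mu_k\}_{k\ge1})$ is an $A_\infty$-conformal algebra, then it can be transferred to an $A_\infty$-conformal algebra structure on $(\mathcal{H},\nu_1)$; namely, if $\{\nu_k\}_{k\ge1}$ are the transferred maps of $\{\mu_k\}_{k\ge1}$ along $(p,i,h)$, then $(\mathcal{H},\{\nu_k\}_{k\ge1})$ is an $A_\infty$-conformal algebra.
   Context: All vector spaces and tensor products are over $\mathbb{C}$. A graded $\mathbb{C}[\partial]$-module is $\mathcal{A}=\oplus_{i\in\mathbb{Z}}\mathcal{A}_i$ with each $\mathcal{A}_i$ a $\mathbb{C}[\partial]$-module; $\mathcal{A}[\lambda_1,\ldots,\lambda_{k-1}]$ is graded by $\mathcal{A}_i[\lambda_1,\ldots,\lambda_{k-1}]$, with $\partial$ acting coefficientwise. A $\mathbb{C}$-linear map $\varphi:\mathcal{A}^{\otimes k}\to\mathcal{A}[\lambda_1,\ldots,\lambda_{k-1}]$ is conformal sesquilinear if $\varphi_{\lambda_1,\ldots,\lambda_{k-1}}(a_1,\ldots,\partial a_j,\ldots,a_k)=-\lambda_j\,\varphi_{\lambda_1,\ldots,\lambda_{k-1}}(a_1,\ldots,a_k)$ for $1\le j\le k-1$, and $\varphi_{\lambda_1,\ldots,\lambda_{k-1}}(a_1,\ldots,a_{k-1},\partial a_k)=(\partial+\lambda_1+\cdots+\lambda_{k-1})\varphi_{\lambda_1,\ldots,\lambda_{k-1}}(a_1,\ldots,a_k)$.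 All maps are extended linearly over polynomials in the $\lambda$'s. An $A_\infty$-conformal algebra is a graded $\mathbb{C}[\partial]$-module $\mathcal{A}$ with conformal sesquilinear maps $\mu_k:\mathcal{A}^{\otimes k}\to\mathcal{A}[\lambda_1,\ldots,\lambda_{k-1}]$ of degree $k-2$, $k\ge1$, such that for all $n\ge1$ and homogeneous $a_1,\ldots,a_n$, $$\sum_{k+l=n+1}\sum_{j=1}^k(-1)^{j(l+1)+l(|a_1|+\cdots+|a_{j-1}|)}(\mu_k)_{\lambda_1,\ldots,\lambda_{j-1},\lambda_j+\cdots+\lambda_{j+l-1},\lambda_{j+l},\ldots,\lambda_{n-1}}\big(a_1,\ldots,a_{j-1},(\mu_l)_{\lambda_j,\ldots,\lambda_{j+l-2}}(a_j,\ldots,a_{j+l-1}),a_{j+l},\ldots,a_n\big)=0,$$ where for $j=k$ the subscripts of $\mu_k$ are just $\lambda_1,\ldots,\lambda_{k-1}$. A chain complex of $\mathbb{C}[\partial]$-modules is a graded $\mathbb{C}[\partial]$-module with a $\mathbb{C}[\partial]$-linear degree $-1$ square-zero map. Contraction data from $(\mathcal{A},\mu_1)$ to $(\mathcal{H},\nu_1)$ consist of $\mathbb{C}[\partial]$-linear chain maps $p:\mathcal{A}\to\mathcal{H}$, $i:\mathcal{H}\to\mathcal{A}$ (degree $0$) and a $\mathbb{C}[\partial]$-linear degree $+1$ map $h:\mathcal{A}\to\mathcal{A}$ with $ip-\mathrm{id}_{\mathcal{A}}=\mu_1h+h\mu_1$ and $pi=\mathrm{id}_{\mathcal{H}}$.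 Transferred maps. Let $\mathcal{A}[-1]$ be the shift, $(\mathcal{A}[-1])_j=\mathcal{A}_{j-1}$, and $s:\mathcal{A}\to\mathcal{A}[-1]$ the degree $+1$ identification (similarly for $\mathcal{H}$). Tensor products of graded maps are evaluated with the Koszul sign rule. Put $\rho_k=s\circ\mu_k\circ(s^{-1})^{\otimes k}$, $\bar p=sps^{-1}$, $\bar i=sis^{-1}$, $\bar h=shs^{-1}$. Planar trees are rooted planar trees whose internal vertices all have at least two inputs; $|$ is the unique one with one leaf, and every planar tree with $k\ge2$ leaves is uniquely a grafting $T=T_1\vee\cdots\vee T_l$, $l\ge2$. Recursively set $\rho_T=\rho_l\big((\bar h\circ\rho_{T_1})\otimes\cdots\otimes(\bar h\circ\rho_{T_l})\big)$ with the convention $\bar h\circ\rho_{|}=\mathrm{id}$; here, for degree $0$ maps $\varphi_j$ of arity $k_j$, $\rho_l(\varphi_1\otimes\cdots\otimes\varphi_l)$ splits the inputs into consecutive blocks of sizes $k_1,\ldots,k_l$, applies $\varphi_j$ to the $j$-th block with subscripts the $\lambda$'s of all but the last index in that block, and then applies $(\rho_l)_{\Lambda_1,\ldots,\Lambda_{l-1}}$ with $\Lambda_j$ the sum of the $\lambda$'s with index in the $j$-th block. For $k\ge2$ let $\theta_k=\bar p\circ\big(\sum_T\rho_T\big)\circ\bar i^{\otimes k}$, the sum over planar trees with $k$ leaves, and let $\nu_k:\mathcal{H}^{\otimes k}\to\mathcal{H}[\lambda_1,\ldots,\lambda_{k-1}]$ be determined by $\theta_k=s\circ\nu_k\circ(s^{-1})^{\otimes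 k}$. The transferred maps are $\nu_1$ (the given differential) and these $\nu_k$, $k\ge2$. *)

(* Defs.v *)
From HB Require Import structures.
From mathcomp Require Import all_boot all_order all_algebra.
From mathcomp Require Import finmap monalg complex reals.

Set Implicit Arguments.
Unset Strict Implicit.
Unset Printing Implicit Defensive.

Import Order.TTheory GRing.Theory Num.Theory.

Local Open Scope ring_scope.

(* ------------------------------------------------------------------------ *)
(* Polynomials in the lambdas with coefficients in an abelian group V.  The *)
(* variables are indexed by nat; the space V[lambda_1, ..., lambda_{k-1}]   *)
(* is the part of {lpoly V} in which only the variables 0, ..., k - 2       *)
(* occur (see in_vars), so variable i stands for lambda_{i+1}.              *)

Notation "{ 'lpoly' V }" := {malg V[{cmonom nat}]}
  (at level 0, V at level 2, format "{ 'lpoly'  V }") : type_scope.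

Definition in_vars (V : zmodType) (n : nat) (f : {lpoly V}) : Prop :=
  forall m : {cmonom nat}, m \in msupp f -> forall i : nat, (n <= i)%N -> m i = 0%N.

Definition lmap (V W : zmodType) (g : V -> W) (f : {lpoly V}) : {lpoly W} :=
  \sum_(m <- msupp f) << g f@_m *g m >>.

Section LambdaPolynomials.

Context {F : fieldType}.

Definition lvar (i : nat) : {lpoly F} := << ucm i >>.

(* In an F[d]-module, encoded as an lmodType {poly F}, the derivation d acts *)
(* as 'X *: _ and a scalar c : F acts as c%:P *: _.                          *)

Definition lscale (V : lmodType {poly F}) (p : {lpoly F}) (f : {lpoly V}) :
    {lpoly V} :=
  \sum_(m <- msupp p) \sum_(m' <- msupp f)
     << (p@_m)%:P *: f@_m' *g mmul m m' >>.

Definition lsubst (V : lmodType {poly F}) (L : nat -> {lpoly F})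
    (f : {lpoly V}) : {lpoly V} :=
  \sum_(m <- msupp f) lscale (\prod_(i <- finsupp m) L i ^+ m i) (f@_m)%:MP.

(* The value at arguments Ps that are themselves polynomials in the lambdas *)
(* of a multilinear map f with subscripts L: f is extended linearly over    *)
(* the lambdas occurring in the arguments.                                  *)
Fixpoint lextend (V : lmodType {poly F}) (L : nat -> {lpoly F})
    (f : seq V -> {lpoly V}) (Ps : seq {lpoly V}) : {lpoly V} :=
  if Ps is P :: Ps' then
    \sum_(m <- msupp P)
       lscale << m >> (lextend L (fun v => f (P@_m :: v)) Ps')
  else lsubst L (f [::]).

(* f(phi_1 (x) ... (x) phi_l) at the arguments a, without any sign, where   *)
(* phis lists the pairs (arity of phi_j, phi_j).  The j-th block of a       *)
(* starts at position sumn (take j sh); phi_j gets the lambdas of all but   *)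
(* the last index of its block, and f gets as j-th subscript the sum of the *)
(* lambdas of the j-th block (the subscript of the last block is not used   *)
(* when f takes values in in_vars (size phis).-1).                          *)
Definition graft (V : lmodType {poly F}) (f : seq V -> {lpoly V})
    (phis : seq (nat * (seq V -> {lpoly V}))) (a : seq V) : {lpoly V} :=
  let sh := [seq phi.1 | phi <- phis] in
  let start j := sumn (take j sh) in
  lextend (fun j => \sum_(start j <= i < start j.+1) lvar i) f
    [seq lsubst (fun i => lvar (start j + i)%N)
           ((nth (0%N, fun=> 0) phis j).2 (nth [::] (reshape sh a) j))
       | j <- iota 0 (size phis)].

Definition lid (V : lmodType {poly F}) : nat * (seq V -> {lpoly V}) :=
  (1%N, fun a => (head 0 a)%:MP).

End LambdaPolynomials.

(* ------------------------------------------------------------------------ *)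
(* A graded F[d]-module is an internal direct sum of submodules: gproj d is *)
(* the projection onto the component of degree d, and the last axiom says   *)
(* that every element is a finite sum of homogeneous ones.                  *)

Record gradedModule (F : fieldType) := GradedModule {
  gsort :> lmodType {poly F};
  gproj : int -> {linear gsort -> gsort};
  gprojK : forall (d e : int) (x : gsort),
    gproj d (gproj e x) = if d == e then gproj e x else 0;
  gproj_sum : forall x : gsort,
    exists s : seq int, uniq s && (x == \sum_(d <- s) gproj d x) }.

Section Graded.

Context {F : fieldType}.
Implicit Types A B : gradedModule F.

Definition homog A (d : int) (x : A) : Prop := gproj A d x = x.

Definition homogs A (ds : seq int) (a : seq A) : Prop :=
  size ds = size a /\
  forall i : nat, (i < size a)%N -> homog (nth 0 ds i) (nth 0 a i).

Definition has_degree A B (e : int) (f : A -> B) : Prop :=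
  forall (d : int) (x : A), homog d x -> homog (d + e) (f x).

(* The linear map x |-> (-1)^(n |x|) x; see twist_homog. *)
Definition twist A (n : int) (x : A) : A :=
  \sum_(d <- xchoose (gproj_sum x)) gproj A d x *~ (-1) ^ (n * d).

(* For g of degree e, the Koszul rule evaluates the k-th tensor power of g   *)
(* at (x_1, ..., x_k) as (-1)^(e \sum_j (k - j) |x_j|) (g x_1, ..., g x_k);  *)
(* the factor (-1)^(e (k - j) |x_j|) is put on the j-th entry.                *)
Definition koszul_map A B (e : int) (g : A -> B) (x : seq A) : seq B :=
  mkseq (fun j => g (twist (e * (size x - j.+1)%N%:Z) (nth 0 x j))) (size x).

Lemma gproj_eq A (x y : A) : (forall d, gproj A d x = gproj A d y) -> x = y.
Proof.
move=> eq_xy; apply/eqP; rewrite -subr_eq0; apply/eqP.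
have [s /andP[_ /eqP->]] := gproj_sum (x - y).
by rewrite big1 // => d _; rewrite linearB /= eq_xy subrr.
Qed.

Lemma gproj_twist A (n d : int) (x : A) :
  gproj A d (twist n x) = gproj A d x *~ (-1) ^ (n * d).
Proof.
rewrite /twist; case/andP: (xchooseP (gproj_sum x)).
set s := xchoose _ => us /eqP xE.
rewrite linear_sum /=.
have [ds|dNs] := boolP (d \in s).
  rewrite (bigD1_seq d) //= raddfMz /= gprojK eqxx big1 ?addr0 // => e ed.
  by rewrite raddfMz /= gprojK eq_sym (negPf ed) mul0rz.
rewrite {2}xE linear_sum /= big_seq big1 => [|e es]; last first.
  by rewrite raddfMz /= gprojK; case: eqP dNs es => [->/negPf->|_ _ _] //; rewrite mul0rz.
rewrite big_seq big1 ?mul0rz // => e es.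
by rewrite gprojK; case: eqP dNs es => [->/negPf->|].
Qed.

Lemma twist_homog A (n d : int) (x : A) :
  homog d x -> twist n x = x *~ (-1) ^ (n * d).
Proof.
move=> hx; apply: gproj_eq => e; rewrite gproj_twist raddfMz /= -hx gprojK.
by case: eqP => [->|]; rewrite ?mul0rz.
Qed.

Lemma twist_twistN A (n : int) (x : A) : twist (- n) (twist n x) = x.
Proof.
apply: gproj_eq => d; rewrite !gproj_twist -mulrzA -exprzDr ?unitrN ?unitr1 //.
by rewrite -mulrDl subrr mul0r expr0z mulr1z.
Qed.

Lemma shift_projK A (d e : int) (x : A) :
  gproj A (d - 1) (gproj A (e - 1) x) = if d == e then gproj A (e - 1) x else 0.
Proof. by rewrite gprojK (inj_eq (addIr _)). Qed.

Lemma shift_proj_sum A (x : A) :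
  exists s : seq int, uniq s && (x == \sum_(d <- s) gproj A (d - 1) x).
Proof.
have [s /andP[us /eqP xE]] := gproj_sum x.
exists [seq d + 1 | d <- s]; rewrite map_inj_uniq ?us /=; last exact: addIr.
by rewrite big_map {1}xE; apply/eqP/eq_bigr => d _; rewrite addrK.
Qed.

(* The shift A[-1], whose component of degree d is A_{d-1}. *)
Definition shift A : gradedModule F :=
  GradedModule (@shift_projK A) (@shift_proj_sum A).

Definition susp A (x : A) : shift A := x.
Definition desusp A (x : shift A) : A := x.

Definition sconj A B (g : A -> B) : shift A -> shift B :=
  fun x => susp (g (desusp x)).

(* ------------------------------------------------------------------------ *)

Record conformal_sesquilinear A (k : nat) (f : seq A -> {lpoly A}) : Prop :=
  ConformalSesquilinear {
  cs_vars : forall a, size a = k -> in_vars k.-1 (f a);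
  cs_linear : forall a b x y (c : F), (size a + size b).+1 = k ->
    f (a ++ (c%:P *: x + y) :: b) =
      lmap ( *:%R c%:P) (f (a ++ x :: b)) + f (a ++ y :: b);
  cs_partial : forall a b x, (size a + size b).+1 = k -> (0 < size b)%N ->
    f (a ++ ('X *: x) :: b) = lscale (- lvar (size a)) (f (a ++ x :: b));
  cs_partial_last : forall a x, (size a).+1 = k ->
    f (rcons a ('X *: x)) =
      lmap ( *:%R 'X) (f (rcons a x))
        + lscale (\sum_(i < size a) lvar i) (f (rcons a x)) }.

(* A family of maps is given by mu : nat -> seq A -> {lpoly A}; only the     *)
(* values of mu k at sequences of length k, for k >= 1, are meaningful.      *)
Record Ainfty_conformal A (mu : nat -> seq A -> {lpoly A}) : Prop :=
  AinftyConformal {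
  Ainfty_sesquilinear : forall k, (0 < k)%N -> conformal_sesquilinear k (mu k);
  Ainfty_degree : forall k ds a, (0 < k)%N -> size a = k -> homogs ds a ->
    forall m, homog (\sum_(d <- ds) d + k%:Z - 2) (mu k a)@_m;
  Ainfty_relation : forall n ds a, (0 < n)%N -> size a = n -> homogs ds a ->
    \sum_(1 <= k < n.+1) \sum_(1 <= l < n.+1 | (k + l == n.+1)%N)
      \sum_(1 <= j < k.+1)
        graft (mu k) (nseq j.-1 (lid A) ++ (l, mu l) :: nseq (k - j) (lid A)) a
          *~ (-1) ^ ((j * l.+1)%N%:Z + l%:Z * \sum_(d <- take j.-1 ds) d) = 0 }.

End Graded.

Record chainComplex (F : fieldType) := ChainComplex {
  cmodule :> gradedModule F;
  cdiff : {linear cmodule -> cmodule};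
  cdiff_degree : has_degree (-1) cdiff;
  cdiffK : forall x, cdiff (cdiff x) = 0 }.

Arguments cdiff {F} c.

Record contraction_data (F : fieldType) (A H : chainComplex F)
    (p : {linear A -> H}) (i : {linear H -> A}) (h : {linear A -> A}) : Prop :=
  ContractionData {
  contr_p_degree : has_degree 0 p;
  contr_i_degree : has_degree 0 i;
  contr_h_degree : has_degree 1 h;
  contr_p_chain : forall x, p (cdiff A x) = cdiff H (p x);
  contr_i_chain : forall y, i (cdiff H y) = cdiff A (i y);
  contr_homotopy : forall x, i (p x) - x = cdiff A (h x) + h (cdiff A x);
  contr_retract : forall y, p (i y) = y }.

(* ------------------------------------------------------------------------ *)
(* Planar trees: PNode t1 t2 ts is the grafting of t1, t2 and the list ts,  *)
(* so that every internal vertex has at least two inputs.                   *)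

Unset Elimination Schemes.
Inductive ptree := PLeaf | PNode of ptree & ptree & seq ptree.
Set Elimination Schemes.

Definition ptree_ind (K : ptree -> Prop) (IHl : K PLeaf)
    (IHn : forall t1 t2 ts, K t1 -> K t2 -> foldr (fun t => and (K t)) True ts ->
       K (PNode t1 t2 ts)) :=
  fix loop t : K t := match t with
  | PLeaf => IHl
  | PNode t1 t2 ts =>
    let fix iter f : foldr (fun t => and (K t)) True f :=
      if f is t :: f' then conj (loop t) (iter f') else Logic.I in
    IHn t1 t2 ts (loop t1) (loop t2) (iter ts)
  end.

Fixpoint ptree_encode (t : ptree) : GenTree.tree unit :=
  match t with
  | PLeaf => GenTree.Leaf tt
  | PNode t1 t2 ts => GenTree.Node 0
      (ptree_encode t1 :: ptree_encode t2 :: map ptree_encode ts)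
  end.

Fixpoint ptree_decode (t : GenTree.tree unit) : ptree :=
  match t with
  | GenTree.Leaf _ => PLeaf
  | GenTree.Node _ f =>
    if map ptree_decode f is [:: t1, t2 & ts] then PNode t1 t2 ts else PLeaf
  end.

Lemma ptree_encodeK : cancel ptree_encode ptree_decode.
Proof.
elim=> //= t1 t2 ts -> -> IH; congr PNode.
by elim: ts IH => //= t ts IHts [-> /IHts->].
Qed.

HB.instance Definition _ := Countable.copy ptree (can_type ptree_encodeK).

Fixpoint leaves (t : ptree) : nat :=
  match t with
  | PLeaf => 1%N
  | PNode t1 t2 ts => (leaves t1 + leaves t2 + sumn (map leaves ts))%N
  end.

Definition pgraft (ts : seq ptree) : option ptree :=
  if ts is [:: t1, t2 & ts'] then Some (PNode t1 t2 ts') else None.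

(* the lists of l trees with n leaves in total, where tr m lists the trees  *)
(* with m leaves                                                            *)
Fixpoint pforests (tr : nat -> seq ptree) (l n : nat) : seq (seq ptree) :=
  if l is l'.+1 then
    flatten [seq [seq t :: f | t <- tr m, f <- pforests tr l' (n - m)%N]
               | m <- iota 1 n]
  else if n == 0%N then [:: [::]] else [::].

(* the trees of height at most d with n leaves *)
Fixpoint ptrees_rec (d n : nat) : seq ptree :=
  (if n == 1%N then [:: PLeaf] else [::]) ++
  (if d is d'.+1 then
     flatten [seq pmap pgraft (pforests (ptrees_rec d') l n) | l <- iota 2 n]
   else [::]).

Definition ptrees (n : nat) : seq ptree := ptrees_rec n n.

Lemma pgraftE f t : (pgraft f == Some t) = if t is PNode t1 t2 ts
  then f == [:: t1, t2 & ts] else false.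
Proof.
case: t f => [|t1 t2 ts] [|u1 [|u2 us]] //=.
  by rewrite eqseq_cons andbF.
by apply/eqP/eqP => -[-> -> ->].
Qed.

Lemma leaves_gt0 t : (0 < leaves t)%N.
Proof. by elim: t => //= t1 t2 ts; case: (leaves t1). Qed.

Lemma mem_pforests (tr : nat -> seq ptree) l n f :
    (forall m t, t \in tr m -> leaves t = m) ->
  (f \in pforests tr l n) =
    [&& size f == l, sumn (map leaves f) == n & all (fun t => t \in tr (leaves t)) f].
Proof.
move=> trP; elim: l n f => [|l IH] n f /=.
  case: eqP => [->|/eqP n0]; case: f => //=.
  by rewrite eq_sym (negPf n0).
apply/flatten_mapP/idP => [[m]|].
  rewrite mem_iota => /andP[m0 mn] /allpairsP[[t g] /= [tm]].
  rewrite IH => /and3P[/eqP sg /eqP ng ag] ->; rewrite /= sg eqxx ng.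
  by rewrite (trP _ _ tm) tm ag subnKC ?eqxx //; rewrite -ltnS -add1n.
case: f => //= t g /and3P[sg /eqP ng /andP[tt ag]].
exists (leaves t); first by rewrite mem_iota leaves_gt0 add1n ltnS -ng leq_addr.
apply/allpairsP; exists (t, g); split => //=.
by rewrite IH -eqSS sg ag -ng addKn eqxx.
Qed.

Lemma ptrees_recP d m u : u \in ptrees_rec d m -> leaves u = m.
Proof.
elim: d m u => [|d IH] m u /=.
  by rewrite cats0; case: eqP => //= ->; rewrite inE => /eqP->.
rewrite mem_cat => /orP[|/flatten_mapP[l _]].
  by case: eqP => //= ->; rewrite inE => /eqP->.
rewrite mem_pmap => /mapP[f]; rewrite mem_pforests // => /and3P[_ /eqP <- _].
move/esym/eqP; rewrite pgraftE; case: u => // t1 t2 ts /eqP->.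
by rewrite /= addnA.
Qed.

Lemma mem_ptrees n t : (t \in ptrees n) = (leaves t == n).
Proof.
rewrite /ptrees.
apply/idP/eqP => [/ptrees_recP //|tn].
suff H d u : (leaves u <= d)%N -> u \in ptrees_rec d (leaves u).
  by rewrite -tn; apply: H.
elim: d u => [|d IH] u; first by rewrite leqNgt leaves_gt0.
case: u => [|t1 t2 ts]; first by [].
set u := PNode t1 t2 ts => ud; rewrite /= mem_cat; apply/orP; right.
have sz us : (size us <= sumn (map leaves us))%N.
  by elim: us => //= v us IHus; rewrite -add1n leq_add // leaves_gt0.
apply/flatten_mapP; exists (size ts).+2.
  rewrite mem_iota /= addSn addSn ltnS add0n ltnS.
  have := sz ts; move: (leaves_gt0 t1) (leaves_gt0 t2).
  by case: (leaves t1) => // a; case: (leaves t2) => // b; rewrite !addSn addnS !ltnS => _ _ /leq_trans->//; rewrite leq_addl.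
rewrite mem_pmap; apply/mapP; exists [:: t1, t2 & ts] => //.
rewrite mem_pforests //=; last exact: ptrees_recP.
rewrite !eqxx addnA eqxx /=.
have [a0 b0] := (leaves_gt0 t1, leaves_gt0 t2).
have le1 : (leaves t1 <= d)%N.
  by rewrite -ltnS; apply: leq_trans ud; rewrite /= -addnA -addn1 leq_add2l addn_gt0 b0.
have le2 : (leaves t2 <= d)%N.
  by rewrite -ltnS; apply: leq_trans ud; rewrite /= [(leaves t1 + _)%N]addnC -addnA -addn1 leq_add2l addn_gt0 a0.
rewrite !IH //=; apply/allP => v vts; apply: IH.
rewrite -ltnS; apply: leq_trans ud; rewrite /=.
have vs : (leaves v <= sumn (map leaves ts))%N.
  by rewrite sumnE big_map (big_rem v) //= leq_addr.
by rewrite -addnA -add1n leq_add // (leq_trans vs) // leq_addl.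
Qed.

Lemma uniq_flatten_key (S : eqType) (g : S -> nat) (F : nat -> seq S) s :
  uniq s -> (forall m, m \in s -> uniq (F m)) ->
  (forall m x, x \in F m -> g x = m) -> uniq (flatten (map F s)).
Proof.
move=> us uF gF; elim: s us uF => //= m s IH /andP[ms us] uF.
rewrite cat_uniq uF ?mem_head // IH //= => [|k ks]; last by rewrite uF // inE ks orbT.
rewrite andbT; apply/hasPn => x /flatten_mapP[k ks /gF gx].
by apply/negP => /gF gx'; rewrite -gx' gx ks in ms.
Qed.

Lemma ptrees_uniq n : uniq (ptrees n).
Proof.
rewrite /ptrees; move: {1}n => d; elim: d n => [|d IH] n /=.
  by case: eqP.
have fP l m f : f \in pforests (ptrees_rec d) l m -> size f = l.
  by rewrite mem_pforests => [/and3P[/eqP]|] //; exact: ptrees_recP.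
have uf l m : uniq (pforests (ptrees_rec d) l m).
  elim: l m => [|l IHl] m /=; first by case: eqP.
  apply: (@uniq_flatten_key _ (fun f => leaves (head PLeaf f))).
  - exact: iota_uniq.
  - by move=> k _; apply: allpairs_uniq => // -[a b] [a' b'] _ _ /= [-> ->].
  - move=> k x /allpairsP[[a b] /= [ak _ ->]] /=; exact: (ptrees_recP ak).
rewrite cat_uniq; apply/and3P; split; first by case: eqP.
  apply/hasPn => x /flatten_mapP[l _]; rewrite mem_pmap => /mapP[f _] /esym/eqP.
  by rewrite pgraftE; case: x => // t1 t2 ts _; case: eqP.
apply: (@uniq_flatten_key _ (fun t => if t is PNode _ _ ts then (size ts).+2 else 0%N)).
- exact: iota_uniq.
- move=> l l2; rewrite -(map_inj_uniq Some_inj) pmapS_filter.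
  have -> : [seq x <- pforests (ptrees_rec d) l n | pgraft x]
     = pforests (ptrees_rec d) l n.
    apply/all_filterP/allP => f /fP.
    move: l2; rewrite mem_iota => /andP[l2 _]; case: f => [|a [|b f]] //= sf; by rewrite -sf in l2.
  rewrite map_inj_in_uniq // => f g /fP sf /fP sg.
  move: l2; rewrite mem_iota => /andP[l2 _].
  by case: f sf => [|a [|b f]] /= sf; rewrite -?sf // in l2 *;
     case: g sg => [|a' [|b' g]] //= sg; rewrite -?sg // in l2 *; case=> -> -> ->.
- move=> l x; rewrite mem_pmap => /mapP[f /fP <-] /esym/eqP.
  by rewrite pgraftE; case: x => // t1 t2 ts /eqP->.
Qed.

(* ------------------------------------------------------------------------ *)

Section Transfer.

Context {F : fieldType}.

(* rho_T; the value at the trivial tree is not used, as the branches of a   *)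
(* grafting that are trivial are replaced by the identity.                  *)
Fixpoint rho_tree (A : gradedModule F) (rho : nat -> seq A -> {lpoly A})
    (h : A -> A) (t : ptree) : seq A -> {lpoly A} :=
  match t with
  | PLeaf => fun a => (head 0 a)%:MP
  | PNode t1 t2 ts =>
    let branch u :=
      if u is PLeaf then lid A
      else (leaves u, fun a => lmap h (rho_tree rho h u a)) in
    graft (rho (size ts).+2) (branch t1 :: branch t2 :: map branch ts)
  end.

Definition shifted_maps (A : gradedModule F) (mu : nat -> seq A -> {lpoly A})
    (k : nat) (x : seq (shift A)) : {lpoly (shift A)} :=
  lmap (@susp F A) (mu k (koszul_map (-1) (@desusp F A) x)).

Definition theta (A H : chainComplex F) (p : A -> H) (i : H -> A) (h : A -> A)
    (mu : nat -> seq A -> {lpoly A}) (k : nat) (y : seq (shift H)) :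
    {lpoly (shift H)} :=
  lmap (sconj p)
    (\sum_(t <- ptrees k)
        rho_tree (shifted_maps mu) (sconj h) t (map (sconj i) y)).

Record transferred_maps (A H : chainComplex F) (p : A -> H) (i : H -> A)
    (h : A -> A) (mu : nat -> seq A -> {lpoly A})
    (nu : nat -> seq H -> {lpoly H}) : Prop := TransferredMaps {
  transferred1 : forall y : H, nu 1%N [:: y] = (cdiff H y)%:MP;
  transferredE : forall (k : nat) (y : seq (shift H)),
    (1 < k)%N -> size y = k -> theta p i h mu k y = shifted_maps nu k y }.

Lemma lmap_id (V : zmodType) (f : {lpoly V}) : lmap id f = f.
Proof. exact/esym/monalgE. Qed.

Lemma transferred_maps_exist (A H : chainComplex F) (p : A -> H) (i : H -> A)
    (h : A -> A) (mu : nat -> seq A -> {lpoly A}) :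
  exists nu, transferred_maps p i h mu nu.
Proof.
pose unkoszul (a : seq H) : seq (shift H) := mkseq (fun j =>
  @twist F (shift H) (size a - j.+1)%N%:Z (@susp F H (nth 0 a j))) (size a).
exists (fun k a => if k == 1%N then (cdiff H (head 0 a))%:MP else
  lmap (@desusp F H) (theta p i h mu k (unkoszul a))).
split=> [y|k y k1 sy]; first by [].
rewrite /shifted_maps (gtn_eqF k1).
have -> : unkoszul (koszul_map (-1) (@desusp F H) y) = y.
  rewrite /unkoszul /koszul_map size_mkseq; apply: (@eq_from_nth _ 0).
    by rewrite size_mkseq.
  move=> j; rewrite size_mkseq => jy; rewrite !nth_mkseq // mulN1r.
  by rewrite -[X in twist X]opprK /susp /desusp twist_twistN.
set f := theta _ _ _ _ _ _.
by rewrite [RHS](lmap_id (V := shift H)) [RHS](lmap_id (V := shift H)).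
Qed.

End Transfer.

(* Main.v *)
Require Import Defs.
From HB Require Import structures.
From mathcomp Require Import all_boot all_order all_algebra.
From mathcomp Require Import finmap monalg complex reals.
From mathcomp Require Import ring zify.

(* Attach to every argument x the parameter c that it carries. A conformal map
   f then acts on words in the letters (x, c), with x in A[lambda] and c in
   C[lambda]: extend f linearly in the lambdas, substitute the c's for its
   subscripts, and give the value the sum of the c's as its parameter. In this
   language grafting is plain composition of functions, and the Koszul signs are
   absorbed into the involution tau : x |-> (-1)^|x| x, so that the A-infinity
   relations of the shifted maps rho say that the sum of the
   rho(tau u, rho(v), w) over all factorizations u v w of a word vanishes.

   Let F be the sum of the rho_T over planar trees, and let Phi be the identity
   on letters and h F on longer words, so that F is the sum of the
   rho(Phi b_1, ..., Phi b_l) over the decompositions into l >= 2 blocks. Put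
   e = i p = 1 + d h + h d, let theta be d on letters and e F on longer words,
   and let X = d F + F o theta, where F o theta is the sum of the
   F(tau u, theta v, w). A direct computation gives
     sum_(l >= 1) rho(Phi, ..., Phi) - Phi o theta = - h X,
   so the relations for rho turn X into a sum of terms
   rho(tau Phi, ..., h X, ..., Phi) with X evaluated at shorter words, and X = 0
   by induction. Composing with p and i yields the relations on H.

   Sesquilinearity becomes a statement on D : (x, c) |-> (d x + c x, c), where d
   is the derivation: f vanishes when D is applied to a letter other than the
   last and commutes with D at the last one, which is stable under composition. *)

Set Implicit Arguments.
Unset Strict Implicit.
Unset Printing Implicit Defensive.

Import Order.TTheory GRing.Theory Num.Theory.

Local Open Scope fset_scope.
Local Open Scope ring_scope.

(** * Factorizations of words *)

Section Deconcatenation.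
Variables (R : zmodType).

(** The obstacle is the bookkeeping of subscripts: in a nested composition an inner value enters
    with the sum of the lambdas of its block, except at the last place, which has no subscript. Here
    every letter carries a parameter, the last one too. It is invisible to the map applied, whose
    values do not contain that variable, but it counts in the weight of the result, which matters as
    soon as this result becomes an interior argument. So all places are treated alike.

    The formula for [- h X] rests on [e = 1 + d h + h d]: on words with two or more letters the sum
    of the [rho(Phi, ..., Phi)] is [F + d h F], its one-block term being [d (h F)], while
    [Phi o theta] is [e F + h (F o theta)]. The induction closes because [F] has only terms with two
    or more blocks, so that the block receiving [theta] is a proper subword. Trees enter only
    through the recursion of [F] over decompositions. On [H] the link is that [theta], built with
    [i p F] and not with [F], is at a word coming from [H] just [i] of the transferred map. *)

Definition cut (S : Type) (G : seq S -> seq S -> R) (w : seq S) : R :=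
  \sum_(0 <= i < (size w).+1) G (take i w) (drop i w).

(** An empty middle word contributes 0, since the relations contain no operation without inputs. *)
Definition ins (S : Type) (G : seq S -> seq S -> seq S -> R) : seq S -> R :=
  cut (fun u r => cut (fun v w => if v is [::] then 0 else G u v w) r).

Lemma cut0 (S : Type) (G : seq S -> seq S -> R) : cut G [::] = G [::] [::].
Proof. by rewrite /cut big_nat1. Qed.

Lemma cut_cons (S : Type) (G : seq S -> seq S -> R) x (w : seq S) :
  cut G (x :: w) = G [::] (x :: w) + cut (fun u v => G (x :: u) v) w.
Proof. by rewrite /cut big_nat_recl. Qed.

Lemma eq_cut (S : Type) (G G' : seq S -> seq S -> R) (w : seq S) :
  (forall u v, u ++ v = w -> G u v = G' u v) -> cut G w = cut G' w.
Proof. by move=> eqG; apply: eq_bigr => i _; apply: eqG; rewrite cat_take_drop. Qed.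

Lemma cutD (S : Type) (G G' : seq S -> seq S -> R) (w : seq S) :
  cut (fun u v => G u v + G' u v) w = cut G w + cut G' w.
Proof. by rewrite /cut big_split. Qed.

Lemma cut_const0 (S : Type) (w : seq S) : cut (fun _ _ : seq S => 0) w = 0.
Proof. by rewrite /cut big1. Qed.

Lemma cut_sum (S : Type) (I : Type) (r : seq I) (G : I -> seq S -> seq S -> R) (w : seq S) :
  cut (fun u v => \sum_(i <- r) G i u v) w = \sum_(i <- r) cut (G i) w.
Proof. by rewrite /cut exchange_big. Qed.

Lemma cut_map (S S' : Type) (f : S' -> S) (G : seq S -> seq S -> R) (w : seq S') :
  cut G (map f w) = cut (fun u v => G (map f u) (map f v)) w.
Proof. by rewrite /cut size_map; apply: eq_bigr => i _; rewrite map_take map_drop. Qed.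

Lemma cut_coassoc (S : Type) (G : seq S -> seq S -> seq S -> R) (w : seq S) :
  cut (fun u r => cut (fun u1 u2 => G u1 u2 r) u) w =
  cut (fun u1 r => cut (fun u2 r' => G u1 u2 r') r) w.
Proof.
elim: w G => [|x w IH] G; first by rewrite !cut0.
rewrite !cut_cons cut0 -IH -addrA -cutD; congr (_ + _).
by apply: eq_cut => u v _; rewrite cut_cons.
Qed.

Lemma cut_nil (S : Type) (G : seq S -> seq S -> R) (w : seq S) :
  cut G w = G [::] w + cut (fun u v => if u is [::] then 0 else G u v) w.
Proof.
case: w => [|x w]; first by rewrite !cut0 addr0.
by rewrite !cut_cons add0r.
Qed.

Lemma ins0 (S : Type) (G : seq S -> seq S -> seq S -> R) : ins G [::] = 0.
Proof. by rewrite /ins !cut0. Qed.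

Lemma eq_ins (S : Type) (G G' : seq S -> seq S -> seq S -> R) (w : seq S) :
  (forall u v r, u ++ v ++ r = w -> v <> [::] -> G u v r = G' u v r) ->
  ins G w = ins G' w.
Proof.
move=> eqG; apply: eq_cut => u r' e; apply: eq_cut => -[|x v] r // e'.
by apply: eqG => //; rewrite e' e.
Qed.

Lemma insD (S : Type) (G G' : seq S -> seq S -> seq S -> R) (w : seq S) :
  ins (fun u v r => G u v r + G' u v r) w = ins G w + ins G' w.
Proof.
rewrite /ins -cutD; apply: eq_cut => u r _; rewrite -cutD.
by apply: eq_cut => -[|x v] r' _; rewrite ?addr0.
Qed.

Lemma ins_eq0 (S : Type) (G : seq S -> seq S -> seq S -> R) (w : seq S) :
  (forall u v r, u ++ v ++ r = w -> v <> [::] -> G u v r = 0) -> ins G w = 0.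
Proof.
move=> G0; rewrite (eq_ins (G' := fun _ _ _ => 0)) //.
rewrite /ins -[RHS](cut_const0 w); apply: eq_cut => u r _.
by rewrite -[RHS](cut_const0 r); apply: eq_cut => -[].
Qed.

Lemma ins_map (S S' : Type) (f : S' -> S) (G : seq S -> seq S -> seq S -> R) (w : seq S') :
  ins G (map f w) = ins (fun u v r => G (map f u) (map f v) (map f r)) w.
Proof.
rewrite /ins cut_map; apply: eq_cut => u r _; rewrite cut_map.
by apply: eq_cut => -[].
Qed.

(** Writes a single value at [w] as a sum over factorizations, so that it can be merged with another
    [ins] term by term. *)
Lemma ins_whole (S : Type) (G : seq S -> R) (w : seq S) : w <> [::] ->
  ins (fun u v r => if (u, r) is ([::], [::]) then G v else 0) w = G w.
Proof.
move=> w0; rewrite /ins cut_nil [X in _ + X](_ : _ = 0) ?addr0; last first.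
  rewrite -[RHS](cut_const0 w); apply: eq_cut => -[|x u] r _ //.
  by rewrite -[RHS](cut_const0 r); apply: eq_cut => -[].
elim: w G w0 => // x w IH G _; rewrite cut_cons add0r.
case: w IH => [|y w] IH; first by rewrite cut0.
rewrite cut_cons add0r -(IH (fun v => G (x :: v))) // [RHS]cut_nil add0r.
by rewrite cut_cons add0r.
Qed.

(** Both sides run over the factorizations of [w] into [u1 u2 v r1 r2] with [v] nonempty: on the
    left [v] is marked before its surroundings are cut, on the right the block [u2 v r1] is marked
    before [v] inside it. *)
Lemma ins_reassoc (S : Type)
    (G : seq S -> seq S -> seq S -> seq S -> seq S -> R) (w : seq S) :
  ins (fun u v r => cut (fun u1 u2 => cut (fun r1 r2 => G u1 u2 v r1 r2) r) u) w =
  ins (fun u1 b r2 => ins (fun u2 v r1 => G u1 u2 v r1 r2) b) w.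
Proof.
(* With the condition on [v] moved into the summand, plain coassociativity of [cut] applies. *)
pose G' u1 u2 v r1 r2 := if v is [::] then 0 else G u1 u2 v r1 r2.
transitivity (cut (fun u r' => cut (fun u1 u2 => cut (fun v r =>
    cut (fun r1 r2 => G' u1 u2 v r1 r2) r) r') u) w).
  apply: eq_cut => u r' _.
  rewrite {2}/cut [RHS]/cut exchange_big /=.
  apply: eq_big_nat => i _; case: (take i r') => [|x v]; last by [].
  by rewrite big1 // => j _; rewrite cut_const0.
rewrite (cut_coassoc (fun u1 u2 r' => cut (fun v r => cut (fun r1 r2 =>
   G' u1 u2 v r1 r2) r) r')).
apply: eq_cut => u1 r' _.
transitivity (cut (fun b r2 => cut (fun u2 c => cut (fun v r1 =>
   G' u1 u2 v r1 r2) c) b) r').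
  rewrite (cut_coassoc (fun u2 c r2 => cut (fun v r1 => G' u1 u2 v r1 r2) c)).
  apply: eq_cut => u2 r _.
  by rewrite (cut_coassoc (fun v r1 r2 => G' u1 u2 v r1 r2)).
(* An empty block [b] contains only an empty [v], so the test of [ins] on [b] loses nothing. *)
apply: eq_cut => -[|x b] r2 _; first by rewrite !cut0.
by [].
Qed.

Lemma cut_last (S : Type) (G : seq S -> R) (w : seq S) :
  cut (fun v r => if r is [::] then G v else 0) w = G w.
Proof.
elim: w G => [|x w IH] G; first by rewrite cut0.
by rewrite cut_cons add0r (IH (fun v => G (x :: v))).
Qed.

End Deconcatenation.

Lemma ins_morph (S : Type) (R R' : zmodType) (g : R -> R')
    (G : seq S -> seq S -> seq S -> R) w :
  {morph g : x y / x + y} -> g 0 = 0 ->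
  g (ins G w) = ins (fun u v r => g (G u v r)) w.
Proof.
move=> gD g0; rewrite /ins /cut (big_morph g gD g0); apply: eq_bigr => i _.
by rewrite (big_morph g gD g0); apply: eq_bigr => j _; case: (take j _).
Qed.

(** * Decompositions of a word into consecutive nonempty blocks *)

Section Splits.
Variables (T : eqType) (R : zmodType).
Implicit Types (w u v : seq T) (s : seq (seq T)).

(** A new first letter either forms a block of its own or joins the first block. *)
Fixpoint splits (w : seq T) : seq (seq (seq T)) :=
  if w is x :: w' then
    flatten [seq ([:: x] :: s) ::
                 (if s is b :: s' then [:: (x :: b) :: s'] else [::])
            | s <- splits w']
  else [:: [::]].

Lemma splits_cons (g : seq (seq T) -> R) x w :
  \sum_(s <- splits (x :: w)) g s =
  \sum_(s <- splits w)
    (g ([:: x] :: s) + (if s is b :: s' then g ((x :: b) :: s') else 0)).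
Proof.
rewrite /= big_flatten big_map; apply: eq_bigr => -[|b s] _.
  by rewrite big_seq1 addr0.
by rewrite big_cons big_seq1.
Qed.

Lemma splitsP w s : s \in splits w -> flatten s = w /\ [::] \notin s.
Proof.
elim: w s => [|x w IH] s /=; first by rewrite inE => /eqP->.
case/flatten_mapP => s' /IH[<- s'0]; rewrite inE => /orP[/eqP->|].
  by split=> //; rewrite inE negb_or.
case: s' s'0 => // b s' b0; rewrite inE => /eqP->; split=> //.
by move: b0; rewrite !inE !negb_or => /andP[_].
Qed.

Lemma splits_nil w : ([::] \in splits w) = (w == [::]).
Proof.
apply/idP/eqP => [/splitsP[<-] //|->]; exact: mem_head.
Qed.

Lemma splits_map (f : T -> T) w :
  splits (map f w) = [seq map (map f) s | s <- splits w].
Proof.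
elim: w => //= x w ->; rewrite map_flatten -!map_comp; congr flatten.
by apply: eq_map => -[|b s].
Qed.

(** A decomposition cut between two of its blocks is a cut of the word together with a decomposition
    of each piece. *)
Lemma splits_cut (G : seq (seq T) -> seq (seq T) -> R) w :
  \sum_(s <- splits w) cut G s =
  cut (fun u v => \sum_(s1 <- splits u) \sum_(s2 <- splits v) G s1 s2) w.
Proof.
elim: w G => [|x w IH] G; first by rewrite cut0 !big_seq1 cut0.
rewrite splits_cons cut_cons big_seq1 splits_cons.
pose G' s1 s2 := G ([:: x] :: s1) s2 +
  (if s1 is b :: s1' then G ((x :: b) :: s1') s2 else 0).
rewrite (_ : cut _ w = \sum_(s <- splits w) cut G' s); last first.
  rewrite IH; apply: eq_cut => u v _; rewrite splits_cons.
  apply: eq_bigr => -[|b s1] _; rewrite ?addr0.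
    by apply: eq_bigr => s2 _; rewrite /G' addr0.
  by rewrite -big_split.
rewrite -big_split; apply: eq_bigr => -[|b s] _ /=.
  by rewrite !(cut_cons, cut0) /G' !addr0.
rewrite !cut_cons {1}/G' addr0 cutD -!addrA; congr (_ + _).
by rewrite [RHS]addrCA; congr (_ + _); rewrite addrCA.
Qed.

Lemma splits_ins (G : seq (seq T) -> seq (seq T) -> seq (seq T) -> R) w :
  \sum_(s <- splits w) ins G s =
  ins (fun u v r => \sum_(s1 <- splits u) \sum_(s2 <- splits v)
                      \sum_(s3 <- splits r) G s1 s2 s3) w.
Proof.
rewrite splits_cut; apply: eq_cut => u r' _.
transitivity (\sum_(s1 <- splits u) cut (fun v r =>
   \sum_(s2 <- splits v) \sum_(s3 <- splits r)
     (if s2 is [::] then 0 else G s1 s2 s3)) r').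
  by apply: eq_bigr => s1 _; rewrite splits_cut.
(* The test on [s2] and the test on [v] agree: the empty decomposition belongs to the empty word
   only. *)
rewrite -cut_sum; apply: eq_cut => -[|x v] r _.
  by rewrite big1 // => s1 _; rewrite big_seq1 big1.
apply: eq_bigr => s1 _; apply: eq_big_seq => -[|b s2]; last by [].
by rewrite splits_nil.
Qed.

Lemma splits_first (G : seq T -> seq (seq T) -> R) w :
  \sum_(s <- splits w) (if s is b :: s' then G b s' else 0) =
  cut (fun v r => if v is [::] then 0 else \sum_(s <- splits r) G v s) w.
Proof.
elim: w G => [|x w IH] G; first by rewrite cut0 big_seq1.
rewrite splits_cons cut_cons add0r big_split /=.
by rewrite (IH (fun b => G (x :: b))) [RHS]cut_nil.
Qed.

(** Exactly one block contains the marked letter [x]; [u2] and [w1] are its parts before and after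
    [x], and the remaining blocks decompose [u1] and [w2]. *)
Lemma splits_middle (g : seq (seq T) -> R) u x w :
  \sum_(s <- splits (u ++ x :: w)) g s =
  cut (fun u1 u2 => cut (fun w1 w2 => \sum_(s1 <- splits u1)
     \sum_(s3 <- splits w2) g (s1 ++ (u2 ++ x :: w1) :: s3)) w) u.
Proof.
elim: u g => [|y u IH] g.
  rewrite cut0 cat0s; transitivity (\sum_(s <- splits (x :: w))
     if s is b :: s' then g (b :: s') else 0).
    by apply: eq_big_seq => -[|b s]; rewrite ?splits_nil.
  rewrite splits_first cut_cons add0r; apply: eq_cut => w1 w2 _.
  by rewrite big_seq1.
rewrite cat_cons splits_cons IH cut_cons.
rewrite [LHS]cut_nil [X in _ = _ + X]cut_nil addrA; congr (_ + _).
  rewrite -cutD; apply: eq_cut => w1 w2 _; rewrite splits_cons !big_seq1 /=.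
  by rewrite addr0 addrC big_split.
apply: eq_cut => -[|z u1] u2 _ //; apply: eq_cut => w1 w2 _.
rewrite [RHS]splits_cons; apply: eq_big_seq => -[|b s1]; first by rewrite splits_nil.
by rewrite big_split.
Qed.

End Splits.

(** * Homotopy transfer on words *)

Section WeightedWords.
Variables (M W : zmodType).
Local Notation letter := (M * W)%type.
Implicit Types (w u v : seq letter).

Definition wt w : W := \sum_(l <- w) l.2.

Definition onl (M' : zmodType) (g : M -> M') (l : letter) : M' * W := (g l.1, l.2).

Definition madd (M' : zmodType) (f : seq letter -> M') :=
  forall u v x y c, f (u ++ (x + y, c) :: v) = f (u ++ (x, c) :: v) + f (u ++ (y, c) :: v).

Lemma wt_cat u v : wt (u ++ v) = wt u + wt v.
Proof. by rewrite /wt big_cat. Qed.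

Lemma wt_cons l u : wt (l :: u) = l.2 + wt u.
Proof. by rewrite /wt big_cons. Qed.

Lemma wt_onl (g : M -> M) u : wt (map (onl g) u) = wt u.
Proof. by rewrite /wt big_map. Qed.

Lemma madd0 (M' : zmodType) (f : seq letter -> M') u v c :
  madd f -> f (u ++ (0, c) :: v) = 0.
Proof. by move=> fD; apply: (addIr (f (u ++ (0, c) :: v))); rewrite -fD addr0 add0r. Qed.

Lemma madd_sum (M' : zmodType) (f : seq letter -> M') u v c (I : Type) (r : seq I)
    (P : pred I) (G : I -> M) : madd f ->
  f (u ++ (\sum_(i <- r | P i) G i, c) :: v) = \sum_(i <- r | P i) f (u ++ (G i, c) :: v).
Proof.
move=> fD; apply: (big_morph (fun x => f (u ++ (x, c) :: v))) => [x y|].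
  exact: fD.
exact: madd0.
Qed.

End WeightedWords.

(** * The inductive proof of the transfer relation *)

Section HomotopyTransfer.
Variables (M W : zmodType).
Local Notation letter := (M * W)%type.
Implicit Types (w u v : seq letter) (s : seq (seq letter)).

Variables (rho F : seq letter -> M) (d h tau : {additive M -> M}).

Definition Phi (b : seq letter) : letter :=
  (if b is [:: l] then l.1 else h (F b), wt b).

(** The [e] of the overview is written out as [1 + d h + h d], so that no second complex is involved
    yet. *)
Definition theta_word (b : seq letter) : letter :=
  (if b is [:: l] then d l.1 else F b + d (h (F b)) + h (d (F b)), wt b).

Hypothesis rho_madd : madd rho.
Hypothesis rho1 : forall l, rho [:: l] = d l.1.
Hypothesis rho_tau : forall w, w <> [::] -> rho (map (onl tau) w) = - tau (rho w).
Hypothesis ddK : forall x, d (d x) = 0.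
Hypothesis h_tau : forall x, h (tau x) = - tau (h x).
Hypothesis rho_rel : forall w,
  ins (fun u v r => rho (map (onl tau) u ++ (rho v, wt v) :: r)) w = 0.
Hypothesis FE : forall w,
  F w = \sum_(s <- splits w) if (1 < size s)%N then rho (map Phi s) else 0.

Let T : seq letter -> seq letter := map (onl tau).

Lemma F_nil : F [::] = 0.
Proof. by rewrite FE big_seq1. Qed.

Lemma F_letter l : F [:: l] = 0.
Proof. by rewrite FE splits_cons big_seq1 /= addr0. Qed.

Lemma wt_flatten s : wt (map Phi s) = wt (flatten s).
Proof.
elim: s => [|b s IH]; first by rewrite /= /wt !big_nil.
by rewrite /= wt_cons wt_cat IH.
Qed.

Lemma size_block w s b : s \in splits w -> (1 < size s)%N -> b \in s ->
  (size b < size w)%N.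
Proof.
move=> /splitsP[<- s0]; case: s s0 => [|b1 [|b2 s]] // s0 _ bs.
have s1 c : c \in [:: b1, b2 & s] -> (0 < size c)%N.
  by case: c => // cs; rewrite cs in s0.
have le t c : c \in t -> (size c <= size (flatten t))%N.
  elim: t => //= c' t IH; rewrite inE size_cat => /orP[/eqP->|/IH ct].
    exact: leq_addr.
  exact: leq_trans ct (leq_addl _ _).
rewrite /= size_cat; move: bs; rewrite inE => /orP[/eqP->|/le bs].
  rewrite -[X in (X < _)%N]addn0 ltn_add2l size_cat addn_gt0.
  by rewrite s1 // !inE eqxx orbT.
by apply: leq_ltn_trans bs _; rewrite -[X in (X < _)%N]add0n ltn_add2r s1 // mem_head.
Qed.

(** [rho] and [h] are both odd, so [h F] is even and [Phi] commutes with [tau]; the outer [rho]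
    leaves one sign. The recursion for [F] meets only blocks shorter than [w], whence the induction
    on the length. *)
Lemma FT w : F (T w) = - tau (F w).
Proof.
have [n] := ubnP (size w); elim: n w => // n IH w; rewrite ltnS => wn.
rewrite FE [F w]FE splits_map big_map raddf_sum -sumrN; apply: eq_big_seq => s sw.
rewrite size_map; case: ifP => s1; last by rewrite raddf0 oppr0.
rewrite -rho_tau; last by case: (s) s1.
congr rho; rewrite -!map_comp; apply/eq_in_map => b bs.
rewrite /= /Phi wt_onl /onl /=; congr pair.
have := size_block sw s1 bs; case: b bs => [|l [|l' b]] bs lt_b.
- by rewrite F_nil !raddf0.
- by [].
by rewrite -(opprK (tau _)) -h_tau -raddfN -IH // (leq_trans lt_b).
Qed.

(** The quantity [X] of the overview. *)
Definition Fdefect w : M :=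
  d (F w) + ins (fun u v r => F (T u ++ theta_word v :: r)) w.

Let R w := \sum_(s <- splits w) rho (map Phi s).
Let PhiTheta w := ins (fun u v r => (Phi (T u ++ theta_word v :: r)).1) w.
(** The equation [E = 0] has the form of the equation for an A-infinity morphism [Phi] from [theta]
    to [rho]. *)
Let E w := R w - PhiTheta w.

(* F has no one-block term, hence the 0. *)
Let K s1 (x : M) c s3 : M :=
  if (s1, s3) is ([::], [::]) then 0
  else rho (T (map Phi s1) ++ (x, c) :: map Phi s3).

Let KD s1 x y c s3 : K s1 (x + y) c s3 = K s1 x c s3 + K s1 y c s3.
Proof.
rewrite /K; case: s1 => [|b1 s1]; case: s3 => [|b3 s3]; last 3 first.
- exact: rho_madd.
- exact: rho_madd.
- exact: rho_madd.
by rewrite addr0.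
Qed.

Let K0 s1 c s3 : K s1 0 c s3 = 0.
Proof. by apply: (addIr (K s1 0 c s3)); rewrite -KD addr0 add0r. Qed.

(** The terms of [rho] at a decomposition of [w] with [f] put at one block [b] and [Phi] at the
    others, of which there is at least one. *)
Let sumK (f : seq letter -> M) w := ins (fun u b r =>
  \sum_(s1 <- splits u) \sum_(s3 <- splits r) K s1 (f b) (wt b) s3) w.

Lemma map_Phi_T u s : s \in splits u -> map Phi (map T s) = T (map Phi s).
Proof.
move=> /splitsP[_ s0]; rewrite /T -!map_comp; apply/eq_in_map => b bs.
rewrite /= /Phi /onl wt_onl /=; congr pair.
have b0 : b != [::] by apply: contraNneq s0 => <-.
case: b b0 {bs} => [|l [|l' b]] // _.
by rewrite -/(T _) FT raddfN h_tau opprK.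
Qed.

(** Expand [F] over the decompositions of the word containing the letter [theta_word v]. The block
    around that letter becomes a term of [PhiTheta], and the blocks to its left keep their [tau]
    because [Phi] commutes with it. The one-block decomposition is absent from [F] as it is from
    [K]. *)
Lemma F_theta w :
  ins (fun u v r => F (T u ++ theta_word v :: r)) w = sumK PhiTheta w.
Proof.
pose H u1 u2 v r1 r2 : M := \sum_(s1 <- splits u1) \sum_(s3 <- splits r2)
   K s1 (Phi (T u2 ++ theta_word v :: r1)).1 (wt (u2 ++ v ++ r1)) s3.
transitivity (ins (fun u v r => cut (fun u1 u2 => cut (fun r1 r2 =>
    H u1 u2 v r1 r2) r) u) w).
  apply: eq_ins => u v r _ _.
  rewrite FE splits_middle cut_map; apply: eq_cut => u1 u2 _.
  apply: eq_cut => r1 r2 _; rewrite splits_map big_map.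
  apply: eq_big_seq => s1 us1; apply: eq_bigr => s3 _.
  rewrite map_cat (map_Phi_T us1) size_cat size_map /= /K /T.
  have -> : Phi (map (onl tau) u2 ++ theta_word v :: r1) =
     ((Phi (map (onl tau) u2 ++ theta_word v :: r1)).1, wt (u2 ++ v ++ r1)).
    by rewrite {1}/Phi !wt_cat wt_cons wt_onl.
  by case: (s1) => [|b1 s1']; case: (s3) => [|b3 s3']; rewrite ?addnS.
rewrite ins_reassoc; apply: eq_ins => u1 b r2 _ _.
rewrite /H; rewrite (_ : ins _ b = ins (fun u2 v r1 => \sum_(s1 <- splits u1)
  \sum_(s3 <- splits r2) K s1 (Phi (T u2 ++ theta_word v :: r1)).1 (wt b) s3) b); last first.
  by apply: eq_ins => u2 v r1 -> _.
pose g x := \sum_(s1 <- splits u1) \sum_(s3 <- splits r2) K s1 x (wt b) s3.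
rewrite -(ins_morph (g := g)) //.
  move=> x y; rewrite /g -big_split; apply: eq_bigr => s1 _.
  by rewrite -big_split; apply: eq_bigr => s3 _; rewrite KD.
by rewrite /g big1 // => s1 _; rewrite big1 // => s3 _; rewrite K0.
Qed.

(** The relation for [rho] at the word [map Phi s], summed over all decompositions [s]: grouping the
    middle blocks turns the inner [rho] into [R b]. *)
Lemma rho_R w : ins (fun u b r => \sum_(s1 <- splits u) \sum_(s3 <- splits r)
  rho (T (map Phi s1) ++ (R b, wt b) :: map Phi s3)) w = 0.
Proof.
transitivity (\sum_(s <- splits w) ins (fun s1 s2 s3 =>
   rho (T (map Phi s1) ++ (rho (map Phi s2), wt (map Phi s2)) :: map Phi s3)) s).
  rewrite splits_ins; apply: eq_ins => u b r _ _; apply: eq_bigr => s1 _.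
  rewrite exchange_big; apply: eq_bigr => s3 _ /=; rewrite madd_sum //.
  by apply: eq_big_seq => s2 /splitsP[<- _]; rewrite wt_flatten.
by apply: big1 => s _; rewrite -(ins_map Phi (fun u v r => rho (T u ++ (rho v, wt v) :: r))).
Qed.

(** In [rho_R] the term with [b = w] is [rho] of the single letter [R w], that is [d (R w)]; the
    others form [sumK R]. *)
Lemma sumKR w : w <> [::] -> sumK R w = - d (R w).
Proof.
move=> w0; apply/eqP; rewrite -addr_eq0; apply/eqP.
rewrite -[RHS](rho_R w) -(rho1 (R w, wt w)).
rewrite -(ins_whole (fun b => rho [:: (R b, wt b)]) w0) -insD.
apply: eq_ins => u b r _ _.
have -> : (if (u, r) is ([::], [::]) then rho [:: (R b, wt b)] else 0) =
   \sum_(s1 <- splits u) \sum_(s3 <- splits r)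
     if (s1, s3) is ([::], [::]) then rho [:: (R b, wt b)] else 0.
  case: u => [|l u]; last first.
    by rewrite big_seq big1 // => -[|b1 s1]; rewrite ?splits_nil // big1.
  rewrite big_seq1; case: r => [|l r]; first by rewrite big_seq1.
  by rewrite big_seq big1 // => -[|b1 s1]; rewrite ?splits_nil.
rewrite -big_split; apply: eq_bigr => s1 _.
rewrite -big_split; apply: eq_bigr => s3 _; rewrite /K.
by case: s1 => [|b1 s1]; case: s3 => [|b3 s3]; rewrite /= ?add0r ?addr0.
Qed.

(** The decompositions with two or more blocks give [F], the single block gives the other term. *)
Lemma RE w : w <> [::] -> R w = F w + rho [:: Phi w].
Proof.
move=> w0; rewrite FE.
rewrite -(cut_last (fun v => rho [:: Phi v]) w).
have -> : cut (fun v (r : seq letter) => if r is [::] then rho [:: Phi v] else 0) w =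
  cut (fun v r => if v is [::] then 0 else
         \sum_(s <- splits r) if s is [::] then rho [:: Phi v] else 0) w.
  apply: eq_cut => v r e; case: r e => [|l r] e.
    rewrite big_seq1; case: v e => // e; by rewrite -e in w0.
  by case: v {e} => // l' v; rewrite big_seq big1 // => -[|b s]; rewrite ?splits_nil.
rewrite -(splits_first (fun v s => if s is [::] then rho [:: Phi v] else 0)) -big_split.
apply: eq_big_seq => s; case: s => [|b [|b' s]] /=; rewrite ?addr0 ?add0r //.
by case: (w) w0 => // l w' _; rewrite splits_nil.
Qed.

(** [Phi] is [h F] except on one-letter words. The word [T u ++ theta_word v :: r] has one letter
    only for [v = w], and [F] vanishes there, so that the two terms do not overlap. *)
Lemma PhiThetaE w : w <> [::] -> PhiTheta w =
  (theta_word w).1 + h (ins (fun u v r => F (T u ++ theta_word v :: r)) w).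
Proof.
move=> w0; rewrite -(ins_whole (fun b => (theta_word b).1) w0).
rewrite (ins_morph _ _ (raddfD h) (raddf0 h)) -insD; apply: eq_ins => u v r _ _.
case: u => [|l u]; last by case: u r => [|l' u] [|l'' r]; rewrite add0r.
by case: r => [|l r]; rewrite ?add0r //= F_letter raddf0 addr0.
Qed.

Lemma EE w : w <> [::] -> E w = - h (Fdefect w).
Proof.
move=> w0; rewrite /E RE // PhiThetaE // rho1 /Fdefect raddfD.
case: w w0 => [|l [|l' w]] // _ /=.
  by rewrite F_letter !raddf0 !add0r opprD addrA subrr add0r.
set ins0 := ins _ _; rewrite !opprD !addrA.
by rewrite [F _ + d _]addrC addrK subrr add0r.
Qed.

(** Write [PhiTheta] as [R - E]. The part [sumK E] sees [E] only at proper blocks, where it vanishes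
    by [EE] and induction. There remains [d (F w) - d (R w)], which is 0 by [RE] and the vanishing
    of [d d]. *)
Theorem transfer_relation w : Fdefect w = 0.
Proof.
have [n] := ubnP (size w); elim: n w => // n IH w; rewrite ltnS => wn.
case: (w =P [::]) => [->|w0]; first by rewrite /Fdefect ins0 F_nil raddf0 addr0.
have E0 b : (size b < size w)%N -> b <> [::] -> E b = 0.
  by move=> bw b0; rewrite EE // IH ?raddf0 ?oppr0 // (leq_trans bw).
have KE : sumK E w = 0.
  apply: ins_eq0 => u b r e b0; rewrite big_seq big1 // => s1 us1.
  rewrite big_seq big1 // => s3 rs3.
  have [/E0 ->|] := boolP (size b < size w)%N; rewrite ?K0 //.
  (* A block as long as [w] leaves no other block, and then [K] is 0 by definition. *)
  rewrite -e !size_cat -leqNgt addnCA -[X in (_ <= X)%N]addn0 leq_add2l leqn0.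
  rewrite addn_eq0 !size_eq0 => /andP[/eqP u0 /eqP r0].
  by move: us1 rs3; rewrite u0 r0 !inE => /eqP-> /eqP->.
rewrite /Fdefect F_theta.
have -> : sumK PhiTheta w = sumK R w - sumK E w.
  apply/eqP; rewrite eq_sym subr_eq eq_sym; apply/eqP.
  rewrite -insD; apply: eq_ins => u b r _ _.
  rewrite -big_split; apply: eq_bigr => s1 _.
  by rewrite -big_split; apply: eq_bigr => s3 _ /=; rewrite -KD /E addrC subrK.
rewrite KE subr0 sumKR // RE // rho1 raddfD ddK addr0 subrr //.
Qed.

End HomotopyTransfer.

(** * Sums over planar trees *)

Lemma eq_pforests (tr tr' : nat -> seq ptree) l n :
  (forall m, (m <= n)%N -> tr m = tr' m) -> pforests tr l n = pforests tr' l n.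
Proof.
elim: l n => //= l IH n eq_tr; congr flatten; apply/eq_in_map => m.
rewrite mem_iota add1n ltnS => /andP[m0 mn]; rewrite eq_tr // IH // => k kn.
by rewrite eq_tr // (leq_trans kn) // leq_subr.
Qed.

Lemma pforestsS (tr : nat -> seq ptree) l n : pforests tr l.+1 n =
  flatten [seq [seq t :: f | t <- tr m, f <- pforests tr l (n - m)] | m <- iota 1 n].
Proof. by []. Qed.

(** In a forest of at least two trees every tree has fewer leaves than the forest; if the first one
    took all [n] leaves, none would be left for the others and the list of forests is empty. *)
Lemma eq_pforests2 (tr tr' : nat -> seq ptree) l n :
  (forall m, (m < n)%N -> tr m = tr' m) -> pforests tr l.+2 n = pforests tr' l.+2 n.
Proof.
move=> eq_tr; rewrite !(pforestsS _ l.+1); congr flatten; apply/eq_in_map => m.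
rewrite mem_iota add1n ltnS (leq_eqVlt m) => /andP[m0 /orP[/eqP->|mn]].
  have allp0 s : [seq t :: f | t <- s, f <- ([::] : seq (seq ptree))] = [::].
    by elim: s.
  by rewrite subnn /= !allp0.
rewrite eq_tr // (@eq_pforests tr tr') //= => k kn.
by rewrite eq_tr // (leq_ltn_trans kn) // -[X in (_ < X)%N]subn0 ltn_sub2l // (leq_ltn_trans _ mn).
Qed.

Lemma ptrees_recS d n : ptrees_rec d.+1 n =
  (if n == 1%N then [:: PLeaf] else [::]) ++
  flatten [seq pmap pgraft (pforests (ptrees_rec d) l n) | l <- iota 2 n].
Proof. by []. Qed.

(** Every internal vertex has two or more inputs, so the height of a tree with [n] leaves is at most
    [n], and a larger bound adds nothing. *)
Lemma ptrees_rec_stable d n : (n <= d)%N -> ptrees_rec d n = ptrees n.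
Proof.
have [k] := ubnP n; elim: k n d => // k IH [|n] d; rewrite ltnS.
  by case: d.
move=> nk nd; case: d nd => // d; rewrite ltnS => nd.
rewrite /ptrees !ptrees_recS; congr cat.
congr flatten; apply/eq_in_map => -[|[|l]]; rewrite mem_iota // => _.
rewrite (@eq_pforests2 _ (ptrees_rec n)) // => m; rewrite ltnS => mn.
by rewrite !IH // ?(leq_trans mn) // (leq_trans _ nk).
Qed.

Lemma ptreesE n : (1 < n)%N ->
  ptrees n = flatten [seq pmap pgraft (pforests ptrees l n) | l <- iota 2 n].
Proof.
case: n => [|[|n]] // _; rewrite {1}/ptrees ptrees_recS cat0s.
congr flatten; apply/eq_in_map => -[|[|l]]; rewrite mem_iota // => _.
by congr pmap; apply: eq_pforests2 => m; rewrite ltnS; apply: ptrees_rec_stable.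
Qed.

Lemma ptrees1 : ptrees 1 = [:: PLeaf].
Proof. by []. Qed.

Lemma ptrees_leaf n t : (1 < n)%N -> t \in ptrees n -> t != PLeaf.
Proof. by move=> n1; rewrite mem_ptrees; case: t => //= /eqP e; rewrite -e in n1. Qed.

Section TreeSums.
Variables (M W : zmodType).
Local Notation letter := (M * W)%type.
Variables (rho : seq letter -> M) (rhoT : ptree -> seq letter -> M) (h : {additive M -> M}).

Definition branch_value (t : ptree) (b : seq letter) : M :=
  if t is PLeaf then (head (0, 0) b).1 else h (rhoT t b).

Definition forest_values (f : seq ptree) (w : seq letter) : seq letter :=
  [seq (branch_value q.1 q.2, wt q.2) | q <- zip f (reshape (map leaves f) w)].

Hypothesis rho_madd : madd rho.
Hypothesis rhoT_node : forall t1 t2 ts w, size w = leaves (PNode t1 t2 ts) ->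
  rhoT (PNode t1 t2 ts) w = rho (forest_values [:: t1, t2 & ts] w).

Let PhiF b : letter := (\sum_(t <- ptrees (size b)) branch_value t b, wt b).

(** The trees on different blocks are chosen independently, so by additivity in each letter the sum
    over forests can be carried out block by block. The map [g] is arbitrary because the induction
    absorbs the first letter into it. *)
Lemma sum_pforests (g : seq letter -> M) l w : madd g ->
  \sum_(f <- pforests ptrees l (size w)) g (forest_values f w) =
  \sum_(s <- splits w) if size s == l then g (map PhiF s) else 0.
Proof.
elim: l g w => [|l IH] g w gD.
  rewrite /=; case: w => [|x w]; first by rewrite !big_seq1.
  rewrite big_nil big_seq big1 // => s; case: s => [|b s] //.
  by rewrite splits_nil.
transitivity (\sum_(s <- splits w) if s is b :: s' then
   if size s' == l then g (PhiF b :: map PhiF s') else 0 else 0); last first.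
  by apply: eq_bigr => -[|b s].
rewrite (splits_first (fun b s' => if size s' == l then g (PhiF b :: map PhiF s') else 0)).
rewrite /= big_flatten big_map [RHS]big_nat_recl // take0 add0r.
have -> : iota 1 (size w) = index_iota 1 (size w).+1 by rewrite /index_iota subSS subn0.
rewrite big_add1 /=; apply: eq_big_nat => m /andP[_ mw].
case tE: (take m.+1 w) => [|x v]; first by case: (w) tE mw.
rewrite -tE big_allpairs_dep /=.
transitivity (\sum_(t <- ptrees m.+1) \sum_(s <- splits (drop m.+1 w))
   if size s == l then g ((branch_value t (take m.+1 w), wt (take m.+1 w)) :: map PhiF s) else 0).
  apply: eq_big_seq => t; rewrite mem_ptrees => /eqP tm.
  rewrite -size_drop -(IH (fun r => g ((branch_value t (take m.+1 w), wt (take m.+1 w)) :: r))).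
    by apply: eq_bigr => f _; rewrite /forest_values /= tm.
  by move=> u r a b c; rewrite -!cat_cons gD.
rewrite exchange_big; apply: eq_bigr => s _; case: eqP => _; last by rewrite big1.
rewrite /PhiF size_takel // -/PhiF.
by rewrite (madd_sum [::] (map PhiF s) _ _ _ _ gD).
Qed.

Definition tree_sum (w : seq letter) : M :=
  if (1 < size w)%N then \sum_(t <- ptrees (size w)) rhoT t w else 0.

Lemma PhiF_Phi b : b != [::] -> PhiF b = Phi tree_sum h b.
Proof.
case: b => [|l [|l' b]] // _; first by rewrite /PhiF ptrees1 big_seq1.
rewrite /PhiF /Phi /tree_sum /= raddf_sum; congr pair; apply: eq_big_seq => t.
by move/ptrees_leaf => /(_ isT); case: t.
Qed.

(** Sorting the trees by the number of inputs of the root yields the recursion that the transfer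
    relation requires of [F]. *)
Lemma tree_sumE w : tree_sum w =
  \sum_(s <- splits w) if (1 < size s)%N then rho (map (Phi tree_sum h) s) else 0.
Proof.
have size_splits s : s \in splits w -> (size s <= size w)%N.
  move=> /splitsP[<-]; elim: s => //= b s IH; rewrite inE negb_or => /andP[b0 /IH].
  by rewrite size_cat -add1n; apply: leq_add; case: b b0.
rewrite /tree_sum; case: ltnP => [w1|w1]; last first.
  by rewrite big_seq big1 // => s /size_splits sw; rewrite ltnNge (leq_trans sw w1).
rewrite ptreesE // big_flatten big_map.
transitivity (\sum_(l <- iota 2 (size w)) \sum_(s <- splits w)
   if size s == l then rho (map PhiF s) else 0).
  apply: eq_big_seq => l; rewrite mem_iota => /andP[l1 _].
  rewrite -sum_pforests //.
  have fP f : f \in pforests ptrees l (size w) ->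
      (size f == l) && (sumn (map leaves f) == size w).
    by rewrite mem_pforests => [/and3P[-> ->]|m t]; last exact: ptrees_recP.
  (* [pmap pgraft] drops no forest here, since each has [l >= 2] trees. *)
  elim: (pforests _ _ _) fP => [|f r IH] fP; first by rewrite !big_nil.
  have := fP f (mem_head _ _); rewrite big_cons.
  case: f fP => [|t1 [|t2 f]] /= fP; [by case: l l1 {IH fP}|by case: l l1 {IH fP} => [|[]]|].
  move=> /andP[_ /eqP sw]; rewrite big_cons rhoT_node /=; last by rewrite -sw addnA.
  by rewrite IH // => f' f'r; apply: fP; rewrite inE f'r orbT.
rewrite exchange_big; apply: eq_big_seq => s sw /=.
have mapE : map PhiF s = map (Phi tree_sum h) s.
  apply/eq_in_map => b bs; apply: PhiF_Phi.
  by apply: contraTneq bs => ->; have [] := splitsP sw.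
rewrite mapE -big_mkcond /=; have [s1|s1] := ltnP 1 (size s); last first.
  rewrite big_seq_cond big1 // => l; rewrite mem_iota => /andP[/andP[l1 _] /eqP sl].
  by rewrite -sl ltnNge s1 in l1.
(* Only [l = size s] contributes; it lies in the range from 2 to [size w + 1]. *)
rewrite (big_rem (size s)) /=; last first.
  by rewrite mem_iota s1 add2n ltnS (leq_trans (size_splits _ sw)).
rewrite eqxx big_seq_cond big1 ?addr0 // => l; rewrite mem_rem_uniq ?iota_uniq //.
by rewrite inE => /andP[/andP[/eqP lNs _] /eqP sl]; case: lNs.
Qed.

End TreeSums.

(** * Polynomials in the lambdas *)

(* Sealed copies: unification diverges when it unfolds the originals. *)
HB.lock Definition mono (K : choiceType) (G : zmodType) (k : K) (x : G) : {malg G[K]} :=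
  mkmalgU k x.
HB.lock Definition coefmap (V W : zmodType) (g : V -> W) (f : {lpoly V}) : {lpoly W} :=
  lmap g f.
HB.lock Definition lact (F : fieldType) (V : lmodType {poly F}) (p : {lpoly F})
  (f : {lpoly V}) : {lpoly V} := lscale p f.
HB.lock Definition lsub (F : fieldType) (V : lmodType {poly F}) (L : nat -> {lpoly F})
  (f : {lpoly V}) : {lpoly V} := lsubst L f.
HB.lock Definition lam (F : fieldType) (i : nat) : {lpoly F} := lvar i.
Arguments lam {F}.

Lemma mono_def : @mono = @mkmalgU. Proof. exact: mono.unlock. Qed.
Lemma coefmap_def : @coefmap = @lmap. Proof. exact: coefmap.unlock. Qed.
Lemma lact_def : @lact = @lscale. Proof. exact: lact.unlock. Qed.
Lemma lsub_def : @lsub = @lsubst. Proof. exact: lsub.unlock. Qed.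
Lemma lam_def : @lam = @lvar. Proof. exact: lam.unlock. Qed.

Section Mono.
Variables (K : choiceType) (G : zmodType).

Lemma mcoeff_mono k k' (x : G) : (mono k x)@_k' = x *+ (k == k' :> K).
Proof. by rewrite mono_def mcoeffU. Qed.

Lemma msupp_mono k (x : G) : msupp (mono k x) `<=` [fset k : K].
Proof. by rewrite mono_def msuppU_le. Qed.

Lemma mono_zmod (k : K) : zmod_morphism (@mono K G k).
Proof. by rewrite mono_def => x y; rewrite monalgUB. Qed.

HB.instance Definition _ k := GRing.isZmodMorphism.Build G {malg G[K]} (mono k) (mono_zmod k).

Lemma sum_mono (g : {malg G[K]}) : g = \sum_(k <- msupp g) mono k g@_k.
Proof. by rewrite mono_def -monalgE. Qed.

End Mono.

Lemma mulUU (R : nzRingType) (K : monomType) (c d : R) (k l : K) :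
  mono k c * mono l d = mono (mmul k l) (c * d) :> {malg R[K]}.
Proof. rewrite mono_def; exact: fgmulUU. Qed.

Lemma mono1 (R : nzRingType) (K : monomType) : mono (@mone K) (1 : R) = 1.
Proof. by rewrite mono_def. Qed.

Local Notation cst := (mono mone).

Section SumOverSupport.
Variables (K : choiceType) (V W : zmodType).
Implicit Types (G : K -> V -> W) (f : {malg V[K]}).

Definition msum G f : W := \sum_(m <- msupp f) G m f@_m.

Lemma msumEw G f (d : {fset K}) : (forall m, G m 0 = 0) -> msupp f `<=` d ->
  msum G f = \sum_(m <- d) G m f@_m.
Proof.
by move=> G0 fd; apply: big_fset_incl => // m _ /mcoeff_outdom ->; rewrite G0.
Qed.

Lemma msumD G f g : (forall m, {morph G m : x y / x + y}) ->
  msum G (f + g) = msum G f + msum G g.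
Proof.
move=> GD; have G0 m : G m 0 = 0.
  by apply: (addIr (G m 0)); rewrite -GD !add0r.
rewrite (msumEw G0 (msuppD_le f g)) (msumEw G0 (fsubsetUl _ (msupp g))).
rewrite (msumEw G0 (fsubsetUr (msupp f) _)) -big_split.
by apply: eq_bigr => m _; rewrite mcoeffD GD.
Qed.

Lemma msumU G x k : (forall m, G m 0 = 0) -> msum G (mono k x) = G k x.
Proof. by move=> G0; rewrite (msumEw G0 (msupp_mono _ _)) big_seq_fset1 mcoeff_mono eqxx. Qed.

Lemma msum0 G : msum G 0 = 0.
Proof. by rewrite /msum msupp0 big_seq_fset0. Qed.

Lemma malg_ind (P : {malg V[K]} -> Prop) : P 0 ->
  (forall f g, P f -> P g -> P (f + g)) -> (forall x k, P (mono k x)) ->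
  forall f, P f.
Proof. by move=> P0 PD PU f; rewrite [f]sum_mono; elim/big_ind: _. Qed.

End SumOverSupport.

Section Lmap.
Variables (V W : zmodType).

Lemma coefmapE (g : {additive V -> W}) (f : {lpoly V}) m : (coefmap g f)@_m = g f@_m.
Proof.
rewrite coefmap_def /lmap -mono_def raddf_sum /=; case: (msuppP f m) => [mf|/negPf mNf].
  rewrite (bigD1_seq m mf (fset_uniq _)) /= mcoeff_mono eqxx.
  by rewrite big1 ?addr0 // => k /negPf km; rewrite mcoeff_mono km.
rewrite raddf0 big_seq big1 // => k kf; rewrite mcoeff_mono.
by case: eqP kf => [->|]; rewrite ?mNf.
Qed.

Lemma coefmap_zmod (g : {additive V -> W}) : zmod_morphism (coefmap g).
Proof. by move=> x y; apply/malgP => m; rewrite mcoeffB !coefmapE mcoeffB raddfB. Qed.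

HB.instance Definition _ (g : {additive V -> W}) :=
  GRing.isZmodMorphism.Build {lpoly V} {lpoly W} (coefmap g) (coefmap_zmod g).

Lemma coefmapU (g : {additive V -> W}) x m : coefmap g (mono m x) = mono m (g x).
Proof. by apply/malgP => k; rewrite coefmapE !mcoeff_mono raddfMn. Qed.

End Lmap.

Section LambdaAction.
Variable F : fieldType.
Implicit Types (V W : lmodType {poly F}) (p q : {lpoly F}) (L : nat -> {lpoly F}).

Lemma lactE V p (f : {lpoly V}) :
  lact p f = msum (fun m c => msum (fun m' x => mono (mmul m m') (c%:P *: x)) f) p.
Proof. by rewrite lact_def mono_def. Qed.

Let lact_mono V c m (f : {lpoly V}) :
  lact (mono m c) f = msum (fun m' x => mono (mmul m m') (c%:P *: x)) f.
Proof.
rewrite lactE msumU // => k; rewrite /msum big1 // => k' _.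
by rewrite scale0r raddf0.
Qed.

Lemma lactUU V c m (x : V) m' :
  lact (mono m c) (mono m' x) = mono (mmul m m') (c%:P *: x).
Proof. by rewrite lact_mono msumU // => k; rewrite scaler0 raddf0. Qed.

Lemma lactDl V p q (f : {lpoly V}) : lact (p + q) f = lact p f + lact q f.
Proof.
rewrite !lactE msumD // => m c c'; rewrite /msum -big_split; apply: eq_bigr => k _.
by rewrite rmorphD scalerDl raddfD.
Qed.

Let lactDr V p (f g : {lpoly V}) : lact p (f + g) = lact p f + lact p g.
Proof.
rewrite !lactE -[RHS]big_split; apply: eq_bigr => m _.
by rewrite msumD // => k x y; rewrite scalerDr raddfD.
Qed.

Lemma lact_zmod V p : zmod_morphism (@lact F V p).
Proof.
have l0 : lact p (0 : {lpoly V}) = 0.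
  by apply: (addIr (lact p 0)); rewrite -lactDr !add0r.
have lN f : lact p (- f : {lpoly V}) = - lact p f.
  by apply: (addIr (lact p f)); rewrite -lactDr !addNr l0.
by move=> f g; rewrite lactDr lN.
Qed.

HB.instance Definition _ V p :=
  GRing.isZmodMorphism.Build {lpoly V} {lpoly V} (lact p) (@lact_zmod V p).

Lemma lact0l V (f : {lpoly V}) : lact 0 f = 0.
Proof. by rewrite lactE msum0. Qed.

Lemma lactNl V p (f : {lpoly V}) : lact (- p) f = - lact p f.
Proof. by apply: (addIr (lact p f)); rewrite -lactDl !addNr lact0l. Qed.

Lemma lact_suml V (I : Type) (r : seq I) (P : pred I) (p : I -> {lpoly F}) (f : {lpoly V}) :
  lact (\sum_(i <- r | P i) p i) f = \sum_(i <- r | P i) lact (p i) f.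
Proof.
exact: (big_morph (fun p => lact p f) (fun _ _ => lactDl _ _ _) (lact0l f)).
Qed.

Lemma lpoly_ind2 V (P : {lpoly F} -> {lpoly V} -> Prop) :
  (forall f, P 0 f) -> (forall p, P p 0) ->
  (forall p q f, P p f -> P q f -> P (p + q) f) ->
  (forall p f g, P p f -> P p g -> P p (f + g)) ->
  (forall c m x m', P (mono m c) (mono m' x)) -> forall p f, P p f.
Proof.
move=> P0l P0r PDl PDr PU p f; elim/malg_ind: p => // [p q|c m]; first exact: PDl.
by elim/malg_ind: f => // g g'; exact: PDr.
Qed.

Lemma lact1 V (f : {lpoly V}) : lact 1 f = f.
Proof.
elim/malg_ind: f => [|f g ef eg|x k]; rewrite ?raddf0 ?raddfD /= ?ef ?eg //.
by rewrite -mono1 lactUU scale1r mul1m.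
Qed.

Lemma lactA V p q (f : {lpoly V}) : lact p (lact q f) = lact (p * q) f.
Proof.
elim/malg_ind: p => [|p p' ep ep'|c m]; first by rewrite mul0r !lact0l.
  by rewrite mulrDl !lactDl ep ep'.
move: q f; apply: lpoly_ind2 => [f|q|q q' f eq eq'|q f g ef eg|d m' x m''].
- by rewrite mulr0 !lact0l raddf0.
- by rewrite !raddf0.
- by rewrite mulrDr !lactDl raddfD /= eq eq'.
- by rewrite !raddfD /= ef eg.
by rewrite mulUU !lactUU scalerA -polyCM mulmA.
Qed.

Lemma lactC V p q (f : {lpoly V}) : lact p (lact q f) = lact q (lact p f).
Proof. by rewrite !lactA mulrC. Qed.

Lemma coefmap_lact V W (g : {linear V -> W}) p (f : {lpoly V}) :
  coefmap g (lact p f) = lact p (coefmap g f).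
Proof.
move: p f; apply: lpoly_ind2 => [f|p|p q f ep eq|p f f' ef ef'|c m x m'].
- by rewrite !lact0l raddf0.
- by rewrite !raddf0.
- by rewrite !lactDl raddfD /= ep eq.
- by rewrite !raddfD /= ef ef'.
by rewrite lactUU !coefmapU lactUU /= linearZ.
Qed.

Lemma coefmap_scale V c (f : {lpoly V}) : coefmap ( *:%R c%:P) f = lact (cst c) f.
Proof.
elim/malg_ind: f => [|f g ef eg|x m]; rewrite ?raddf0 ?raddfD /= ?ef ?eg //.
by rewrite coefmapU lactUU mul1m.
Qed.

Definition mev L (m : {cmonom nat}) : {lpoly F} := \prod_(i <- finsupp m) L i ^+ m i.

Lemma mevEw L (m : {cmonom nat}) (d : {fset nat}) : finsupp m `<=` d ->
  mev L m = \prod_(i <- d) L i ^+ m i.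
Proof.
move=> md; apply: big_fset_incl => // i _.
by rewrite -cmE_eq0 => /eqP->; rewrite expr0.
Qed.

Lemma mev1 L : mev L mone = 1.
Proof. by rewrite /mev mdom1 big_seq_fset0. Qed.

Lemma mevM L m m' : mev L (mmul m m') = mev L m * mev L m'.
Proof.
rewrite (mevEw L (fsubsetUl (finsupp m) (finsupp m'))).
rewrite (mevEw L (fsubsetUr (finsupp m) (finsupp m'))).
rewrite /mev mdomD -[RHS]big_split.
by apply: eq_bigr => i _; rewrite cmM exprD.
Qed.

Lemma mevU L i : mev L (ucm i) = L i.
Proof. by rewrite /mev mdomU big_seq_fset1 cmUU expr1. Qed.

Lemma mev_mmorphism L : mmorphism (mev L).
Proof. by split=> [m m'|]; rewrite ?mevM ?mev1. Qed.

HB.instance Definition _ L :=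
  isMultiplicative.Build {cmonom nat} {lpoly F} (mev L) (mev_mmorphism L).

Lemma cst_monoid : monoid_morphism (@mono {cmonom nat} F mone).
Proof. by split=> [|c d]; rewrite ?mono1 // mulUU mul1m. Qed.

HB.instance Definition _ :=
  GRing.isMonoidMorphism.Build F {lpoly F} (mono mone) cst_monoid.

End LambdaAction.

(** The counterpart of [lsub] for scalar polynomials, over which [lsub] is semilinear. *)
HB.lock Definition psubst (F : fieldType) (L : nat -> {lpoly F}) (p : {lpoly F}) :
  {lpoly F} := mmap (@mono {cmonom nat} F mone) (mev L) p.

(** * Substitution for the lambdas *)

Section LambdaSubstitution.
Variable F : fieldType.
Implicit Types (V W : lmodType {poly F}) (p q : {lpoly F}) (L : nat -> {lpoly F}).

Lemma psubst_def L : psubst L =1 mmap (@mono {cmonom nat} F mone) (mev L).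
Proof. by rewrite psubst.unlock. Qed.

Lemma psubst_zmod L : zmod_morphism (psubst L).
Proof. by move=> p q; rewrite !psubst_def raddfB. Qed.

Lemma psubst_monoid L : monoid_morphism (psubst L).
Proof. by split=> [|p q]; rewrite !psubst_def ?rmorph1 ?rmorphM. Qed.

HB.instance Definition _ L :=
  GRing.isZmodMorphism.Build {lpoly F} {lpoly F} (psubst L) (psubst_zmod L).
HB.instance Definition _ L :=
  GRing.isMonoidMorphism.Build {lpoly F} {lpoly F} (psubst L) (psubst_monoid L).

Lemma psubstU L c m : psubst L (mono m c) = cst c * mev L m.
Proof.
rewrite psubst_def; apply: (msumU (G := fun k c => cst c * mev L k)) => k.
by rewrite raddf0 mul0r.
Qed.

Lemma psubstC L c : psubst L (cst c) = (cst c).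
Proof. by rewrite psubstU mev1 mulr1. Qed.

Lemma psubst_lam L i : psubst L (lam i) = L i.
Proof. by rewrite lam_def /lvar -mono_def psubstU mono1 mevU mul1r. Qed.

Lemma psubst_mev L L' m : psubst L (mev L' m) = mev (fun i => psubst L (L' i)) m.
Proof. by rewrite /mev rmorph_prod; apply: eq_bigr => i _; rewrite rmorphXn. Qed.

Lemma mev_lam m : mev (@lam F) m = mono m 1.
Proof.
have mX (a : {cmonom nat}) n : (mono a 1) ^+ n = (mono (iter n (mmul a) mone) 1) :> {lpoly F}.
  elim: n => [|n IH]; first by rewrite expr0 mono1.
  by rewrite exprS IH mulUU mulr1.
have expE (a : {cmonom nat}) n j : (iter n (mmul a) mone : {cmonom nat}) j = (n * a j)%N.
  by elim: n => [|n IH]; rewrite ?cm1 //= cmM IH mulSn.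
have prodE (r : seq nat) : \prod_(i <- r) lam i ^+ m i =
    mono (\big[mmul/mone]_(i <- r) iter (m i) (mmul (ucm i)) mone) 1 :> {lpoly F}.
  elim: r => [|i r IH]; first by rewrite !big_nil mono1.
  by rewrite !big_cons IH {1}lam_def /lvar -{1}mono_def mX mulUU mulr1.
have coefE (r : seq nat) j :
    (\big[mmul/mone]_(i <- r) iter (m i) (mmul (ucm i)) mone : {cmonom nat}) j =
    (\sum_(i <- r) iter (m i) (mmul (ucm i)) (mone : {cmonom nat}) j)%N.
  by elim: r => [|i r IH]; rewrite ?big_nil ?cm1 // !big_cons cmM IH.
rewrite /mev prodE; congr (mono _ _); apply/eqP/cmP => j; rewrite coefE.
case: (mdomP m j) => jm.
  rewrite (big_fsetD1 j) //= expE cmUU muln1 big1_fset ?addn0 // => i.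
  by rewrite !inE expE cmU => /andP[/negPf -> _]; rewrite muln0.
rewrite big_seq big1 // => i im; rewrite expE cmU.
by case: eqP im jm => [-> -> //|]; rewrite muln0.
Qed.

Lemma lsubE V L (f : {lpoly V}) : lsub L f = msum (fun m x => lact (mev L m) (cst x)) f.
Proof. by rewrite lsub_def lact_def mono_def. Qed.

Lemma lsub_zmod V L : zmod_morphism (@lsub F V L).
Proof.
have lD : {morph @lsub F V L : f g / f + g}.
  by move=> f g; rewrite !lsubE msumD // => m x y; rewrite !raddfD.
have l0 : @lsub F V L 0 = 0 by rewrite lsubE msum0.
by move=> f g; apply: (addIr (lsub L g)); rewrite -lD !subrK.
Qed.

HB.instance Definition _ V L :=
  GRing.isZmodMorphism.Build {lpoly V} {lpoly V} (lsub L) (@lsub_zmod V L).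

Lemma lsubU V L (x : V) m : lsub L (mono m x) = lact (mev L m) (cst x).
Proof. by rewrite lsubE msumU // => k; rewrite !raddf0. Qed.

Lemma lsubC V L (x : V) : lsub L (cst x) = (cst x).
Proof. by rewrite lsubU mev1 lact1. Qed.

Lemma lsub_lact V L p (f : {lpoly V}) :
  lsub L (lact p f) = lact (psubst L p) (lsub L f).
Proof.
move: p f; apply: lpoly_ind2 => [f|p|p q f ep eq|p f g ef eg|c m x m'].
- by rewrite !lact0l raddf0 rmorph0 lact0l.
- by rewrite !raddf0.
- by rewrite !lactDl raddfD rmorphD lactDl /= ep eq.
- by rewrite !raddfD /= ef eg.
rewrite lactUU !lsubU psubstU mevM.
have -> : cst (c%:P *: x) = lact (cst c) (cst x) :> {lpoly V} by rewrite lactUU mul1m.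
by rewrite [LHS]lactA [RHS]lactA [in LHS]mulrC [in LHS]mulrA.
Qed.

Lemma lsub_comp V L L' (f : {lpoly V}) :
  lsub L (lsub L' f) = lsub (fun i => psubst L (L' i)) f.
Proof.
elim/malg_ind: f => [|f g ef eg|x m]; rewrite ?raddf0 ?raddfD /= ?ef ?eg //.
by rewrite !lsubU lsub_lact lsubC psubst_mev.
Qed.

Lemma lsub_lam V (f : {lpoly V}) : lsub lam f = f.
Proof.
elim/malg_ind: f => [|f g ef eg|x m]; rewrite ?raddf0 ?raddfD /= ?ef ?eg //.
by rewrite lsubU mev_lam lactUU scale1r mulm1.
Qed.

Lemma coefmap_lsub V W (g : {linear V -> W}) L (f : {lpoly V}) :
  coefmap g (lsub L f) = lsub L (coefmap g f).
Proof.
elim/malg_ind: f => [|f f' ef ef'|x m]; rewrite ?raddf0 ?raddfD /= ?ef ?ef' //.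
by rewrite coefmapU !lsubU coefmap_lact coefmapU.
Qed.

Lemma eq_lsub_vars V n L L' (f : {lpoly V}) : in_vars n f ->
  (forall i, (i < n)%N -> L i = L' i) -> lsub L f = lsub L' f.
Proof.
move=> fn eL; rewrite !lsubE; apply: eq_big_seq => m mf.
have -> // : mev L m = mev L' m; apply: eq_big_seq => i im.
rewrite eL // ltnNge; apply/negP => /(fn _ mf) mi0.
by move: im; rewrite -cmE_neq0 mi0.
Qed.

Lemma eq_lsub V L L' (f : {lpoly V}) : L =1 L' -> lsub L f = lsub L' f.
Proof.
move=> eL; rewrite !lsubE; apply: eq_bigr => m _.
by have -> // : mev L m = mev L' m; apply: eq_bigr => i _; rewrite eL.
Qed.

Lemma in_varsD (V : zmodType) n (f g : {lpoly V}) :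
  in_vars n f -> in_vars n g -> in_vars n (f + g).
Proof.
move=> fn gn m /(fsubsetP (msuppD_le f g)); rewrite inE => /orP[]; [exact: fn|exact: gn].
Qed.

Lemma in_vars0 (V : zmodType) n : in_vars n (0 : {lpoly V}).
Proof. by move=> m; rewrite msupp0 inE. Qed.

Lemma in_varsC (V : zmodType) n (x : V) : in_vars n ((cst x) : {lpoly V}).
Proof. by move=> m /(fsubsetP (msupp_mono _ _)); rewrite inE => /eqP-> i _; rewrite cm1. Qed.

(** The substitution kills every monomial with a variable of index at least [n] and fixes the
    others, so its image involves only the first [n] variables. *)
Lemma in_vars_subst V n (f : {lpoly V}) :
  lsub (fun i => if (i < n)%N then lam i else 0) f = f -> in_vars n f.
Proof.
move=> <-; elim/malg_ind: f => [|f g ef eg|x m].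
- by rewrite raddf0; exact: in_vars0.
- by rewrite raddfD; exact: in_varsD.
rewrite lsubU; have [/allP mn|/allPn[i im]] := boolP (all (fun i => (i < n)%N) (finsupp m)).
  rewrite (_ : mev _ m = (mono m 1)) ?lactUU => [k|]; last first.
    by rewrite -mev_lam; apply: eq_big_seq => i /mn ->.
  move=> /(fsubsetP (msupp_mono _ _)); rewrite inE mulm1 => /eqP-> i ni.
  by apply/eqP; rewrite cmE_eq0; apply/negP => /mn; rewrite ltnNge ni.
rewrite -leqNgt => ni; rewrite /mev (big_fsetD1 i) //= ltnNge ni expr0n.
by rewrite cmE_eq0 im mul0r lact0l; exact: in_vars0.
Qed.

Lemma in_vars_coefmap (V W : zmodType) n (g : {additive V -> W}) (f : {lpoly V}) :
  in_vars n f -> in_vars n (coefmap g f).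
Proof.
move=> fn m mf; apply: fn; move: mf; rewrite -!mcoeff_neq0 coefmapE.
by apply: contraNneq => ->; rewrite raddf0.
Qed.

End LambdaSubstitution.

HB.lock Definition ext (F : fieldType) (V : lmodType {poly F}) (L : nat -> {lpoly F})
  (f : seq V -> {lpoly V}) (Ps : seq {lpoly V}) : {lpoly V} := lextend L f Ps.

Lemma ext_def : @ext = @lextend. Proof. exact: ext.unlock. Qed.

(** * Linear extension of multilinear maps over the lambdas *)

Section Extension.
Variable F : fieldType.
Implicit Types (V W : lmodType {poly F}) (p q : {lpoly F}) (L : nat -> {lpoly F}).

Lemma ext_nil V L (f : seq V -> {lpoly V}) : ext L f [::] = lsub L (f [::]).
Proof. by rewrite ext_def lsub_def. Qed.

Lemma ext_cons V L (f : seq V -> {lpoly V}) P Ps :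
  ext L f (P :: Ps) = msum (fun m v => lact (mono m 1) (ext L (fun a => f (v :: a)) Ps)) P.
Proof. by rewrite ext_def lact_def mono_def. Qed.

Definition multilin V k (f : seq V -> {lpoly V}) := forall a b x y c,
  (size a + size b).+1 = k ->
  f (a ++ (c%:P *: x + y) :: b) = lact (cst c) (f (a ++ x :: b)) + f (a ++ y :: b).

Lemma multilin_cons V k (f : seq V -> {lpoly V}) v :
  multilin k.+1 f -> multilin k (fun a => f (v :: a)).
Proof. by move=> fL a b x y c ek; rewrite -!cat_cons fL //= -ek. Qed.

Lemma lactN1 V (f : {lpoly V}) : lact (cst (-1)) f = - f.
Proof.
have -> : cst (-1) = - 1 :> {lpoly F} by rewrite -(mono1 F) -raddfN.
by rewrite lactNl lact1.
Qed.

Lemma multilin0 V k (f : seq V -> {lpoly V}) a b :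
  multilin k f -> (size a + size b).+1 = k -> f (a ++ 0 :: b) = 0.
Proof.
move=> fL ek; have := fL a b 0 0 (-1) ek.
by rewrite scaler0 addr0 lactN1 addNr.
Qed.

Lemma multilinN V k (f : seq V -> {lpoly V}) a b x :
  multilin k f -> (size a + size b).+1 = k -> f (a ++ (- x) :: b) = - f (a ++ x :: b).
Proof.
move=> fL ek; have := fL a b x 0 (-1) ek.
by rewrite addr0 rmorphN rmorph1 scaleN1r lactN1 (multilin0 fL) // addr0.
Qed.

(** The scalar [q] sits in the values of [f], so its lambdas are replaced by the subscripts [L].
    Lambdas coming from the arguments are kept, as [ext_head_lact] shows. *)
Lemma ext_comb V L q (f f1 f2 : seq V -> {lpoly V}) Ps :
  (forall a, size a = size Ps -> f a = lact q (f1 a) + f2 a) ->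
  ext L f Ps = lact (psubst L q) (ext L f1 Ps) + ext L f2 Ps.
Proof.
elim: Ps f f1 f2 => [|P Ps IH] f f1 f2 ef.
  by rewrite !ext_nil ef // raddfD /= lsub_lact.
rewrite !ext_cons [X in lact _ X]/msum raddf_sum -[RHS]big_split.
apply: eq_bigr => m _; rewrite (IH _ (fun a => f1 (P@_m :: a)) (fun a => f2 (P@_m :: a))).
  by rewrite raddfD [X in X + _]lactC.
by move=> a sa; rewrite ef //= sa.
Qed.

Lemma eq_ext V L (f f' : seq V -> {lpoly V}) Ps :
  (forall a, size a = size Ps -> f a = f' a) -> ext L f Ps = ext L f' Ps.
Proof.
elim: Ps f f' => [|P Ps IH] f f' ef; first by rewrite !ext_nil ef.
rewrite !ext_cons; apply: eq_bigr => m _; congr (lact _ _); apply: IH => a sa.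
by rewrite ef //= sa.
Qed.

Lemma eq_ext_vars V n L L' (f : seq V -> {lpoly V}) Ps :
  (forall a, size a = size Ps -> in_vars n (f a)) ->
  (forall i, (i < n)%N -> L i = L' i) -> ext L f Ps = ext L' f Ps.
Proof.
move=> fn eL; elim: Ps f fn => [|P Ps IH] f fn.
  by rewrite !ext_nil; apply: eq_lsub_vars eL; apply: fn.
rewrite !ext_cons; apply: eq_bigr => m _; congr (lact _ _); apply: IH => a sa.
by apply: fn; rewrite /= sa.
Qed.

Lemma eq_ext_subst V L L' (f : seq V -> {lpoly V}) Ps : L =1 L' -> ext L f Ps = ext L' f Ps.
Proof.
move=> eL; elim: Ps f => [|P Ps IH] f; first by rewrite !ext_nil; apply: eq_lsub.
by rewrite !ext_cons; apply: eq_bigr => m _; congr (lact _ _).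
Qed.

Lemma ext_add_head V k L (f : seq V -> {lpoly V}) Ps c x y :
  multilin k f -> (size Ps).+1 = k ->
  ext L (fun a => f ((c%:P *: x + y) :: a)) Ps =
  lact (cst c) (ext L (fun a => f (x :: a)) Ps) + ext L (fun a => f (y :: a)) Ps.
Proof.
move=> fL ek; rewrite -(psubstC L c); apply: ext_comb => a sa.
by apply: (fL [::]); rewrite sa.
Qed.

Lemma ext_addv V k L (f : seq V -> {lpoly V}) Ps x y :
  multilin k f -> (size Ps).+1 = k ->
  ext L (fun a => f ((x + y) :: a)) Ps =
  ext L (fun a => f (x :: a)) Ps + ext L (fun a => f (y :: a)) Ps.
Proof.
by move=> fL ek; have := ext_add_head L 1 x y fL ek; rewrite scale1r mono1 lact1.
Qed.

Lemma ext_head0 V k L (f : seq V -> {lpoly V}) Ps :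
  multilin k f -> (size Ps).+1 = k -> ext L (fun a => f (0 :: a)) Ps = 0.
Proof.
move=> fL ek; apply: (addIr (ext L (fun a => f (0 :: a)) Ps)).
by rewrite -(ext_addv L _ _ fL ek) !add0r.
Qed.

Lemma ext_scalev V k L (f : seq V -> {lpoly V}) Ps c x :
  multilin k f -> (size Ps).+1 = k ->
  ext L (fun a => f ((c%:P *: x) :: a)) Ps = lact (cst c) (ext L (fun a => f (x :: a)) Ps).
Proof.
move=> fL ek; have := ext_add_head L c x 0 fL ek.
by rewrite addr0 (ext_head0 L fL ek) addr0.
Qed.

Lemma ext_headU V k L (f : seq V -> {lpoly V}) Ps m x :
  multilin k f -> (size Ps).+1 = k ->
  ext L f (mono m x :: Ps) = lact (mono m 1) (ext L (fun a => f (x :: a)) Ps).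
Proof.
by move=> fL ek; rewrite ext_cons msumU // => k'; rewrite (ext_head0 L fL ek) raddf0.
Qed.

Lemma ext_headD V k L (f : seq V -> {lpoly V}) Ps P Q :
  multilin k f -> (size Ps).+1 = k ->
  ext L f ((P + Q) :: Ps) = ext L f (P :: Ps) + ext L f (Q :: Ps).
Proof.
move=> fL ek; rewrite !ext_cons msumD // => m x y.
by rewrite (ext_addv L x y fL ek) raddfD.
Qed.

Lemma ext_head_lact V k L (f : seq V -> {lpoly V}) Ps p Q :
  multilin k f -> (size Ps).+1 = k ->
  ext L f (lact p Q :: Ps) = lact p (ext L f (Q :: Ps)).
Proof.
move=> fL ek; have e0 : ext L f (0 :: Ps) = 0 by rewrite ext_cons msum0.
move: p Q; apply: lpoly_ind2 => [Q|p|p q Q ep eq|p P Q eP eQ|c m x m'].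
- by rewrite !lact0l e0.
- by rewrite raddf0 e0 raddf0.
- by rewrite !lactDl (ext_headD L _ _ fL ek) ep eq.
- by rewrite !raddfD !(ext_headD L _ _ fL ek) raddfD /= eP eQ.
rewrite lactUU !(ext_headU L _ _ fL ek) (ext_scalev L c x fL ek) lactA lactA.
by rewrite !mulUU mulm1 mulr1 mul1r.
Qed.

Lemma ext_lin V k L (f : seq V -> {lpoly V}) Ps Qs p x y :
  multilin k f -> (size Ps + size Qs).+1 = k ->
  ext L f (Ps ++ (lact p x + y) :: Qs) =
  lact p (ext L f (Ps ++ x :: Qs)) + ext L f (Ps ++ y :: Qs).
Proof.
elim: Ps k f => [|P Ps IH] k f fL ek /=.
  by rewrite (ext_headD L _ _ fL ek) (ext_head_lact L _ _ fL ek).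
rewrite !ext_cons /msum raddf_sum -[RHS]big_split.
apply: eq_bigr => m _; case: k fL ek => // k fL [ek].
by rewrite (IH k _ (multilin_cons _ fL)) // raddfD [X in X + _]lactC.
Qed.

Lemma ext_cst V k L (f : seq V -> {lpoly V}) a :
  multilin k f -> size a = k -> ext L f (map (fun x => cst x) a) = lsub L (f a).
Proof.
elim: a k f => [|x a IH] [|k] f // fL ek; first exact: ext_nil.
case: ek => ek; rewrite /= (ext_headU L _ _ fL) ?size_map ?ek //.
by rewrite (IH k _ (multilin_cons _ fL)) // mono1 lact1.
Qed.

Lemma lsub_sum V L (f : {lpoly V}) : lsub L f = \sum_(m <- msupp f) lact (mev L m) (cst f@_m).
Proof. by rewrite lsubE. Qed.

Lemma ext_head_sum V k L (f : seq V -> {lpoly V}) Ps (I : Type) (r : seq I)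
    (p : I -> {lpoly F}) (Q : I -> {lpoly V}) :
  multilin k f -> (size Ps).+1 = k ->
  ext L f ((\sum_(i <- r) lact (p i) (Q i)) :: Ps) =
  \sum_(i <- r) lact (p i) (ext L f (Q i :: Ps)).
Proof.
move=> fL ek; elim: r => [|i r IH]; first by rewrite !big_nil ext_cons msum0.
by rewrite !big_cons (ext_headD L _ _ fL ek) (ext_head_lact L _ _ fL ek) IH.
Qed.

Lemma lsub_ext V k L L' (f : seq V -> {lpoly V}) Ps :
  multilin k f -> size Ps = k ->
  lsub L' (ext L f Ps) = ext (fun i => psubst L' (L i)) f (map (lsub L') Ps).
Proof.
elim: Ps k f => [|P Ps IH] k f fL ek; first by rewrite !ext_nil lsub_comp.
case: k fL ek => // k fL [ek]; rewrite /= (lsub_sum L' P).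
rewrite (ext_head_sum _ _ _ _ fL) ?size_map ?ek // ext_cons raddf_sum.
apply: eq_bigr => m _; rewrite /= lsub_lact psubstU mono1 mul1r.
by rewrite (IH k _ (multilin_cons _ fL)) // (ext_headU _ _ _ fL) ?size_map ?ek // mono1 lact1.
Qed.

Lemma multilin_conj V W k (f : seq V -> {lpoly V}) (p : {linear V -> W}) (i : {linear W -> V}) :
  multilin k f -> multilin k (fun a => coefmap p (f (map i a))).
Proof.
move=> fL a b x y c ek.
by rewrite !map_cat /= raddfD /= linearZ /= fL ?size_map // raddfD /= coefmap_lact.
Qed.

Lemma ext_conj V W k L (f : seq V -> {lpoly V}) (p : {linear V -> W}) (i : {linear W -> V}) Ps :
  multilin k f -> size Ps = k ->
  ext L (fun a => coefmap p (f (map i a))) Ps = coefmap p (ext L f (map (coefmap i) Ps)).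
Proof.
elim: Ps k f => [|P Ps IH] k f fL ek; first by rewrite !ext_nil coefmap_lsub.
case: k fL ek => // k fL [ek]; rewrite /= {2}[P]sum_mono raddf_sum /=.
transitivity (coefmap p (\sum_(m <- msupp P)
    lact 1 (ext L f (coefmap i (mono m P@_m) :: map (coefmap i) Ps)))).
  rewrite ext_cons raddf_sum; apply: eq_bigr => m _.
  rewrite /= (IH k (fun a => f (i P@_m :: a))) //; last exact: multilin_cons.
  by rewrite -coefmap_lact coefmapU lact1 (ext_headU _ _ _ fL) ?size_map ?ek.
congr (coefmap p _).
rewrite -(ext_head_sum _ _ _ _ fL) ?size_map ?ek //.
by rewrite (eq_bigr (fun m => coefmap i (mono m P@_m))) => [|m _]; rewrite ?lact1.
Qed.

End Extension.

(** * Grafting as composition on words *)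

Fixpoint allp (T : Type) (P : T -> Prop) (s : seq T) : Prop :=
  if s is x :: s' then P x /\ allp P s' else True.

Lemma allp_cat (T : Type) (P : T -> Prop) s1 s2 : allp P (s1 ++ s2) <-> allp P s1 /\ allp P s2.
Proof.
elim: s1 => [|x s1 IH] /=; first by split=> // -[].
by rewrite IH; split=> [[? [? ?]]|[[? ?] ?]].
Qed.

Local Notation arity phis := (sumn [seq q.1 | q <- phis]).

Section Words.
Variable F : fieldType.
Implicit Types (V W : lmodType {poly F}) (p : {lpoly F}) (L : nat -> {lpoly F}).

(* The letter (P, c) stands for an argument P whose subscript is c. *)
Definition hat V (f : seq V -> {lpoly V}) (w : seq ({lpoly V} * {lpoly F})) : {lpoly V} :=
  ext (nth 0 (unzip2 w)) f (unzip1 w).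

Definition wlin V k (G : seq ({lpoly V} * {lpoly F}) -> {lpoly V}) :=
  forall u v p x y c, (size u + size v).+1 = k ->
  G (u ++ (lact p x + y, c) :: v) = lact p (G (u ++ (x, c) :: v)) + G (u ++ (y, c) :: v).

Lemma wlinD V k (G : seq ({lpoly V} * {lpoly F}) -> {lpoly V}) u v x y c :
  wlin k G -> (size u + size v).+1 = k ->
  G (u ++ (x + y, c) :: v) = G (u ++ (x, c) :: v) + G (u ++ (y, c) :: v).
Proof. by move=> GL ek; have := GL u v 1 x y c ek; rewrite !lact1. Qed.

Lemma wlin0 V k (G : seq ({lpoly V} * {lpoly F}) -> {lpoly V}) u v c :
  wlin k G -> (size u + size v).+1 = k -> G (u ++ (0, c) :: v) = 0.
Proof.
move=> GL ek; apply: (addIr (G (u ++ (0, c) :: v))).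
by rewrite -(wlinD _ _ _ GL ek) !add0r.
Qed.

Lemma hat_wlin V k (f : seq V -> {lpoly V}) : multilin k f -> wlin k (hat f).
Proof.
move=> fL u v p x y c ek; rewrite /hat /unzip1 /unzip2 !map_cat /=.
by rewrite (ext_lin _ _ _ _ fL) // !size_map.
Qed.

Definition subw V L (l : {lpoly V} * {lpoly F}) := (lsub L l.1, psubst L l.2).

Lemma nth_subw V L (w : seq ({lpoly V} * {lpoly F})) i :
  nth 0 (unzip2 (map (subw L) w)) i = psubst L (nth 0 (unzip2 w) i).
Proof.
elim: w i => [|l w IH] [|i] //=; rewrite ?nth_nil ?raddf0 //; exact: IH.
Qed.

Lemma lsub_hat V k L (f : seq V -> {lpoly V}) w : multilin k f -> size w = k ->
  lsub L (hat f w) = hat f (map (subw L) w).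
Proof.
move=> fL ek; rewrite /hat (lsub_ext _ _ fL) ?size_map //.
have -> : unzip1 (map (subw L) w) = map (lsub L) (unzip1 w).
  by rewrite /unzip1 -!map_comp.
by apply: eq_ext_subst => i; rewrite nth_subw.
Qed.

Lemma hat_cst V k (f : seq V -> {lpoly V}) a cs : multilin k f -> size a = k -> size cs = k ->
  hat f (zip (map (fun x => cst x) a) cs) = lsub (nth 0 cs) (f a).
Proof.
by move=> fL ea ec; rewrite /hat unzip1_zip ?unzip2_zip ?(ext_cst _ fL) // size_map ea ec.
Qed.

(** The generic word on [a]. For [n = 0] its last parameter is a variable that does not occur in the
    values of a conformal map at [a]. *)
Definition genw V n (a : seq V) : seq ({lpoly V} * {lpoly F}) :=
  zip (map (fun x => cst x) a) (map lam (iota n (size a))).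

Lemma size_genw V n (a : seq V) : size (genw n a) = size a.
Proof. by rewrite size_zip !size_map size_iota minnn. Qed.

Lemma genw_cat V n (a b : seq V) : genw n (a ++ b) = genw n a ++ genw (n + size a) b.
Proof.
by rewrite /genw size_cat iotaD !map_cat zip_cat // !size_map size_iota.
Qed.

Lemma genw_cons V n (x : V) b : genw n (x :: b) = (cst x, lam n) :: genw n.+1 b.
Proof. by []. Qed.

Definition mvar V k (f : seq V -> {lpoly V}) :=
  multilin k f /\ forall a, size a = k -> in_vars k.-1 (f a).

Lemma lsub_genw V k L (f : seq V -> {lpoly V}) a n : mvar k f -> size a = k ->
  (forall i, (i < k.-1)%N -> L i = lam (n + i)) ->
  lsub L (f a) = hat f (genw n a).
Proof.
move=> [fL fv] ek eL; rewrite (hat_cst fL) ?size_map ?size_iota //.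
apply: (eq_lsub_vars (fv a ek)) => i ik.
have ik' : (i < k)%N by case: k ik {fL fv ek eL} => // k ik; rewrite ltnS ltnW.
by rewrite (nth_map 0%N) ?size_iota ?ek // nth_iota ?ek // eL.
Qed.

Lemma hat_genw V k (f : seq V -> {lpoly V}) a : mvar k f -> size a = k ->
  hat f (genw 0 a) = f a.
Proof. by move=> fv ek; rewrite -(lsub_genw (L := lam) fv) // lsub_lam. Qed.

(** The tensor product of the [phis] on words. Each value carries the weight of its block, as the
    subscript rule of grafting prescribes. *)
Fixpoint pcomp V (phis : seq (nat * (seq V -> {lpoly V}))) (w : seq ({lpoly V} * {lpoly F})) :
    seq ({lpoly V} * {lpoly F}) :=
  if phis is q :: phis' then
    (hat q.2 (take q.1 w), wt (take q.1 w)) :: pcomp phis' (drop q.1 w)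
  else [::].


Lemma size_pcomp V (phis : seq (nat * (seq V -> {lpoly V}))) w :
  size (pcomp phis w) = size phis.
Proof. by elim: phis w => //= q phis IH w; rewrite IH. Qed.

Lemma pcomp_cat V (phis1 phis2 : seq (nat * (seq V -> {lpoly V}))) u v :
  size u = arity phis1 -> pcomp (phis1 ++ phis2) (u ++ v) = pcomp phis1 u ++ pcomp phis2 v.
Proof.
elim: phis1 u => [|q phis1 IH] u /=; first by case: u.
move=> su; have qu : (q.1 <= size u)%N by rewrite su leq_addr.
rewrite takel_cat // drop_cat; case: ltnP => [lt_qu|ge_qu].
  by rewrite IH // size_drop su addKn.
have eq_qu : q.1 = size u by apply/eqP; rewrite eqn_leq qu ge_qu.
rewrite eq_qu subnn drop0 drop_size -(IH [::]) //=.
by apply/esym/eqP; rewrite -(eqn_add2l q.1) addn0 -su eq_qu.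
Qed.

Lemma pcomp_block V (phis1 : seq (nat * (seq V -> {lpoly V}))) q phis2 u1 b v2 :
  size u1 = arity phis1 -> size b = q.1 ->
  pcomp (phis1 ++ q :: phis2) (u1 ++ b ++ v2) =
  pcomp phis1 u1 ++ (hat q.2 b, wt b) :: pcomp phis2 v2.
Proof. by move=> su sb; rewrite pcomp_cat //= take_size_cat // drop_size_cat. Qed.

Lemma wt_pcomp V (phis : seq (nat * (seq V -> {lpoly V}))) w : size w = arity phis ->
  wt (pcomp phis w) = wt w.
Proof.
elim: phis w => [|q phis IH] w /= sw; first by case: w sw.
by rewrite wt_cons /= IH ?size_drop ?sw ?addKn // -wt_cat cat_take_drop.
Qed.

(** Locates the block that contains a letter marked between [u] and [v]. *)
Lemma arity_split (T : Type) (sh : seq nat) (u v : seq T) : (size u + size v).+1 = sumn sh ->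
  exists sh1 k sh2 u1 u2 v1 v2, [/\ sh = sh1 ++ k :: sh2, u = u1 ++ u2, v = v1 ++ v2,
    size u1 = sumn sh1 & (size u2 + size v1).+1 = k] /\ size v2 = sumn sh2.
Proof.
elim: sh u => //= k sh IH u e; have [uk|ku] := ltnP (size u) k.
  exists [::], k, sh, [::], u, (take (k - size u).-1 v), (drop (k - size u).-1 v).
  have kv : ((k - size u).-1 <= size v)%N.
    rewrite -ltnS prednK ?subn_gt0 // leq_subLR addnS e; exact: leq_addr.
  rewrite cat_take_drop size_takel // size_drop; split; first split=> //.
    by rewrite -addnS prednK ?subn_gt0 // subnKC // ltnW.
  apply/eqP; rewrite -(eqn_add2l k) -e -{1}(subnKC (ltnW uk)) -addnA -addnS.
  by rewrite eqn_add2l -{1}(prednK (n := k - size u)) ?subn_gt0 // addSn subnKC.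
have [|sh1 [k' [sh2 [u1 [u2 [v1 [v2 [[-> eu -> su1 sk] sv2]]]]]]]] := IH (drop k u).
  by apply/eqP; rewrite -(eqn_add2l k) addnS addnA size_drop subnKC // e.
exists (k :: sh1), k', sh2, (take k u ++ u1), u2, v1, v2; split=> //; split=> //.
  by rewrite -catA -eu cat_take_drop.
by rewrite size_cat size_takel // su1.
Qed.

Lemma map_cat_split (T T' : Type) (g : T -> T') s t1 x t2 : map g s = t1 ++ x :: t2 ->
  exists s1 y s2, [/\ s = s1 ++ y :: s2, map g s1 = t1, g y = x & map g s2 = t2].
Proof.
elim: t1 s => [|z t1 IH] [|y s] //= [e].
  by move=> <-; exists [::], y, s.
by move=> /IH[s1 [y' [s2 [-> <- <- <-]]]]; exists (y :: s1), y', s2; rewrite /= e.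
Qed.

Lemma pcomp_split V (phis : seq (nat * (seq V -> {lpoly V}))) (T : Type) (u v : seq T) :
  (size u + size v).+1 = arity phis ->
  exists phis1 q phis2 u1 u2 v1 v2, [/\ phis = phis1 ++ q :: phis2, u = u1 ++ u2, v = v1 ++ v2,
    size u1 = arity phis1 & (size u2 + size v1).+1 = q.1] /\ size v2 = arity phis2.
Proof.
move=> /arity_split[sh1 [k [sh2 [u1 [u2 [v1 [v2 [[esh -> -> su1 sk] sv2]]]]]]]].
have [phis1 [q [phis2 [-> e1 eq e2]]]] := map_cat_split esh.
by exists phis1, q, phis2, u1, u2, v1, v2; rewrite e1 eq e2.
Qed.

Lemma pcomp_subw V L (phis : seq (nat * (seq V -> {lpoly V}))) w :
  allp (fun q => multilin q.1 q.2) phis -> size w = arity phis ->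
  map (subw L) (pcomp phis w) = pcomp phis (map (subw L) w).
Proof.
elim: phis w => //= q phis IH w [qL phisL] sw.
have qw : (q.1 <= size w)%N by rewrite sw leq_addr.
rewrite IH ?size_drop ?sw ?addKn // map_drop -map_take; congr cons.
rewrite {1}/subw /= (lsub_hat _ qL) ?size_takel //.
by rewrite /wt big_map raddf_sum.
Qed.

Lemma hat_pcomp_wlin V (f : seq V -> {lpoly V}) phis :
  multilin (size phis) f -> allp (fun q => multilin q.1 q.2) phis ->
  wlin (arity phis) (fun w => hat f (pcomp phis w)).
Proof.
move=> fL phisL u v p x y c /pcomp_split[phis1 [q [phis2 [u1 [u2 [v1 [v2]]]]]]].
move=> [[ephis -> -> su1 sq] sv2]; move: fL phisL; rewrite ephis => fL.
move=> /allp_cat[_ [qL _]]; rewrite -!catA.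
have cE z : u2 ++ (z, c) :: v1 ++ v2 = (u2 ++ (z, c) :: v1) ++ v2 by rewrite -catA.
rewrite !cE !pcomp_block ?size_cat /= ?addnS ?sq // (hat_wlin qL) //.
have wE z : wt (u2 ++ (z, c) :: v1) = wt u2 + (c + wt v1) by rewrite wt_cat wt_cons.
by rewrite !wE (hat_wlin fL) // !size_pcomp size_cat /= addnS.
Qed.

(** At the generic word the subscripts built into [graft] are the parameters of [pcomp]: each block
    receives its own variables, and their sum is its weight. *)
Lemma graftE V (f : seq V -> {lpoly V}) phis a :
  allp (fun q => mvar q.1 q.2) phis -> size a = arity phis ->
  graft f phis a = hat f (pcomp phis (genw 0 a)).
Proof.
(* The offset [n] lets the induction on [phis] move past the first block. *)
suff gen n b : allp (fun q => mvar q.1 q.2) phis -> size b = arity phis ->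
  pcomp phis (genw n b) = [seq (lsub (fun i => lam (n + sumn (take j [seq q.1 | q <- phis]) + i))
           ((nth (0%N, fun=> 0) phis j).2 (nth [::] (reshape [seq q.1 | q <- phis] b) j)),
      \sum_(sumn (take j [seq q.1 | q <- phis]) <= i < sumn (take j.+1 [seq q.1 | q <- phis])) lam (n + i)%N)
       | j <- iota 0 (size phis)].
  move=> phisv sa; rewrite /hat gen // /graft -ext_def -lsub_def -lam_def.
  rewrite /unzip1 -map_comp; apply: eq_ext_subst => j.
  rewrite /unzip2 -map_comp; have [jp|pj] := ltnP j (size phis).
    by rewrite (nth_map 0%N) ?size_iota // nth_iota.
  rewrite nth_default ?size_map ?size_iota // big_geq // !take_oversize ?size_map //.
  exact: leqW.
clear a f; elim: phis n b => //= q phis IH n b [qv phisv] sb.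
have qb : (q.1 <= size b)%N by rewrite sb leq_addr.
have -> : genw n b = genw n (take q.1 b) ++ genw (n + q.1) (drop q.1 b).
  by rewrite -{1}(cat_take_drop q.1 b) genw_cat size_takel.
rewrite take_size_cat ?size_genw ?size_takel // drop_size_cat ?size_genw ?size_takel //.
congr cons.
  rewrite take0 addn0 (lsub_genw (n := n) qv) ?size_takel //; congr pair.
  rewrite /wt -(big_map snd predT id) -/(unzip2 _) unzip2_zip ?size_map ?size_iota //.
  rewrite big_map size_takel // -[X in iota X]addn0 iotaDl big_map /= addn0.
  by rewrite /index_iota subn0.
rewrite IH // ?size_drop ?sb ?addKn // -[1%N]addn0 iotaDl -map_comp.
apply/eq_in_map => j; rewrite mem_iota add0n /= => jp; congr pair.
  by apply: eq_lsub => i; rewrite !addnA.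
rewrite ![(q.1 + sumn _)%N]addnC big_addn addnK.
by apply: eq_bigr => i _; rewrite -addnA [(q.1 + i)%N]addnC.
Qed.

End Words.

(** * Grafting at arbitrary words, and its compatibility with [D] *)

Section GraftComposition.
Variable F : fieldType.
Implicit Types (V W : lmodType {poly F}) (p : {lpoly F}) (L : nat -> {lpoly F}).

(** Closure under combinations reduces the letters one at a time to constants from the spanning set
    [S]. *)
Lemma word_ind V (S : V -> Prop) (Pr : seq ({lpoly V} * {lpoly F}) -> Prop) k :
  S 0 -> (forall x, exists s : seq V, (forall y, y \in s -> S y) /\ x = \sum_(y <- s) y) ->
  (forall u v p x y c, (size u + size v).+1 = k ->
     Pr (u ++ (x, c) :: v) -> Pr (u ++ (y, c) :: v) -> Pr (u ++ (lact p x + y, c) :: v)) ->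
  (forall t : seq (V * {lpoly F}), size t = k -> (forall l, l \in t -> S l.1) ->
     Pr [seq (cst l.1, l.2) | l <- t]) ->
  forall w, size w = k -> Pr w.
Proof.
move=> S0 Sspan Plin Pcst.
(* The letters of [t] are already reduced; [u] shrinks from its right end. *)
suff gen u t : (size u + size t)%N = k -> (forall l, l \in t -> S l.1) ->
    Pr (u ++ [seq (cst l.1, l.2) | l <- t]).
  by move=> w ew; rewrite -(cats0 w); apply: (gen w [::]); rewrite ?addn0.
elim/last_ind: u t => [|u [x c] IH] t; first exact: Pcst.
rewrite size_rcons cat_rcons => ek St.
have Pc y : S y -> Pr (u ++ (cst y, c) :: [seq (cst l.1, l.2) | l <- t]).
  move=> Sy; apply: (IH ((y, c) :: t)); first by rewrite /= addnS -addSn.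
  by move=> l; rewrite inE => /orP[/eqP->|/St].
have P0' : Pr (u ++ (0, c) :: [seq (cst l.1, l.2) | l <- t]) by rewrite -[0](raddf0 cst); apply: Pc.
rewrite [x]sum_mono; elim: (msupp x : seq _) => [|m r IHr]; first by rewrite big_nil.
rewrite big_cons; have -> : mono m x@_m = lact (mono m 1) (cst x@_m).
  by rewrite lactUU scale1r mulm1.
have ek' : (size u + size [seq (cst l.1 : {lpoly V}, l.2) | l <- t]).+1 = k by rewrite size_map.
have [s [Ss ->]] := Sspan x@_m.
elim: s Ss => [|y s IHs] Ss; first by rewrite big_nil !raddf0 add0r.
rewrite big_cons !raddfD -addrA /=; apply: Plin => //.
  by apply: Pc; apply: Ss; rewrite mem_head.
by apply: IHs => z zs; apply: Ss; rewrite inE zs orbT.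
Qed.

Lemma wlin_ext V (S : V -> Prop) k (G G' : seq ({lpoly V} * {lpoly F}) -> {lpoly V}) :
  S 0 -> (forall x, exists s : seq V, (forall y, y \in s -> S y) /\ x = \sum_(y <- s) y) ->
  wlin k G -> wlin k G' ->
  (forall t : seq (V * {lpoly F}), size t = k -> (forall l, l \in t -> S l.1) ->
     G [seq (cst l.1, l.2) | l <- t] = G' [seq (cst l.1, l.2) | l <- t]) ->
  forall w, size w = k -> G w = G' w.
Proof.
move=> S0 Sspan GL GL' eG; apply: (word_ind S0 Sspan) eG => u v p x y c ek ex ey.
by rewrite GL // GL' // ex ey.
Qed.

Lemma cst_word V (t : seq (V * {lpoly F})) :
  [seq (cst l.1 : {lpoly V}, l.2) | l <- t] = zip (map (fun x => cst x) (unzip1 t)) (unzip2 t).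
Proof. by elim: t => //= l t ->. Qed.

(** Constant letters with arbitrary parameters are a substitution instance of the generic word; thus
    identities at generic words reach all parameters. *)
Lemma subw_genw V (a : seq V) cs : size cs = size a ->
  map (subw (nth 0 cs)) (genw 0 a) = zip (map (fun x => cst x) a) cs.
Proof.
move=> sc; apply: (@eq_from_nth _ (0, 0)).
  by rewrite size_map size_genw size_zip size_map sc minnn.
move=> i; rewrite size_map size_genw => ia.
rewrite (nth_map (0, 0)) ?size_genw // !nth_zip ?size_map ?size_iota //.
rewrite /subw /= (nth_map 0) // lsubC; congr pair.
by rewrite (nth_map 0%N) ?size_iota // nth_iota // psubst_lam.
Qed.

Lemma allp_imp (T : Type) (P Q : T -> Prop) s : (forall x, P x -> Q x) -> allp P s -> allp Q s.
Proof. by move=> PQ; elim: s => //= x s IH [/PQ ? /IH]. Qed.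

Lemma graft_multilin V (f : seq V -> {lpoly V}) phis :
  multilin (size phis) f -> allp (fun q => mvar q.1 q.2) phis ->
  multilin (arity phis) (graft f phis).
Proof.
move=> fL phisv a b x y c ek.
have phisL : allp (fun q => multilin q.1 q.2) phis by apply: allp_imp phisv => q [].
rewrite !graftE ?size_cat //= ?addnS // !genw_cat !genw_cons.
by rewrite raddfD -(hat_pcomp_wlin fL phisL) ?size_genw // lactUU mul1m.
Qed.

(** Both sides are multilinear, so constant letters suffice, and there the claim is [graftE] after a
    substitution. *)
Lemma hat_graft V (f : seq V -> {lpoly V}) phis w :
  multilin (size phis) f -> allp (fun q => mvar q.1 q.2) phis -> size w = arity phis ->
  hat (graft f phis) w = hat f (pcomp phis w).
Proof.
move=> fL phisv.
have phisL : allp (fun q => multilin q.1 q.2) phis by apply: allp_imp phisv => q [].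
move: w; apply: (@wlin_ext V (fun _ => True) (arity phis) (hat (graft f phis))
  (fun w => hat f (pcomp phis w))) => //.
- by move=> x; exists [:: x]; rewrite big_seq1.
- exact/hat_wlin/graft_multilin.
- exact: hat_pcomp_wlin.
move=> t st _; rewrite cst_word; set a := unzip1 t; set cs := unzip2 t.
have sa : size a = arity phis by rewrite size_map.
have sc : size cs = arity phis by rewrite size_map.
rewrite (hat_cst (graft_multilin fL phisv)) // graftE //.
rewrite (lsub_hat _ fL) ?size_pcomp // pcomp_subw ?size_genw // subw_genw // sc sa //.
Qed.

Lemma hat_last V k (f : seq V -> {lpoly V}) u x c c' : mvar k f -> (size u).+1 = k ->
  hat f (rcons u (x, c)) = hat f (rcons u (x, c')).
Proof.
move=> [fL fv] ek; rewrite /hat /unzip1 /unzip2 !map_rcons; apply: (eq_ext_vars (n := k.-1)).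
  by move=> a; rewrite size_rcons size_map ek; apply: fv.
by move=> i; rewrite -ek /= => iu; rewrite !nth_rcons size_map iu.
Qed.

(** Positive arities ensure that the last letter lies in the last block. *)
Lemma pcomp_rcons V (phis : seq (nat * (seq V -> {lpoly V}))) (T : Type) (u : seq T) :
  allp (fun q => (0 < q.1)%N) phis -> (size u).+1 = arity phis ->
  exists phis1 q u1 u2, [/\ phis = rcons phis1 q, u = u1 ++ u2,
    size u1 = arity phis1 & (size u2).+1 = q.1].
Proof.
move=> phis0 su; have [|phis1 [q [phis2 [u1 [u2 [v1 [v2 [[ephis -> ev su1 sq] sv2]]]]]]]] :=
  @pcomp_split _ _ phis T u [::]; first by rewrite addn0.
exists phis1, q, u1, u2; case: v1 v2 ev sq sv2 => // -[] // _; rewrite addn0 => sq sv2.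
rewrite -cats1 ephis; split=> //; case: phis2 sv2 ephis => //= q' phis2 e2 ephis.
by move: phis0; rewrite ephis => /allp_cat[_ [_ [q0 _]]]; case: (q'.1) q0 e2.
Qed.

Lemma pcomp_last V (phis1 : seq (nat * (seq V -> {lpoly V}))) q u1 u2 l :
  size u1 = arity phis1 -> (size u2).+1 = q.1 ->
  pcomp (phis1 ++ [:: q]) (u1 ++ u2 ++ [:: l]) =
  rcons (pcomp phis1 u1) (hat q.2 (rcons u2 l), wt (rcons u2 l)).
Proof.
move=> su1 sq; rewrite -!cats1 -{1}(cats0 (u2 ++ _)) pcomp_block //.
by rewrite size_cat addn1.
Qed.

(** Setting the variables of index at least [arity phis - 1] to 0 changes only the last parameter of
    the generic word. It is invisible to the map of the last block, and the weight of that block is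
    invisible to [f]. *)
Lemma graft_mvar V (f : seq V -> {lpoly V}) phis :
  mvar (size phis) f -> allp (fun q => mvar q.1 q.2) phis ->
  allp (fun q => (0 < q.1)%N) phis ->
  mvar (arity phis) (graft f phis).
Proof.
move=> fv phisv phis0; have [fL _] := fv.
have phisL : allp (fun q => multilin q.1 q.2) phis by apply: allp_imp phisv => q [].
split; first exact: graft_multilin.
move=> a; case/lastP: a => [|a x] sa; apply: in_vars_subst.
  have -> : phis = [::] by case: phis sa phis0 {fv fL phisv phisL} => // -[[|k] g] phis //= _ [].
  by rewrite graftE //= /hat ext_nil lsub_comp; apply: eq_lsub => i; rewrite nth_nil raddf0.
rewrite graftE // (lsub_hat _ fL) ?size_pcomp // pcomp_subw ?size_genw //.
rewrite -cats1 genw_cat map_cat.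
have -> : map (subw (fun i => if (i < (arity phis).-1)%N then lam i else 0)) (genw 0 a) = genw 0 a.
  apply: (@eq_from_nth _ (0, 0)); rewrite ?size_map // => i; rewrite size_genw => ia.
  rewrite (nth_map (0, 0)) ?size_genw // nth_zip ?size_map ?size_iota //.
  rewrite /subw /= (nth_map 0) // lsubC; congr pair.
  rewrite (nth_map 0%N) ?size_iota // nth_iota // psubst_lam -sa size_rcons /= ia.
  by [].
have [c ->] : exists c, map (subw (fun i => if (i < (arity phis).-1)%N then lam i else 0))
    (genw (0 + size a) [:: x]) =
    [:: (cst x : {lpoly V}, c)].
  by eexists; rewrite /= /subw /= lsubC.
rewrite (_ : genw (0 + size a) [:: x] = [:: (cst x, lam (size a))]) //.
have [|phis1 [q [u1 [u2 [ephis ea su1 sq]]]]] := @pcomp_rcons _ _ _ (genw 0 a) phis0.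
  by rewrite size_genw -sa size_rcons.
rewrite ea -!catA ephis -cats1.
rewrite !(pcomp_last _ su1 sq); have qv : mvar q.1 q.2.
  by move: phisv; rewrite ephis -cats1 => /allp_cat[_ []].
rewrite (hat_last _ c (lam (size a)) qv) //.
by apply: hat_last fv _; rewrite ephis size_rcons size_pcomp.
Qed.

Definition wD V (l : {lpoly V} * {lpoly F}) : {lpoly V} * {lpoly F} :=
  (coefmap ( *:%R 'X) l.1 + lact l.2 l.1, l.2).

Definition csq V k (f : seq V -> {lpoly V}) :=
  [/\ mvar k f,
    forall u l v, (size u + size v).+1 = k -> v <> [::] -> hat f (u ++ wD l :: v) = 0 &
    forall u l, (size u).+1 = k ->
      hat f (rcons u (wD l)) = (wD (hat f (rcons u l), wt (rcons u l))).1].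

(** At a letter that does not end its block, [D] is killed by the map of the block. At the end of a
    block it passes to the value, whose parameter is the weight of the block, and [f] then kills it
    or lets it pass. *)
Lemma graft_csq V (f : seq V -> {lpoly V}) phis :
  csq (size phis) f -> allp (fun q => csq q.1 q.2 /\ (0 < q.1)%N) phis ->
  csq (arity phis) (graft f phis).
Proof.
move=> [fv fD fD'] phisD; have fL := fv.1.
have phisv : allp (fun q => mvar q.1 q.2) phis by apply: allp_imp phisD => q [[]].
have phis0 : allp (fun q => (0 < q.1)%N) phis by apply: allp_imp phisD => q [].
have wtD (u v : seq ({lpoly V} * {lpoly F})) l : wt (u ++ wD l :: v) = wt (u ++ l :: v).
  by rewrite !wt_cat !wt_cons.
split; first exact: graft_mvar.
  move=> u l v suv v0; rewrite hat_graft ?size_cat //= ?addnS //.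
  have [phis1 [q [phis2 [u1 [u2 [v1 [v2 [[ephis eu ev su1 sq] sv2]]]]]]]] := pcomp_split suv.
  move: phisD; rewrite ephis => /allp_cat[_ [[[qv qD qD'] _] _]].
  rewrite eu ev -catA -cat_cons (catA u2) pcomp_block ?size_cat /= ?addnS // wtD.
  have s12 : (size (pcomp phis1 u1) + size (pcomp phis2 v2)).+1 = size phis.
    by rewrite !size_pcomp ephis size_cat /= addnS.
  case: v1 ev sq => [|l' v1] ev sq; last by rewrite qD // (wlin0 _ (hat_wlin fL)).
  (* The marked letter ends its block; as [v] is nonempty, a further block follows and [f] kills
     [D]. *)
  rewrite addn0 in sq; rewrite !cats1 qD' //.
  rewrite -[((wD _).1, _)]/(wD (hat q.2 (rcons u2 l), wt (rcons u2 l))) fD //.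
  move=> /(congr1 size); rewrite size_pcomp => p0; apply: v0.
  by rewrite ev; apply: size0nil; rewrite sv2; case: (phis2) p0.
move=> u l su; rewrite !hat_graft ?size_rcons //.
have [phis1 [q [u1 [u2 [ephis -> su1 sq]]]]] := pcomp_rcons phis0 su.
move: phisD; rewrite ephis -cats1 => /allp_cat[_ [[[qv qD qD'] _] _]].
have s1 : (size (pcomp phis1 u1)).+1 = size phis by rewrite size_pcomp ephis size_rcons.
have wtr (a : seq ({lpoly V} * {lpoly F})) x : wt (rcons a x) = wt a + x.2.
  by rewrite -cats1 wt_cat wt_cons /wt big_nil addr0.
rewrite -!cats1 -!catA !(pcomp_last _ su1 sq) qD' //.
have -> : wt (rcons u2 (wD l)) = wt (rcons u2 l) by rewrite !wtr.
rewrite -[((wD _).1, _)]/(wD (hat q.2 (rcons u2 l), wt (rcons u2 l))) fD' //.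
have -> // : wt (rcons (pcomp phis1 u1) (hat q.2 (rcons u2 l), wt (rcons u2 l))) =
   wt (u1 ++ u2 ++ [:: l]).
by rewrite wtr /= wt_pcomp // cats1 wt_cat.
Qed.

End GraftComposition.

(** * Sesquilinearity in terms of [D] *)

Section Sesquilinear.
Variable F : fieldType.
Implicit Types (V W : lmodType {poly F}) (p : {lpoly F}) (L : nat -> {lpoly F}).

Lemma ext_coefmap V L (g : {linear V -> V}) (f : seq V -> {lpoly V}) Ps :
  ext L (fun a => coefmap g (f a)) Ps = coefmap g (ext L f Ps).
Proof.
elim: Ps f => [|P Ps IH] f; first by rewrite !ext_nil coefmap_lsub.
rewrite !ext_cons /msum raddf_sum; apply: eq_bigr => m _.
by rewrite /= coefmap_lact -IH.
Qed.

(** Extends to polynomial arguments a rule known on vectors at one slot: [q] belongs to the values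
    of [f] and is substituted, while [g'] acts on coefficients. *)
Lemma ext_slot V k L (f : seq V -> {lpoly V}) (g g' : {linear V -> V}) q Ps P Qs :
  multilin k f -> (size Ps + size Qs).+1 = k ->
  (forall a v b, size a = size Ps -> size b = size Qs ->
     f (a ++ g v :: b) = lact q (f (a ++ v :: b)) + coefmap g' (f (a ++ v :: b))) ->
  ext L f (Ps ++ coefmap g P :: Qs) =
  lact (psubst L q) (ext L f (Ps ++ P :: Qs)) + coefmap g' (ext L f (Ps ++ P :: Qs)).
Proof.
elim: Ps k f => [|P' Ps IH] k f fL ek ef /=; last first.
  rewrite !ext_cons /msum !raddf_sum -[RHS]big_split; apply: eq_bigr => m _ /=.
  case: k fL ek => // k fL [ek]; rewrite (IH k _ (multilin_cons _ fL)) //.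
    by rewrite raddfD [X in X + _]lactC coefmap_lact.
  by move=> a v b sa sb; apply: (ef (P'@_m :: a)) => //=; rewrite sa.
elim/malg_ind: P => [|P P' eP eP'|v m].
- by rewrite raddf0 !ext_cons msum0 !raddf0 addr0.
- by rewrite raddfD !(ext_headD L _ _ fL ek) eP eP' !raddfD /= addrACA.
rewrite coefmapU !(ext_headU L _ _ fL ek) lactC coefmap_lact -raddfD; congr (lact _ _).
rewrite (@ext_comb _ _ L q _ (fun a => f (v :: a)) (fun a => coefmap g' (f (v :: a)))) ?ext_coefmap //.
by move=> b sb; apply: (ef [::]).
Qed.

Lemma wlinD_lact V k (G : seq ({lpoly V} * {lpoly F}) -> {lpoly V}) u v x y c p :
  wlin k G -> (size u + size v).+1 = k ->
  G (u ++ (x + lact p y, c) :: v) = G (u ++ (x, c) :: v) + lact p (G (u ++ (y, c) :: v)).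
Proof. by move=> GL ek; rewrite addrC GL // addrC. Qed.

(** In an inner slot the derivation yields minus the parameter [c], which cancels the [c] of [D]. In
    the last slot it yields the derivation of the value plus the other parameters, which [c]
    completes to the weight. *)
Lemma csqP (A : gradedModule F) k (f : seq A -> {lpoly A}) :
  conformal_sesquilinear k f -> csq k f.
Proof.
case=> fv fL fD fD'.
have fL' : multilin k f.
  by move=> a b x y c ek; rewrite fL // -coefmap_def coefmap_scale.
split; first by split.
  move=> u [x c] v ek v0; rewrite /wD (wlinD_lact _ _ _ _ (hat_wlin fL') ek).
  rewrite /hat /unzip1 /unzip2 !map_cat /=.
  (* Scaling by 0 serves as the zero map [g']. *)
  rewrite (@ext_slot _ k _ _ ( *:%R 'X) ( *:%R 0) (- lam (size u)) _ _ _ fL') ?size_map //.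
    rewrite coefmap_scale raddf0 lact0l addr0 raddfN /= psubst_lam nth_cat size_map ltnn subnn /=.
    by rewrite lactNl addNr.
  move=> a y b sa sb; rewrite coefmap_scale raddf0 lact0l addr0 fD ?sa ?sb ?size_map //.
    by rewrite lact_def lam_def.
  by rewrite lt0n size_eq0; apply/eqP.
move=> u [x c] ek; rewrite -!cats1 /wD.
have ek' : (size u + size (@nil ({lpoly A} * {lpoly F}))).+1 = k by rewrite addn0.
rewrite (wlinD_lact _ _ _ _ (hat_wlin fL') ek').
rewrite /= wt_cat wt_cons {2}/wt big_nil addr0 /=.
have hE y : hat f (u ++ [:: (y, c)]) = ext (nth 0 ([seq i.2 | i <- u] ++ [:: c])) f
    ([seq i.1 | i <- u] ++ [:: y]) by rewrite /hat /unzip1 /unzip2 !map_cat.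
rewrite !hE.
rewrite (@ext_slot _ k _ _ ( *:%R 'X) ( *:%R 'X) (\sum_(i < size u) lam i) _ _ _ fL') ?size_map //.
  have -> : psubst (nth 0 ([seq i.2 | i <- u] ++ [:: c])) (\sum_(i < size u) lam i) = wt u.
    rewrite raddf_sum /wt (big_nth (0, 0)) big_mkord; apply: eq_bigr => i _.
    by rewrite /= psubst_lam nth_cat size_map ltn_ord (nth_map (0, 0)).
  by rewrite [X in X + _]addrC -addrA -lactDl.
move=> a y b sa; case: b => // _; rewrite cats1 fD' ?sa ?size_map //.
by rewrite addrC cats1 lact_def lam_def coefmap_def.
Qed.

(** On a constant letter, multiplication by ['X] is [D] minus the parameter. In the last slot this
    subtraction removes the last variable from the weight. *)
Lemma csq_sesquilinear (A : gradedModule F) k (f : seq A -> {lpoly A}) : (0 < k)%N ->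
  csq k f -> conformal_sesquilinear k f.
Proof.
move=> k0 [fv fD fD']; have [fL fvar] := fv.
have hatE (a b : seq A) x : (size a + size b).+1 = k ->
    f (a ++ x :: b) = hat f (genw 0 a ++ (cst x, lam (size a)) :: genw (size a).+1 b).
  by move=> ek; rewrite -(hat_genw fv) ?genw_cat ?genw_cons // size_cat /= addnS.
have DE (x : A) c : (cst ('X *: x) : {lpoly A}, c) = ((wD (cst x, c)).1 + lact (- c) (cst x), c).
  by rewrite /wD /= lactNl addrK coefmapU.
split=> [||a b x ek b0|a x ek].
- exact: fvar.
- by move=> a b x y c ek; rewrite fL // -coefmap_def coefmap_scale.
- rewrite -lact_def -lam_def !hatE // DE (wlinD_lact _ _ _ _ (hat_wlin fL)) ?size_genw //.
  rewrite -[((wD _).1, _)]/(wD (cst x, lam (size a))) fD ?size_genw // ?add0r //.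
  by move=> /(congr1 size); rewrite size_genw => b0'; rewrite b0' in b0.
rewrite -lact_def -lam_def -coefmap_def -!cats1 !hatE ?addn0 //.
rewrite DE (wlinD_lact _ _ _ _ (hat_wlin fL)) ?size_genw ?addn0 //.
rewrite -[((wD _).1, _)]/(wD (cst x, lam (size a))) !cats1 fD' ?size_genw //.
rewrite /wD /= -addrA -lactDl; congr (_ + lact _ _).
rewrite -cats1 wt_cat wt_cons {2}/wt big_nil addr0 /= addrK.
rewrite /wt -(big_map snd predT id) -/(unzip2 _) unzip2_zip ?size_map ?size_iota //.
by rewrite big_map -(big_mkord predT) /index_iota subn0.
Qed.

End Sesquilinear.

(** * Degrees and Koszul signs *)

Definition sg (n : int) : int := (-1) ^ n.

Lemma sgD a b : sg (a + b) = sg a * sg b.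
Proof. by rewrite /sg exprzDr ?unitrN ?unitr1. Qed.

Lemma sg_cases n : sg n = 1 \/ sg n = -1.
Proof.
rewrite /sg; case: n => n; rewrite ?NegzE -?exprnN -?exprnP.
  by rewrite -signr_odd; case: (odd n); [right|left].
by rewrite -signr_odd; case: (odd n.+1); [right|left].
Qed.

Lemma sgN n : sg (- n) = sg n.
Proof.
have : sg (- n) * sg n = 1 by rewrite -sgD addNr.
by case: (sg_cases n) => -> ; rewrite ?mulr1 // mulrN1 => /eqP; rewrite eqr_oppLR => /eqP.
Qed.

Lemma sg_double n : sg (n + n) = 1.
Proof. by rewrite sgD; case: (sg_cases n) => ->. Qed.

Section Twist.
Variables (F : fieldType).
Implicit Types (A B : gradedModule F).

Lemma twist_linear A n : linear (@twist F A n).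
Proof.
move=> c x y; apply: gproj_eq => d.
by rewrite gproj_twist !linearP /= !gproj_twist mulrzDl scalerMzr.
Qed.

HB.instance Definition _ A n :=
  GRing.isLinear.Build {poly F} A A *:%R (@twist F A n) (@twist_linear A n).

Lemma homog0 A d : homog d (0 : A).
Proof. by rewrite /homog raddf0. Qed.

Lemma homogD A d (x y : A) : homog d x -> homog d y -> homog d (x + y).
Proof. by rewrite /homog raddfD /= => -> ->. Qed.

Lemma homogZ A d c (x : A) : homog d x -> homog d (c *: x).
Proof. by rewrite /homog linearZ /= => ->. Qed.

Lemma homogMz A d n (x : A) : homog d x -> homog d (x *~ n).
Proof. by rewrite /homog raddfMz /= => ->. Qed.

Lemma homog_span A (x : A) :
  exists s : seq A, (forall y, y \in s -> exists d, homog d y) /\ x = \sum_(y <- s) y.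
Proof.
have [s /andP[us /eqP e]] := gproj_sum x.
exists [seq gproj A d x | d <- s]; split; last by rewrite big_map.
by move=> y /mapP[d _ ->]; exists d; rewrite /homog gprojK eqxx.
Qed.

(** The lambdas have degree 0. *)
Definition homd A (d : int) (P : {lpoly A}) := forall m, homog d P@_m.

Lemma homd0 A d : homd d (0 : {lpoly A}).
Proof. by move=> m; rewrite mcoeff0; exact: homog0. Qed.

Lemma homdD A d (P Q : {lpoly A}) : homd d P -> homd d Q -> homd d (P + Q).
Proof. by move=> dP dQ m; rewrite mcoeffD; apply: homogD. Qed.

Lemma homd_mono A d (x : A) m : homog d x -> homd d (mono m x).
Proof. by move=> dx k; rewrite mcoeff_mono; case: eqP => _ //; exact: homog0. Qed.

Lemma homd_sum A d (I : eqType) (r : seq I) (Q : I -> {lpoly A}) :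
  (forall i, i \in r -> homd d (Q i)) -> homd d (\sum_(i <- r) Q i).
Proof.
by move=> dQ; rewrite big_seq; elim/big_ind: _; [exact: homd0|move=> *; exact: homdD|].
Qed.

Lemma homd_lact A d p (P : {lpoly A}) : homd d P -> homd d (lact p P).
Proof.
move=> dP; rewrite [P]sum_mono raddf_sum; apply: homd_sum => m _ /=.
rewrite [p]sum_mono lact_suml; apply: homd_sum => k _.
by rewrite lactUU; apply/homd_mono/homogZ/dP.
Qed.

Lemma homd_lsub A d L (P : {lpoly A}) : homd d P -> homd d (lsub L P).
Proof.
by move=> dP; rewrite lsub_sum; apply: homd_sum => m _; apply/homd_lact/homd_mono/dP.
Qed.

Lemma homd_coefmap A B d e (g : {additive A -> B}) P :
  has_degree e g -> homd d P -> homd (d + e) (coefmap g P).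
Proof. by move=> ge dP m; rewrite coefmapE; apply/ge/dP. Qed.

Fixpoint homs A (ds : seq int) (Ps : seq {lpoly A}) : Prop :=
  match ds, Ps with
  | d :: ds', P :: Ps' => homd d P /\ homs ds' Ps'
  | [::], [::] => True
  | _, _ => False
  end.

Lemma homs_size A ds (Ps : seq {lpoly A}) : homs ds Ps -> size ds = size Ps.
Proof. by elim: ds Ps => [|d ds IH] [|P Ps] //= [_ /IH ->]. Qed.

Lemma homs_cat A ds1 ds2 (P1 P2 : seq {lpoly A}) :
  homs ds1 P1 -> homs ds2 P2 -> homs (ds1 ++ ds2) (P1 ++ P2).
Proof. by elim: ds1 P1 => [|d ds IH] [|P Ps] //= [dP dPs] d2; split=> //; apply: IH. Qed.

Lemma homs_split A n ds (Ps : seq {lpoly A}) : homs ds Ps ->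
  homs (take n ds) (take n Ps) /\ homs (drop n ds) (drop n Ps).
Proof. by elim: n ds Ps => [|n IH] [|d ds] [|P Ps] //= [dP /IH[]]. Qed.

Lemma homogs_cons A d ds x (a : seq A) :
  homogs (d :: ds) (x :: a) <-> homog d x /\ homogs ds a.
Proof.
split=> [[/= [sa] da]|[dx [sa da]]].
  by split; [exact: (da 0%N)|split=> // i ia; exact: (da i.+1)].
by split=> [|[|i]] //=; [rewrite sa|exact: da].
Qed.

Lemma homogs_homs A ds (a : seq A) :
  homogs ds a -> homs ds (map (fun x => cst x : {lpoly A}) a).
Proof.
elim: a ds => [|x a IH] [|d ds]; [by []|by case|by case|].
by move=> /homogs_cons[dx /IH]; split=> //; apply: homd_mono.
Qed.

Definition fdeg A k e (f : seq A -> {lpoly A}) := forall ds a,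
  size a = k -> homogs ds a -> homd (\sum_(d <- ds) d + e) (f a).

Lemma homd_ext A k e L (f : seq A -> {lpoly A}) ds Ps :
  fdeg k e f -> size Ps = k -> homs ds Ps -> homd (\sum_(d <- ds) d + e) (ext L f Ps).
Proof.
elim: Ps k e f ds => [|P Ps IH] k e f ds fe.
  case: ds => // ek _; rewrite ext_nil; apply/homd_lsub/fe => //.
case: k fe => // k fe [ek]; case: ds => // d ds [dP dPs].
rewrite ext_cons; apply: homd_sum => m _; apply: homd_lact.
rewrite big_cons [d + _]addrC -addrA; apply: (IH k) => // ds' a sa da.
have := fe (d :: ds') (P@_m :: a); rewrite big_cons [d + _]addrC -addrA; apply; first by rewrite /= sa.
exact/homogs_cons.
Qed.

Lemma homd_hat A k e (f : seq A -> {lpoly A}) ds w :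
  fdeg k e f -> size w = k -> homs ds (unzip1 w) -> homd (\sum_(d <- ds) d + e) (hat f w).
Proof. by move=> fe sw; apply: (homd_ext (k := k)) => //; rewrite size_map. Qed.

Lemma coefmap_twist A n d (P : {lpoly A}) :
  homd d P -> coefmap (twist n) P = P *~ sg (n * d).
Proof.
by move=> dP; apply/malgP => m; rewrite coefmapE raddfMz /= (twist_homog _ (dP m)).
Qed.

(* twso s n multiplies the j-th of l entries by (-1)^(s (l - j + n) |x_j|). *)
Fixpoint twso A (s : int) (n : nat) (a : seq A) : seq A :=
  if a is x :: a' then twist (s * (size a' + n)%N%:Z) x :: twso s n a' else [::].

Lemma size_twso A s n (a : seq A) : size (twso s n a) = size a.
Proof. by elim: a => //= x a ->. Qed.

Lemma twso_cat A s n (a b : seq A) :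
  twso s n (a ++ b) = twso s (size b + n) a ++ twso s n b.
Proof. by elim: a => //= x a ->; rewrite size_cat addnA. Qed.

Lemma koszul_mapE A B (g : A -> B) e a : koszul_map e g a = map g (twso e 0 a).
Proof.
rewrite /koszul_map; elim: a => // x a IH; rewrite /= -IH /mkseq /= subn1 addn0; congr cons.
by rewrite -[1%N]addn0 iotaDl -map_comp; apply: eq_map => j /=; rewrite subSS.
Qed.

Lemma sesquilinear_twso A s k (f : seq A -> {lpoly A}) :
  conformal_sesquilinear k f -> conformal_sesquilinear k (fun a => f (twso s 0 a)).
Proof.
case=> fv fL fD fD'; split=> [a sa|a b x y c ek|a b x ek b0|a x ek].
- by apply: fv; rewrite size_twso.
- by rewrite !twso_cat /= linearP fL // !size_twso.
- by rewrite !twso_cat /= linearZ fD ?size_twso.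
by rewrite -!cats1 !twso_cat /= linearZ !cats1 fD' ?size_twso.
Qed.

Lemma twso_inv A s (a : seq A) : twso s 0 (twso (- s) 0 a) = a.
Proof.
elim: a => //= x a ->; rewrite size_twso -{1}[s]opprK mulNr twist_twistN //.
Qed.

Lemma fdeg_twso A k e s (f : seq A -> {lpoly A}) :
  fdeg k e f -> fdeg k e (fun a => f (twso s 0 a)).
Proof.
move=> fe ds a sa da; apply: fe; first by rewrite size_twso.
elim: a ds da {sa} => [|x a IH] [|d ds] //; try by case.
move=> /homogs_cons[dx da]; apply/homogs_cons; split; last exact: IH.
by rewrite (twist_homog _ dx); apply: homogMz.
Qed.

(** The Koszul exponent of a tensor power of an odd map at arguments of degrees [es]: each degree
    counts once for every argument to its right. *)
Fixpoint kexp (es : seq int) : int :=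
  if es is e :: es' then (size es')%:Z * e + kexp es' else 0.

Lemma kexp_cat es1 es2 :
  kexp (es1 ++ es2) = kexp es1 + (size es2)%:Z * \sum_(e <- es1) e + kexp es2.
Proof.
elim: es1 => [|e es1 IH] /=; first by rewrite big_nil mulr0 !add0r.
by rewrite IH big_cons size_cat PoszD; ring.
Qed.

Lemma ext_opp A L (f : seq A -> {lpoly A}) Ps : ext L (fun a => - f a) Ps = - ext L f Ps.
Proof.
elim: Ps f => [|P Ps IH] f; first by rewrite !ext_nil raddfN.
rewrite !ext_cons /msum -sumrN; apply: eq_bigr => m _.
by rewrite -raddfN -IH.
Qed.

(** On arguments of degrees [es] the twists are scalar signs, which leave [f] by multilinearity. *)
Lemma ext_koszul A k L (f : seq A -> {lpoly A}) es Ps :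
  multilin k f -> size Ps = k -> homs es Ps ->
  ext L (fun a => f (twso (-1) 0 a)) Ps = ext L f Ps *~ sg (kexp es).
Proof.
elim: Ps k f es => [|P Ps IH] k f [|e es] fL ek //; first by rewrite !ext_nil.
case: k fL ek => // k fL [ek] [eP ePs].
have ses : size es = size Ps := homs_size ePs.
rewrite !ext_cons /msum mulrz_suml; apply: eq_bigr => m _.
rewrite -raddfMz; congr (lact _ _).
rewrite /= sgD mulrzA ses -sgN -mulNr.
transitivity (ext L (fun a => f (P@_m *~ sg (-1 * (size Ps)%:Z * e) :: twso (-1) 0 a)) Ps).
  by apply: eq_ext => a sa; rewrite /= addn0 sa (twist_homog _ (eP m)).
have IHm := IH k (fun a => f (P@_m :: a)) es (multilin_cons _ fL) ek ePs.
rewrite mulN1r; case: (sg_cases (- (size Ps)%:Z * e)) => ->.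
  by rewrite !mulr1z IHm.
rewrite !mulrN1z.
rewrite mulNrz -IHm -ext_opp; apply: eq_ext => a sa.
by apply: (multilinN (a := [::]) _ fL); rewrite /= size_twso sa ek.
Qed.

End Twist.

Lemma sg_eq a b c : a = b + (c + c) -> sg a = sg b.
Proof. by move=> ->; rewrite sgD sg_double mulr1. Qed.

(** With [i = j - 1] arguments before the inner map and [n - i - l] after it, [k] is determined; the
    triple sum becomes one over factorizations of a word of length [n]. *)
Lemma sum_relation_reindex (R : nmodType) n (X : nat -> nat -> nat -> R) :
  \sum_(1 <= k < n.+1) \sum_(1 <= l < n.+1 | (k + l == n.+1)%N) \sum_(1 <= j < k.+1) X k l j =
  \sum_(0 <= i < n.+1) \sum_(1 <= l < (n - i).+1) X (i + (n - i - l)).+1 l i.+1.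
Proof.
rewrite (exchange_big_dep_nat predT) //=.
have -> : \sum_(0 <= i < n.+1) \sum_(1 <= l < (n - i).+1) X (i + (n - i - l)).+1 l i.+1 =
    \sum_(0 <= i < n.+1) \sum_(1 <= l < n.+1 | (l < (n - i).+1)%N) X (i + (n - i - l)).+1 l i.+1.
  by apply: eq_bigr => i _; rewrite (big_nat_widen 1 _ n.+1) // ltnS leq_subr.
rewrite [RHS](exchange_big_dep_nat predT) //=; apply: eq_big_nat => l /andP[l0 ln].
have kl k : (k + l == n.+1)%N = (k == n.+1 - l)%N.
  by apply/eqP/eqP => [<-|->]; rewrite ?addnK // subnK // ltnW.
under eq_bigl do rewrite kl.
rewrite big_nat1_eq subn_gt0 ln ltn_subrL l0 /= big_add1 /=.
rewrite (big_nat_widen 0 _ n.+1) ?leq_subr // big_nat_cond [RHS]big_nat_cond.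
apply: eq_big => [i|i /andP[/andP[_ iN] il]].
  rewrite andbC [RHS]andbC; apply: andb_id2r => /andP[_ iN].
  by rewrite ltn_subRL !ltnS leq_subRL // addnC.
by have -> : (n.+1 - l = (i + (n - i - l)).+1)%N by lia.
Qed.

(** * The relations at words of a fixed length *)

Section KoszulSigns.
Variables (F : fieldType) (B : gradedModule F).
Implicit Types (m : nat -> seq B -> {lpoly B}).
Local Notation word := (seq ({lpoly B} * {lpoly F})).

Definition pointwise (g : B -> B) : nat * (seq B -> {lpoly B}) := (1%N, fun a => cst (g (head 0 a))).

Lemma lidE : lid B = pointwise id.
Proof. by rewrite /lid /pointwise mono_def. Qed.

Lemma pointwise_multilin (g : {linear B -> B}) : multilin 1 (pointwise g).2.
Proof.
move=> [|z a] [|z' b] // x y c _; rewrite /= linearP raddfD /=; congr (_ + _).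
by rewrite lactUU mul1m.
Qed.

Lemma pointwise_mvar (g : {linear B -> B}) : mvar 1 (pointwise g).2.
Proof. by split=> [|a _]; [exact: pointwise_multilin|exact: in_varsC]. Qed.

Lemma hat_pointwise (g : {linear B -> B}) l : hat (pointwise g).2 [:: l] = coefmap g l.1.
Proof.
rewrite /hat ext_cons [l.1 in RHS]sum_mono raddf_sum; apply: eq_bigr => k _.
by rewrite ext_nil lsubC /= coefmapU lactUU scale1r mulm1.
Qed.

Lemma pcomp_pointwise (g : {linear B -> B}) (w : word) :
  pcomp (nseq (size w) (pointwise g)) w = map (onl (coefmap g)) w.
Proof.
elim: w => //= l w <-; rewrite take0 drop0 hat_pointwise; congr cons.
by rewrite /onl /wt big_seq1.
Qed.

Lemma arity_nseq (T : Type) n (x : nat * T) : x.1 = 1%N -> arity (nseq n x) = n.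
Proof. by move=> x1; rewrite map_nseq x1 sumn_nseq mul1n. Qed.

(* f_k o (g (x) ... (x) g (x) f_l (x) 1 (x) ... (x) 1) with i factors g and r factors 1. *)
Definition insertion (g : B -> B) m i l r :=
  nseq i (pointwise g) ++ (l, m l) :: nseq r (pointwise id).

Lemma size_insertion g m i l r : size (insertion g m i l r) = (i + r).+1.
Proof. by rewrite size_cat /= !size_nseq addnS. Qed.

Lemma arity_insertion g m i l r : arity (insertion g m i l r) = (i + (l + r))%N.
Proof. by rewrite map_cat sumn_cat /= !arity_nseq. Qed.

Lemma pcomp_insertion (g : {linear B -> B}) m (u v r : word) :
  pcomp (insertion g m (size u) (size v) (size r)) (u ++ v ++ r) =
  map (onl (coefmap g)) u ++ (hat (m (size v)) v, wt v) :: r.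
Proof.
rewrite pcomp_block ?arity_nseq // pcomp_pointwise (pcomp_pointwise idfun).
rewrite [X in _ ++ _ :: X](_ : _ = r) //.
elim: r => //= -[x c] r ->; congr cons; rewrite /onl /=; congr pair.
by apply/malgP => k; rewrite coefmapE.
Qed.

Lemma insertion_allp (P : nat * (seq B -> {lpoly B}) -> Prop) (g : {linear B -> B}) m i l r :
  P (pointwise g) -> P (pointwise idfun) -> P (l, m l) -> allp P (insertion g m i l r).
Proof.
move=> Pg P1 Pm; apply/allp_cat; split; first by elim: i.
by split=> //; elim: r.
Qed.

Definition wmap m (w : word) := hat (m (size w)) w.

Definition relation_sum (g : B -> B) m n (w : word) : {lpoly B} :=
  \sum_(0 <= i < n.+1) \sum_(1 <= l < (n - i).+1)
    hat (m (i + (n - i - l)).+1) (pcomp (insertion g m i l (n - i - l)) w).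

Lemma ins_relation_sum (g : {linear B -> B}) m (w : word) :
  ins (fun u v r => wmap m (map (onl (coefmap g)) u ++ (wmap m v, wt v) :: r)) w =
  relation_sum g m (size w) w.
Proof.
rewrite /ins /cut /relation_sum; apply: eq_big_nat => i /andP[_ iw].
rewrite big_ltn // take0 add0r size_drop; apply: eq_big_nat => l /andP[l0 lw].
have s1 : size (take i w) = i by rewrite size_takel.
have s2 : size (take l (drop i w)) = l by rewrite size_takel // size_drop.
have s3 : size (drop l (drop i w)) = (size w - i - l)%N by rewrite !size_drop.
case tE: (take l (drop i w)) s2 => [|x v] s2; first by rewrite -s2 in l0.
have wE : w = take i w ++ (x :: v) ++ drop l (drop i w) by rewrite -tE !cat_take_drop.
have := pcomp_insertion g m (take i w) (x :: v) (drop l (drop i w)).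
rewrite s1 s2 s3 -wE => ->.
by rewrite /wmap s2 size_cat size_map s1 /= s3 addnS.
Qed.

End KoszulSigns.

Section RelationExtension.
Variables (F : fieldType) (B : gradedModule F) (g : {linear B -> B}).
Variable f : nat -> seq B -> {lpoly B}.
Hypothesis fv : forall k, (0 < k)%N -> mvar k (f k).
Local Notation word := (seq ({lpoly B} * {lpoly F})).

Let insL i l r : (0 < l)%N -> allp (fun q => multilin q.1 q.2) (insertion g f i l r).
Proof.
by move=> l0; apply: insertion_allp; [exact: pointwise_multilin|exact: pointwise_multilin|exact: (fv l0).1].
Qed.

Lemma relation_sum_wlin n : wlin n (relation_sum g f n).
Proof.
move=> u v p x y c ek; rewrite /relation_sum raddf_sum -big_split; apply: eq_big_nat => i /andP[_ iN].
rewrite raddf_sum -[RHS]big_split; apply: eq_big_nat => l /andP[l0 lN] /=.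
have ar : (size u + size v).+1 = arity (insertion g f i l (n - i - l)).
  by rewrite arity_insertion ek; lia.
apply: (hat_pcomp_wlin _ (insL _ _ l0)) => //.
by rewrite size_insertion; exact: (fv _).1.
Qed.

Lemma lsub_relation_sum n L (w : word) : size w = n ->
  lsub L (relation_sum g f n w) = relation_sum g f n (map (subw L) w).
Proof.
move=> sw; rewrite /relation_sum raddf_sum; apply: eq_big_nat => i /andP[_ iN].
rewrite /= raddf_sum; apply: eq_big_nat => l /andP[l0 lN] /=.
rewrite (lsub_hat (k := (i + (n - i - l)).+1)) ?size_pcomp ?size_insertion //; last exact: (fv _).1.
by rewrite pcomp_subw //; [exact: insL|rewrite arity_insertion; lia].
Qed.

(** The sum is multilinear and commutes with substitution, and homogeneous vectors span, so generic
    words on homogeneous vectors decide. *)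
Lemma relation_sum_eq0 n :
  (forall es a, size a = n -> homogs es a -> relation_sum g f n (genw 0 a) = 0) ->
  forall w, size w = n -> relation_sum g f n w = 0.
Proof.
move=> rel; apply: (@word_ind _ _ (fun x : B => exists d, homog d x)).
- by exists 0; exact: homog0.
- exact: homog_span.
- by move=> u v p x y c ek ex ey; rewrite relation_sum_wlin // ex ey raddf0 addr0.
move=> t st ht; rewrite cst_word -subw_genw ?size_map // -lsub_relation_sum ?size_genw ?size_map //.
have [es hes] : exists es, homogs es (unzip1 t).
  elim: t ht {st} => [|l t IH] ht; first by exists [::].
  have [d dl] := ht l (mem_head _ _).
  have [|es des] := IH; first by move=> l' l't; apply: ht; rewrite inE l't orbT.
  by exists (d :: es); apply/homogs_cons.
by rewrite (rel es) ?size_map // raddf0.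
Qed.

End RelationExtension.

(** * Signs of the relations under suspension *)

Section KoszulRelation.
Variables (F : fieldType) (B : gradedModule F) (m : nat -> seq B -> {lpoly B}).
Hypothesis msesq : forall k, (0 < k)%N -> conformal_sesquilinear k (m k).
Hypothesis mdeg : forall k, (0 < k)%N -> fdeg k (-1) (m k).
Local Notation word := (seq ({lpoly B} * {lpoly F})).

(* lmap id makes this convertible to shifted_maps m k when B is a shift. *)
Definition koszul (k : nat) (a : seq B) : {lpoly B} := lmap id (m k (koszul_map (-1) id a)).

Lemma koszulE k a : koszul k a = m k (twso (-1) 0 a).
Proof. by rewrite /koszul lmap_id koszul_mapE map_id. Qed.

Let mL k : (0 < k)%N -> multilin k (m k).
Proof. by move=> /msesq/csqP[[]]. Qed.

Lemma homdMz d n (P : {lpoly B}) : homd d P -> homd d (P *~ n).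
Proof. by move=> dP k; rewrite (raddfMz (mcoeff k)); apply/homogMz/dP. Qed.

Lemma hat_koszul k es w : (0 < k)%N -> size w = k -> homs es (unzip1 w) ->
  hat (koszul k) w = hat (m k) w *~ sg (kexp es).
Proof.
move=> k0 sw ew; have sw1 : size (unzip1 w) = k by rewrite size_map.
rewrite /hat -(ext_koszul _ (mL k0) sw1 ew); apply: eq_ext => a _; exact: koszulE.
Qed.

Lemma wlin_sg k (G : word -> {lpoly B}) u v x c n : wlin k G -> (size u + size v).+1 = k ->
  G (u ++ (x *~ sg n, c) :: v) = G (u ++ (x, c) :: v) *~ sg n.
Proof.
move=> GL ek; case: (sg_cases n) => ->; rewrite ?mulr1z // !mulrN1z.
have := GL u v (- 1) x 0 c ek.
by rewrite addr0 (wlin0 _ GL) // addr0 !lactNl !lact1.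
Qed.

Lemma hat_twist k (G : word -> {lpoly B}) u v eu : wlin k G -> (size u + size v)%N = k ->
  homs eu (unzip1 u) ->
  G (map (onl (coefmap (twist 1))) u ++ v) = G (u ++ v) *~ sg (\sum_(e <- eu) e).
Proof.
move=> GL; suff gen a : (size a + (size u + size v))%N = k -> homs eu (unzip1 u) ->
    G (a ++ map (onl (coefmap (twist 1))) u ++ v) = G (a ++ u ++ v) *~ sg (\sum_(e <- eu) e).
  exact: (gen [::]).
elim: u a eu => [|[x c] u IH] a [|e eu] //; first by rewrite big_nil mulr1z.
move=> ek [ex eu'] /=; set l := onl _ _; rewrite -!cat_rcons.
have ek' : (size (rcons a l) + (size u + size v))%N = k by rewrite size_rcons addSn -addnS.
rewrite (IH (rcons a l) eu ek' eu') big_cons sgD mulrzA !cat_rcons.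
have -> : l = (x *~ sg e, c) by rewrite /l /onl /= (coefmap_twist 1 ex) mul1r.
have ek'' : (size a + size (u ++ v)).+1 = k by rewrite -ek /= size_cat addnS.
by rewrite (wlin_sg _ _ _ GL ek'').
Qed.

(** Three signs are collected: the outer Koszul sign, in which the inner value has one degree less
    than its block, the inner Koszul sign, and the twist of the prefix. Modulo 2 the exponents add
    up to that of the whole word, [l] times the degree of the prefix, and [r]; the last is due to
    the degree -1 of the inner map. *)
Lemma koszul_term i l r es w : (0 < l)%N -> size w = (i + (l + r))%N -> homs es (unzip1 w) ->
  hat (koszul (i + r).+1) (pcomp (insertion (twist 1) koszul i l r) w) =
  hat (m (i + r).+1) (pcomp (insertion id m i l r) w) *~
    sg (kexp es + l%:Z * \sum_(e <- take i es) e + r%:Z).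
Proof.
move=> l0 sw hes.
have ses : size es = size w by rewrite (homs_size hes) size_map.
set u := take i w; set v := take l (drop i w); set t := drop l (drop i w).
have su : size u = i by rewrite size_takel // sw; lia.
have sv : size v = l by rewrite size_takel // size_drop sw; lia.
have st : size t = r by rewrite !size_drop sw; lia.
have wE : w = u ++ v ++ t by rewrite !cat_take_drop.
set eu := take i es; set ev := take l (drop i es); set et := drop l (drop i es).
have esE : es = eu ++ ev ++ et by rewrite !cat_take_drop.
have [hu hvt] := homs_split i hes; have [hv ht] := homs_split l hvt.
rewrite -!map_drop -!map_take -/u -/v -/t -/eu -/ev -/et in hu hv ht.
have pE (g : {linear B -> B}) f : pcomp (insertion g f i l r) w =
    map (onl (coefmap g)) u ++ (hat (f l) v, wt v) :: t.
  by have := pcomp_insertion g f u v t; rewrite su sv st -wE.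
have pE1 f : pcomp (insertion id f i l r) w = u ++ (hat (f l) v, wt v) :: t.
  rewrite (pE idfun); congr (_ ++ _); rewrite -[RHS]map_id; apply: eq_map => -[x c].
  by rewrite /onl /=; congr pair; apply/malgP => k; rewrite coefmapE.
rewrite pE pE1 (hat_koszul (es := eu ++ (\sum_(e <- ev) e - 1) :: et)) //; last 2 first.
- by rewrite size_cat /= size_map su st addnS.
- rewrite /unzip1 map_cat /=; apply: homs_cat.
    elim: (u) (eu) hu => [|[x c] u' IH] [|e eu'] //= [ex /IH ?]; split=> //.
    by rewrite (coefmap_twist 1 ex); apply: homdMz.
  split=> //; rewrite (hat_koszul (es := ev)) //; apply: homdMz.
  exact: (homd_hat (mdeg l0)).
rewrite (hat_twist (k := (i + r).+1) (eu := eu)) //; last 2 first.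
- exact/hat_wlin/mL.
- by rewrite /= su st addnS.
rewrite (hat_koszul (es := ev)) // (wlin_sg _ _ _ (hat_wlin (mL (ltn0Sn (i + r))))) ?su ?st //.
rewrite -!mulrzA -!sgD; congr (_ *~ _).
rewrite esE !kexp_cat /= size_cat.
have -> : size et = r by rewrite !size_drop ses sw; lia.
have -> : size ev = l by rewrite size_takel // size_drop ses sw; lia.
(* Half the difference of the two exponents. *)
apply: (@sg_eq _ _ ((1 - l%:Z) * (\sum_(e <- eu) e) - r%:Z)).
rewrite PoszD -[(r.+1)%:Z]/(1 + r)%:Z PoszD.
ring.
Qed.

Definition ainfty_sum n (ds : seq int) (a : seq B) : {lpoly B} :=
    \sum_(1 <= k < n.+1) \sum_(1 <= l < n.+1 | (k + l == n.+1)%N)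
      \sum_(1 <= j < k.+1)
        graft (m k) (nseq j.-1 (lid B) ++ (l, m l) :: nseq (k - j) (lid B)) a
          *~ (-1) ^ ((j * l.+1)%N%:Z + l%:Z * \sum_(d <- take j.-1 ds) d).

(** The letters have degrees [d + 1], so a prefix of length [i] contributes its original degree plus
    [i]. The exponents of [koszul_term] and of the relation then differ modulo 2 by a quantity
    independent of the term, which is the global sign. *)
Lemma koszul_relation n ds a : size a = n -> homogs [seq d + 1 | d <- ds] a ->
  relation_sum (twist 1) koszul n (genw 0 a) =
  ainfty_sum n ds a *~ sg (kexp [seq d + 1 | d <- ds] + n.+1%:Z).
Proof.
move=> sa hes; rewrite /ainfty_sum.
rewrite (sum_relation_reindex n (fun k l j =>
  graft (m k) (nseq j.-1 (lid B) ++ (l, m l) :: nseq (k - j) (lid B)) a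
          *~ (-1) ^ ((j * l.+1)%N%:Z + l%:Z * \sum_(d <- take j.-1 ds) d))).
rewrite /relation_sum mulrz_suml; apply: eq_big_nat => i /andP[_ iN].
rewrite mulrz_suml; apply: eq_big_nat => l /andP[l0 lN].
set r := (n - i - l)%N; have nE : n = (i + (l + r))%N by rewrite /r; lia.
have hes' := homogs_homs hes.
rewrite (koszul_term (es := [seq d + 1 | d <- ds])) ?size_genw -?nE //; last first.
  by rewrite unzip1_zip // !size_map size_iota.
rewrite subSS addKn /= lidE -/(insertion id m i l r) -mulrzA -sgD.
rewrite graftE; last 2 first.
- apply: (insertion_allp (g := idfun)); [exact: (pointwise_mvar idfun)|exact: (pointwise_mvar idfun)|].
  by have [] := csqP (msesq l0).
- by rewrite arity_insertion -nE.
congr (_ *~ _); rewrite -/(sg _).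
have -> : \sum_(e <- take i [seq d + 1 | d <- ds]) e = \sum_(d <- take i ds) d + i%:Z.
  have sds : size ds = n by case: hes; rewrite size_map => ->.
  rewrite -map_take big_map big_split /=; congr (_ + _).
  rewrite big_const_seq count_predT size_takel ?sds; last by lia.
  by elim: (i) => //= i' ->; rewrite -add1n PoszD.
set S := \sum_(d <- _) d; set K := kexp _.
apply: (@sg_eq _ _ (- 1 - i%:Z - l%:Z)).
rewrite nE PoszM -[l.+1]add1n -[i.+1]add1n -[(i + (l + r)).+1]add1n !PoszD.
ring.
Qed.

End KoszulRelation.

(** * Sums and conjugates of sesquilinear maps *)

Section Closure.
Variable F : fieldType.
Implicit Types (V W : lmodType {poly F}) (A B : gradedModule F).

Lemma onl_wD V W (g : {linear V -> W}) (l : {lpoly V} * {lpoly F}) :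
  (coefmap g (wD l).1, l.2) = wD (coefmap g l.1, l.2).
Proof.
rewrite /wD /= raddfD /= coefmap_lact; congr (_ + _, _).
by apply/malgP => m; rewrite !coefmapE /= linearZ.
Qed.

Lemma hat_sum V (I : Type) (r : seq I) (f : I -> seq V -> {lpoly V}) w :
  hat (fun a => \sum_(i <- r) f i a) w = \sum_(i <- r) hat (f i) w.
Proof.
rewrite /hat; elim: (unzip1 w) f => [|P Ps IH] f.
  by rewrite ext_nil raddf_sum; apply: eq_bigr => i _; rewrite ext_nil.
transitivity (\sum_(m <- msupp P) \sum_(i <- r)
    lact (mono m 1) (ext (nth 0 (unzip2 w)) (fun a => f i (P@_m :: a)) Ps)).
  rewrite ext_cons; apply: eq_bigr => m _.
  by rewrite (IH (fun i a => f i (P@_m :: a))) raddf_sum.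
by rewrite exchange_big; apply: eq_bigr => i _; rewrite ext_cons.
Qed.

Lemma csq_sum V k (I : eqType) (r : seq I) (f : I -> seq V -> {lpoly V}) :
  (forall i, i \in r -> csq k (f i)) -> csq k (fun a => \sum_(i <- r) f i a).
Proof.
elim: r => [|i r IH] fD.
  have e0 w : hat (fun a : seq V => \sum_(i <- [::]) f i a) w = 0.
    by rewrite (hat_sum [::] f) big_nil.
  split; first split=> [a b x y c _|a _].
  - by rewrite !big_nil raddf0 addr0.
  - by rewrite big_nil; exact: in_vars0.
  - by move=> *; rewrite e0.
  by move=> *; rewrite !e0 /wD /= !raddf0 addr0.
have [[L1 v1] D1 D1'] := fD i (mem_head _ _).
have [|[L2 v2] D2 D2'] := IH; first by move=> j jr; apply: fD; rewrite inE jr orbT.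
have hE w : hat (fun a => \sum_(i <- i :: r) f i a) w =
    hat (f i) w + hat (fun a => \sum_(i <- r) f i a) w.
  by rewrite !hat_sum big_cons.
split; first split=> [a b x y c ek|a sa].
- by rewrite !big_cons L1 // L2 // raddfD addrACA.
- by rewrite big_cons; apply: in_varsD; [exact: v1|exact: v2].
- by move=> u l v ek v0; rewrite hE D1 // D2 // addr0.
by move=> u l ek; rewrite !hE D1' // D2' // /wD /= !raddfD /= addrACA.
Qed.

Lemma hat_conj V W k (f : seq V -> {lpoly V}) (p : {linear V -> W}) (i : {linear W -> V}) w :
  multilin k f -> size w = k ->
  hat (fun a => coefmap p (f (map i a))) w = coefmap p (hat f (map (onl (coefmap i)) w)).
Proof.
move=> fL sw; rewrite /hat (ext_conj _ _ _ fL) ?size_map //.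
by rewrite /unzip1 /unzip2 -!map_comp.
Qed.

Lemma csq_conj V W k (f : seq V -> {lpoly V}) (p : {linear V -> W}) (i : {linear W -> V}) :
  csq k f -> csq k (fun a => coefmap p (f (map i a))).
Proof.
move=> [[fL fv] fD fD'].
split; first split; first exact: multilin_conj.
- by move=> a sa; apply/in_vars_coefmap/fv; rewrite size_map.
- move=> u l v ek v0; rewrite (hat_conj _ _ fL) ?size_cat //= ?addnS //.
  rewrite map_cat /= {2}/onl onl_wD fD ?raddf0 ?size_map //.
  by case: (v) v0.
move=> u l ek; rewrite !(hat_conj _ _ fL) ?size_rcons // !map_rcons {2}/onl onl_wD.
rewrite fD' ?size_map //.
have -> : wt (rcons (map (onl (coefmap i)) u) (onl (coefmap i) l)) = wt (rcons u l).
  by rewrite -!cats1 !wt_cat /wt !big_seq1 big_map.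
exact: (congr1 fst (onl_wD p (_, _))).
Qed.

End Closure.

(** * Transfer of the shifted maps *)

Section Trees.
Variables (F : fieldType) (B : gradedModule F).
Variables (rho : nat -> seq B -> {lpoly B}) (h : {linear B -> B}).
Hypothesis rhoD : forall k, (0 < k)%N -> csq k (rho k).
Hypothesis rho_deg : forall k, (0 < k)%N -> fdeg k (-1) (rho k).
Hypothesis h_deg : has_degree 1 h.

Lemma eq_hat (V : lmodType {poly F}) k (f f' : seq V -> {lpoly V}) (w : seq ({lpoly V} * {lpoly F})) :
  (forall a, size a = k -> f a = f' a) -> size w = k -> hat f w = hat f' w.
Proof. by move=> ef sw; apply: eq_ext => a; rewrite size_map sw; apply: ef. Qed.

Lemma eq_csq (V : lmodType {poly F}) k (f f' : seq V -> {lpoly V}) :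
  (forall a, size a = k -> f a = f' a) -> csq k f -> csq k f'.
Proof.
move=> ef [[fL fv] fD fD']; split; first split=> [a b x y c ek|a sa].
- by rewrite -!ef ?size_cat /= ?addnS // fL.
- by rewrite -ef //; exact: fv.
- by move=> u l v ek v0; rewrite -(eq_hat ef) ?fD // size_cat /= addnS.
by move=> u l ek; rewrite -!(eq_hat ef) ?fD' // size_rcons.
Qed.

Lemma csq_coefmap (V : lmodType {poly F}) k (f : seq V -> {lpoly V}) (g : {linear V -> V}) :
  csq k f -> csq k (fun a => coefmap g (f a)).
Proof.
move=> fD; apply: eq_csq (csq_conj g idfun fD) => a _.
by rewrite (_ : map _ a = a) //; exact: map_id.
Qed.

Lemma csq_pointwise (g : {linear B -> B}) : csq 1 (pointwise g).2.
Proof.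
split; first exact: pointwise_mvar.
  by move=> [|l' u] l [|l'' v].
move=> [|l' u] l // _; rewrite !(hat_pointwise g).
by rewrite /wt big_seq1; exact: (congr1 fst (onl_wD g l)).
Qed.

Definition branch (u : ptree) : nat * (seq B -> {lpoly B}) :=
  if u is PLeaf then lid B else (leaves u, fun a => lmap h (rho_tree rho h u a)).

Lemma branch_node t1 t2 ts : branch (PNode t1 t2 ts) =
  (leaves (PNode t1 t2 ts), fun a => coefmap h (rho_tree rho h (PNode t1 t2 ts) a)).
Proof. by rewrite coefmap_def. Qed.

Lemma branch_arity u : (branch u).1 = leaves u.
Proof. by case: u. Qed.

Lemma map_branch_arity us : [seq q.1 | q <- map branch us] = map leaves us.
Proof. by rewrite -map_comp; apply: eq_map => u; exact: branch_arity. Qed.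

Lemma branch_csq u : csq (leaves u) (rho_tree rho h u) -> csq (branch u).1 (branch u).2.
Proof.
case: u => [_|t1 t2 ts uD]; first by rewrite /branch lidE; exact: (csq_pointwise idfun).
by rewrite branch_node; exact: csq_coefmap uD.
Qed.

Let allp_branch (K : ptree -> Prop) (Q : nat * (seq B -> {lpoly B}) -> Prop) t1 t2 ts :
  (forall u, K u -> Q (branch u)) -> K t1 -> K t2 ->
  foldr (fun t => and (K t)) True ts -> allp Q (map branch [:: t1, t2 & ts]).
Proof.
move=> KQ K1 K2 Ks; split; [exact: KQ|split; [exact: KQ|]].
by elim: ts Ks => //= t ts IH [/KQ ? /IH].
Qed.

Lemma rho_tree_node t1 t2 ts :
  rho_tree rho h (PNode t1 t2 ts) = graft (rho (size ts).+2) (map branch [:: t1, t2 & ts]).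
Proof. by []. Qed.

Lemma leaves_node t1 t2 ts :
  leaves (PNode t1 t2 ts) = arity (map branch [:: t1, t2 & ts]).
Proof. by rewrite map_branch_arity /= addnA. Qed.

Lemma rho_tree_csq t : csq (leaves t) (rho_tree rho h t).
Proof.
elim: t => [|t1 t2 ts K1 K2 Ks].
  by apply: eq_csq (csq_pointwise idfun) => a _; rewrite /= mono_def.
rewrite rho_tree_node leaves_node; apply: graft_csq; first by rewrite size_map; exact: rhoD.
apply: (allp_branch (K := fun t => csq (leaves t) (rho_tree rho h t))) => // u uD.
by split; [exact: branch_csq|rewrite branch_arity; exact: leaves_gt0].
Qed.

Lemma branches_csq us : allp (fun q => csq q.1 q.2) (map branch us).
Proof. by elim: us => //= u us IH; split=> //; apply: branch_csq; exact: rho_tree_csq. Qed.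

Lemma branches_mvar us : allp (fun q => mvar q.1 q.2) (map branch us).
Proof. by apply: allp_imp (branches_csq us) => q []. Qed.

Lemma homs_pcomp phis ds (w : seq ({lpoly B} * {lpoly F})) :
  allp (fun q => fdeg q.1 0 q.2) phis -> size w = arity phis -> homs ds (unzip1 w) ->
  exists ds', homs ds' (unzip1 (pcomp phis w)) /\ \sum_(d <- ds') d = \sum_(d <- ds) d.
Proof.
elim: phis ds w => [|q phis IH] ds w /=.
  by case: w => // _ _; case: ds => // _; exists [::].
move=> [qd phisd] sw hw; have [h1 h2] := homs_split q.1 hw.
rewrite -map_take in h1; rewrite -map_drop in h2.
have qw : (q.1 <= size w)%N by rewrite sw leq_addr.
have [|ds' [h' e']] := IH _ _ phisd _ h2; first by rewrite size_drop sw addKn.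
exists (\sum_(d <- take q.1 ds) d + 0 :: ds'); split; last first.
  by rewrite big_cons e' addr0 -big_cat cat_take_drop.
by split=> //; apply: (homd_hat qd) => //; rewrite size_takel.
Qed.

Lemma graft_fdeg phis e (f : seq B -> {lpoly B}) : fdeg (size phis) e f ->
  allp (fun q => fdeg q.1 0 q.2) phis -> allp (fun q => mvar q.1 q.2) phis ->
  fdeg (arity phis) e (graft f phis).
Proof.
move=> fe phise phisv ds a sa da; rewrite graftE //.
have [||ds' [h' <-]] := @homs_pcomp phis ds (genw 0 a) phise.
- by rewrite size_genw.
- by rewrite unzip1_zip ?size_map ?size_iota //; exact: homogs_homs.
by apply: (homd_hat fe); rewrite ?size_pcomp.
Qed.

(** A grafting has the degree -1 of the map at its root: [h] raises a nontrivial branch to degree 0,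
    and the trivial branch is the identity. *)
Lemma rho_tree_fdeg t : fdeg (leaves t) (if t is PLeaf then 0 else -1) (rho_tree rho h t).
Proof.
have branch_deg u : fdeg (leaves u) (if u is PLeaf then 0 else -1) (rho_tree rho h u) ->
    fdeg (branch u).1 0 (branch u).2.
  case: u => [ud|u1 u2 us]; first exact: ud.
  rewrite branch_node; move: (rho_tree rho h _) (leaves _) => f n fd ds a sa da.
  have := homd_coefmap h_deg (fd ds a sa da).
  by rewrite -addrA addNr.
elim: t => [|t1 t2 ts K1 K2 Ks].
  move=> [|d [|d' ds]] [|x [|x' a]] // _; try by case.
  move=> /homogs_cons[dx _]; rewrite big_seq1 addr0 /= -mono_def; exact: homd_mono.
rewrite rho_tree_node leaves_node; apply: graft_fdeg; last exact: branches_mvar.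
  by rewrite size_map; exact: rho_deg.
exact: (allp_branch (K := fun t => fdeg (leaves t) (if t is PLeaf then 0 else -1) (rho_tree rho h t))).
Qed.

Lemma hat_rho_tree_node t1 t2 ts w : size w = leaves (PNode t1 t2 ts) ->
  hat (rho_tree rho h (PNode t1 t2 ts)) w =
  wmap rho (forest_values (fun t w => hat (rho_tree rho h t) w) (coefmap h) [:: t1, t2 & ts] w).
Proof.
rewrite rho_tree_node leaves_node => sw; rewrite hat_graft //; last 2 first.
- by rewrite size_map; have [[]] := rhoD (ltn0Sn (size ts).+1).
- exact: branches_mvar.
have pE us (v : seq ({lpoly B} * {lpoly F})) : size v = sumn (map leaves us) -> pcomp (map branch us) v =
    forest_values (fun t w => hat (rho_tree rho h t) w) (coefmap h) us v.
  elim: us v => // u us IH v sv; rewrite /forest_values /= branch_arity IH; last first.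
    by rewrite size_drop sv addKn.
  congr ((_, _) :: _); case: u sv => [|u1 u2 us'] sv.
    rewrite /branch lidE; case: v sv => // l v _.
    have -> : take (leaves PLeaf) (l :: v) = [:: l] by rewrite /= take0.
    rewrite (hat_pointwise idfun).
    by apply/malgP => m; rewrite coefmapE.
  by rewrite branch_node; exact: (ext_coefmap _ h).
have fv : size (forest_values (fun t w => hat (rho_tree rho h t) w) (coefmap h)
    [:: t1, t2 & ts] w) = (size ts).+2.
  by rewrite size_map size_zip size_reshape !size_map minnn.
by rewrite /wmap fv pE // sw map_branch_arity.
Qed.

End Trees.

Lemma sg1 : sg 1 = -1.
Proof. by rewrite /sg expr1z. Qed.

Lemma degree_twist (F : fieldType) (B C : gradedModule F) e (g : {linear B -> C}) n x :
  has_degree e g -> twist n (g x) = g (twist n x) *~ sg (n * e).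
Proof.
move=> ge; have [s [hs ->]] := homog_span x.
elim: s hs => [|y s IH] hs; first by rewrite big_nil !raddf0 mul0rz.
rewrite big_cons !raddfD /= mulrzDl; congr (_ + _); last first.
  by apply: IH => z zs; apply: hs; rewrite inE zs orbT.
have [d dy] := hs y (mem_head _ _).
rewrite (twist_homog _ (ge d y dy)) (twist_homog _ dy) raddfMz /= -mulrzA -!/(sg _).
by rewrite -sgD mulrDr.
Qed.

Lemma coefmap_degree_twist (F : fieldType) (B C : gradedModule F) e (g : {linear B -> C}) n P :
  has_degree e g -> coefmap (twist n) (coefmap g P) = coefmap g (coefmap (twist n) P) *~ sg (n * e).
Proof.
move=> ge; apply/malgP => k; rewrite (raddfMz (mcoeff k)) /= !coefmapE.
exact: degree_twist.
Qed.

(** * The relations for the transferred maps *)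

Section ShiftedTransfer.
Variables (F : fieldType) (B C : gradedModule F).
Variables (m : nat -> seq B -> {lpoly B}) (nu : nat -> seq C -> {lpoly C}).
Variables (dB h : {linear B -> B}) (dC : {linear C -> C}) (p : {linear B -> C}) (i : {linear C -> B}).
Hypothesis msesq : forall k, (0 < k)%N -> conformal_sesquilinear k (m k).
Hypothesis mdeg : forall k, (0 < k)%N -> fdeg k (-1) (m k).
Hypothesis mrel : forall n ds a, (0 < n)%N -> size a = n ->
  homogs [seq d + 1 | d <- ds] a -> ainfty_sum m n ds a = 0.
Hypothesis m1 : forall x, m 1%N [:: x] = cst (dB x).
Hypothesis nu1 : forall y, nu 1%N [:: y] = cst (dC y).
Hypothesis nuE : forall k y, (1 < k)%N -> size y = k ->
  coefmap p (\sum_(t <- ptrees k) rho_tree (koszul m) h t (map i y)) = koszul nu k y.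
Hypothesis dBK : forall x, dB (dB x) = 0.
Hypothesis dCK : forall x, dC (dC x) = 0.
Hypothesis h_deg : has_degree 1 h.
Hypothesis p_deg : has_degree 0 p.
Hypothesis i_deg : has_degree 0 i.
Hypothesis dC_deg : has_degree (-1) dC.
Hypothesis p_chain : forall x, p (dB x) = dC (p x).
Hypothesis i_chain : forall y, i (dC y) = dB (i y).
Hypothesis homotopy : forall x, i (p x) - x = dB (h x) + h (dB x).
Local Notation letter := ({lpoly B} * {lpoly F})%type.

Let rho := koszul m.

Lemma koszul_csq k : (0 < k)%N -> csq k (rho k).
Proof.
move=> k0; apply: (eq_csq (fun a _ => esym (koszulE m k a))).
exact: csqP (@sesquilinear_twso _ _ (-1) k (m k) (msesq k0)).
Qed.

Lemma koszul_fdeg k : (0 < k)%N -> fdeg k (-1) (rho k).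
Proof.
move=> k0 ds a sa da; rewrite /rho koszulE.
exact: (@fdeg_twso _ _ k (-1) (-1) (m k) (mdeg k0) ds a sa da).
Qed.

Let rhoL k (k0 : (0 < k)%N) : multilin k (rho k) := let: And3 (conj L _) _ _ := koszul_csq k0 in L.

Lemma wmap_madd : madd (wmap rho).
Proof.
move=> u v x y c; rewrite /wmap !size_cat /= addnS.
exact: (wlinD _ _ _ (hat_wlin (rhoL (ltn0Sn _)))).
Qed.

Lemma twist0 (A : gradedModule F) (x : A) : twist 0 x = x.
Proof. by apply: gproj_eq => d; rewrite gproj_twist mul0r expr0z mulr1z. Qed.

Lemma wmap1 l : wmap rho [:: l] = coefmap dB l.1.
Proof.
rewrite -(hat_pointwise dB) /wmap /=; apply: (eq_hat (k := 1%N)) => // -[|x [|]] // _.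
by rewrite /rho koszulE /= mulN1r oppr0 twist0 m1.
Qed.

(** [rho] is odd. On homogeneous letters this is a comparison of signs, and multilinearity gives the
    general case. *)
Lemma wmap_twist w : w <> [::] ->
  wmap rho (map (onl (coefmap (twist 1))) w) = - coefmap (twist 1) (wmap rho w).
Proof.
move=> w0; rewrite /wmap size_map; have k0 : (0 < size w)%N by case: (w) w0.
move: k0; suff gen k : (0 < k)%N -> forall w, size w = k ->
    hat (rho k) (map (onl (coefmap (twist 1))) w) = - coefmap (twist 1) (hat (rho k) w).
  by move=> /gen; apply.
move=> {w w0} k0.
apply: (@wlin_ext _ _ (fun x : B => exists d, homog d x) k
  (fun w => hat (rho k) (map (onl (coefmap (twist 1))) w)) (fun w => - coefmap (twist 1) (hat (rho k) w))).
- by exists 0; exact: homog0.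
- exact: homog_span.
- move=> u v q x y c ek; rewrite !map_cat /= {2 4 6}/onl /= raddfD /= coefmap_lact.
  by rewrite (hat_wlin (rhoL k0)) // !size_map.
- move=> u v q x y c ek; rewrite (hat_wlin (rhoL k0)) // raddfD /= coefmap_lact.
  by rewrite opprD raddfN.
move=> t st ht.
have [es hes] : exists es, homs es (unzip1 [seq (cst l.1 : {lpoly B}, l.2) | l <- t]).
  elim: t ht {st} => [|l t IH] ht; first by exists [::].
  have [d dl] := ht l (mem_head _ _).
  have [|es des] := IH; first by move=> l' l't; apply: ht; rewrite inE l't orbT.
  by exists (d :: es); split=> //; exact: homd_mono.
have := hat_twist (k := k) (v := [::]) (hat_wlin (rhoL k0)) _ hes.
rewrite !cats0 addn0 size_map => -> //.
have hd := homd_hat (koszul_fdeg k0) (etrans (size_map _ _) st) hes.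
by rewrite (coefmap_twist 1 hd) mul1r sgD mulrzA sgN sg1 mulrN1z opprK.
Qed.

Lemma rho_relation w :
  ins (fun u v r => wmap rho (map (onl (coefmap (twist 1))) u ++ (wmap rho v, wt v) :: r)) w = 0.
Proof.
rewrite ins_relation_sum; apply: relation_sum_eq0 => //.
  by move=> k /koszul_csq[].
(* The relations start at [n = 1]; for the empty word the sum has no terms. *)
move=> es a sa da; case: (size w) sa => [|n] sa.
  by rewrite /relation_sum big_nat1 big_geq.
have esE : es = [seq d + 1 | d <- [seq e - 1 | e <- es]].
  by rewrite -map_comp -[LHS]map_id; apply: eq_map => e /=; rewrite subrK.
rewrite esE in da; rewrite (koszul_relation msesq mdeg sa da) mrel ?mul0rz //.
Qed.

Let treeval t (w : seq letter) := hat (rho_tree rho h t) w.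

Lemma tree_relation w :
  Fdefect (tree_sum treeval) (coefmap dB) (coefmap h) (coefmap (twist 1)) w = 0.
Proof.
apply: (@transfer_relation _ _ (wmap rho)).
- exact: wmap_madd.
- exact: wmap1.
- exact: wmap_twist.
- by move=> x; apply/malgP => k; rewrite !coefmapE /= dBK mcoeff0.
- move=> x /=; rewrite (coefmap_degree_twist _ _ h_deg) mul1r.
  by rewrite sg1 mulrN1z opprK.
- exact: rho_relation.
apply: tree_sumE; first exact: wmap_madd.
by move=> t1 t2 ts w' sw; apply: hat_rho_tree_node koszul_csq _ _ _ _ sw.
Qed.

Let trees k (a : seq B) := \sum_(t <- ptrees k) rho_tree rho h t a.

Lemma trees_csq k : csq k (trees k).
Proof.
by apply: csq_sum => t; rewrite mem_ptrees => /eqP <-; exact: rho_tree_csq koszul_csq t.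
Qed.

(** The twists [twso 1] undo the Koszul signs [twso (-1)], which solves the defining equation for
    [nu k]. *)
Lemma nu_koszulE k a : (1 < k)%N -> size a = k ->
  coefmap p (trees k (map i (twso 1 0 a))) = nu k a.
Proof.
move=> k1 sa; rewrite nuE ?size_twso // koszulE.
by have := twso_inv (-1) a; rewrite opprK => ->.
Qed.

Lemma nu1E a : size a = 1%N -> (pointwise dC).2 a = nu 1 a.
Proof. by case: a => [|y [|]] // _; rewrite nu1. Qed.

Lemma eq_sesquilinear (A : gradedModule F) k (f f' : seq A -> {lpoly A}) : (0 < k)%N ->
  (forall a, size a = k -> f a = f' a) -> conformal_sesquilinear k f -> conformal_sesquilinear k f'.
Proof. by move=> k0 ef fD; apply/csq_sesquilinear/(eq_csq ef)/csqP. Qed.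

Lemma nu_sesquilinear k : (0 < k)%N -> conformal_sesquilinear k (nu k).
Proof.
case: k => [|[|k]] // _.
  by apply: (eq_sesquilinear _ nu1E) => //; apply/csq_sesquilinear/csq_pointwise.
apply: (eq_sesquilinear _ (fun a => @nu_koszulE k.+2 a isT)) => //.
apply: (@sesquilinear_twso _ _ 1 k.+2 (fun a => coefmap p (trees k.+2 (map i a)))).
by apply: csq_sesquilinear => //; apply/csq_conj/trees_csq.
Qed.

Lemma nu_fdeg k : (0 < k)%N -> fdeg k (-1) (nu k).
Proof.
case: k => [|[|k]] // _ ds a sa da.
  case: a ds sa da => [|y [|]] // [|d [|d' ds]] _ []// _ /(_ 0%N isT) dy.
  by rewrite big_seq1 nu1; apply/homd_mono/dC_deg.
rewrite -nu_koszulE //; move: ds a sa da.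
apply: (@fdeg_twso _ _ k.+2 (-1) 1 (fun a => coefmap p (trees k.+2 (map i a)))) => ds a sa da.
rewrite -[_ + -1]addr0; apply: (homd_coefmap p_deg); apply: homd_sum => t.
rewrite mem_ptrees => /eqP lt.
have := @rho_tree_fdeg _ _ _ _ koszul_csq koszul_fdeg h_deg t ds (map i a).
case: t lt => // t1 t2 ts lt; apply; first by rewrite size_map sa lt.
split; first by rewrite size_map; case: da.
move=> j; rewrite size_map => ja; rewrite (nth_map 0) //.
by have := i_deg (da.2 j ja); rewrite addr0.
Qed.

Let map_i := map (onl (coefmap i)) : seq ({lpoly C} * {lpoly F}) -> seq letter.
Let theta_w := wmap (koszul nu).

Lemma theta_w1 l : theta_w [:: l] = coefmap dC l.1.
Proof.
rewrite -(hat_pointwise dC) /theta_w /wmap /=; apply: (eq_hat (k := 1%N)) => // -[|x [|]] // _.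
by rewrite koszulE /= mulN1r oppr0 twist0 nu1.
Qed.

Lemma theta_wE w : (1 < size w)%N -> theta_w w = coefmap p (tree_sum treeval (map_i w)).
Proof.
move=> w1; rewrite /tree_sum size_map w1 /theta_w /wmap.
rewrite -(eq_hat (fun y => @nuE (size w) y w1)) //.
have [[tL _] _ _] := trees_csq (size w).
rewrite (hat_conj _ _ tL) // /trees hat_sum //.
Qed.

(** This is [p] applied to [X = 0] at [map_i w]. By the homotopy identity, [theta_word] at [map_i v]
    is [i] of the transferred map at [v], so [p F] at the new word is again a transferred map. Where
    the outer word has one letter [F] vanishes, and the missing term comes from [p (d F)]. *)
Lemma theta_relation w : (0 < size w)%N ->
  ins (fun u v r => theta_w (map (onl (coefmap (twist 1))) u ++ (theta_w v, wt v) :: r)) w = 0.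
Proof.
move=> w0.
have w0' : w <> [::] by case: (w) w0.
have iw : size (map_i w) = size w by rewrite size_map.
rewrite -[RHS](raddf0 (coefmap p)) -(tree_relation (map_i w)) /Fdefect raddfD /=.
rewrite (ins_morph _ _ (raddfD (coefmap p)) (raddf0 _)) ins_map.
rewrite -[X in X + _](ins_whole (fun v => coefmap p (coefmap dB (tree_sum treeval (map_i v)))) w0') -insD.
apply: eq_ins => u v r e v0.
have map_i_insertion : map_i (map (onl (coefmap (twist 1))) u ++ (theta_w v, wt v) :: r) =
    map (onl (coefmap (twist 1))) (map_i u) ++
    theta_word (tree_sum treeval) (coefmap dB) (coefmap h) (map_i v) :: map_i r.
  rewrite /map_i map_cat /= -!map_comp; congr (_ ++ _ :: _).
    apply: eq_map => l; rewrite /onl /=; congr pair.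
    by rewrite (coefmap_degree_twist _ _ i_deg) mulr0 /sg expr0z mulr1z.
  rewrite /theta_word /onl /=; congr pair; last by rewrite /wt big_map.
  case: (v) v0 => [|l [|l' v']] // _ /=.
    by rewrite theta_w1; apply/malgP => k; rewrite !coefmapE /= i_chain.
  rewrite theta_wE //=; apply/malgP => k.
  rewrite !mcoeffD !coefmapE /=; set x := _@_k.
  by rewrite -addrA -homotopy addrC subrK.
have tree1 l : tree_sum treeval [:: l] = 0 by [].
have big : (u, r) <> ([::], [::]) ->
    (1 < size (map (onl (coefmap (twist 1))) u ++ (theta_w v, wt v) :: r))%N.
  by rewrite size_cat /= addnS; case: (u) => [|? ?]; case: (r).
case: u r e map_i_insertion big => [|l u] r e map_i_insertion big; last first.
  by rewrite add0r theta_wE ?big // map_i_insertion.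
case: r e map_i_insertion big => [|l r] e map_i_insertion big; last first.
  by rewrite add0r theta_wE ?big // map_i_insertion.
(* Here [u] and [r] are empty and the outer map is the differential of [H]. For a single letter its
   square appears, otherwise [p] is moved past the differential. *)
rewrite /= tree1 raddf0 addr0 theta_w1 /=.
case: (v) v0 => [|l [|l' v']] // _.
  rewrite theta_w1 /= tree1 !raddf0.
  by apply/malgP => k; rewrite !coefmapE /= dCK mcoeff0.
rewrite theta_wE //.
by apply/malgP => k; rewrite !coefmapE /= p_chain.
Qed.

(** At the generic word the relation differs from [ainfty_sum] only by a global sign, which cannot
    affect its vanishing. *)
Lemma nu_relation n ds a : (0 < n)%N -> size a = n ->
  homogs [seq d + 1 | d <- ds] a -> ainfty_sum nu n ds a = 0.
Proof.
move=> n0 sa da; have := koszul_relation nu_sesquilinear nu_fdeg sa da.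
have sg_w : size (genw (F := F) 0 a) = n by rewrite size_genw.
rewrite -{1}sg_w -ins_relation_sum theta_relation ?sg_w //.
by case: (sg_cases (kexp [seq d + 1 | d <- ds] + n.+1%:Z)) => ->;
  rewrite ?mulr1z ?mulrN1z => /esym // /eqP; rewrite oppr_eq0 => /eqP.
Qed.

End ShiftedTransfer.

(** * Passing between a graded module and its shift *)

Section Shift.
Variables (F : fieldType) (A : gradedModule F).

(** The shift changes only the grading, which sesquilinearity does not involve. *)
Lemma sesquilinear_shift k (f : seq A -> {lpoly A}) :
  conformal_sesquilinear k f -> @conformal_sesquilinear F (shift A) k f.
Proof. by case=> fv fL fD fD'; split; assumption. Qed.

Lemma sesquilinear_unshift k (f : seq A -> {lpoly A}) :
  @conformal_sesquilinear F (shift A) k f -> conformal_sesquilinear k f.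
Proof. by case=> fv fL fD fD'; split; assumption. Qed.

Lemma homog_shift d (x : A) : @homog F (shift A) (d + 1) x <-> homog d x.
Proof. by rewrite /homog /= addrK. Qed.

Lemma homogs_shift ds (a : seq A) :
  @homogs F (shift A) [seq d + 1 | d <- ds] a <-> homogs ds a.
Proof.
elim: ds a => [|d ds IH] [|x a]; try by split=> -[].
rewrite /= (@homogs_cons F (shift A)) (@homogs_cons F A) IH; split=> -[dx da]; split=> //.
  exact/homog_shift.
exact/homog_shift.
Qed.

Lemma homogs_shiftP es (a : seq A) :
  @homogs F (shift A) es a -> homogs [seq e - 1 | e <- es] a.
Proof.
move=> ha; apply/homogs_shift; rewrite -map_comp (eq_map (g := id)) ?map_id // => e /=.
exact: subrK.
Qed.

Lemma sum_shift (ds : seq int) c :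
  \sum_(d <- [seq d + c | d <- ds]) d = \sum_(d <- ds) d + c *+ size ds.
Proof. by rewrite big_map big_split /= big_const_seq count_predT iter_addr_0. Qed.

End Shift.

(** Raising the [k] input degrees and the output degree by 1 turns [k - 2] into -1. *)
Lemma fdeg_shift (F : fieldType) (A : gradedModule F) k (f : seq A -> {lpoly A}) :
  (forall ds a, size a = k -> homogs ds a ->
     forall m, homog (\sum_(d <- ds) d + k%:Z - 2) (f a)@_m) <->
  @fdeg F (shift A) k (-1) f.
Proof.
have sumE (ds : seq int) : size ds = k ->
    \sum_(d <- [seq d + 1 | d <- ds]) d - 1 = \sum_(d <- ds) d + k%:Z - 2 + 1.
  move=> sds; rewrite sum_shift sds pmulrn intz -!addrA; congr (_ + (_ + _)).
split=> [fd es a sa ha|fd ds a sa ha m].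
  have ha' := homogs_shiftP ha.
  have esE : es = [seq d + 1 | d <- [seq e - 1 | e <- es]].
    by rewrite -map_comp (eq_map (g := id)) ?map_id // => e /=; rewrite subrK.
  move=> m; rewrite esE sumE; last by rewrite size_map; case: ha => ->.
  by apply/homog_shift; exact: fd.
have := fd [seq d + 1 | d <- ds] a sa ((homogs_shift ds a).2 ha) m.
rewrite sumE; last by case: ha => ->.
by move/homog_shift.
Qed.

Local Open Scope complex_scope.

Theorem theorem3p16 (R : realType) (A H : chainComplex R[i])
    (p : {linear A -> H}) (i : {linear H -> A}) (h : {linear A -> A})
    (hcontr : contraction_data p i h)
    (mu : nat -> seq A -> {lpoly A})
    (hmu1 : forall x : A, mu 1%N [:: x] = (cdiff A x)%:MP)
    (hmu : Ainfty_conformal mu) :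
  (exists nu : nat -> seq H -> {lpoly H}, transferred_maps p i h mu nu) /\
  (forall nu : nat -> seq H -> {lpoly H},
     transferred_maps p i h mu nu -> Ainfty_conformal nu).
Proof.
split; first exact: transferred_maps_exist.
move=> nu [nu1 nuE]; case: hcontr => p_deg i_deg h_deg p_chain i_chain homotopy _.
have shift_deg (A' B' : gradedModule R[i]) e (g : A' -> B') : has_degree e g ->
    @has_degree _ (shift A') (shift B') e g.
  move=> ge d x; rewrite -{1}[d](subrK 1) => /homog_shift/ge dx.
  by rewrite (_ : d + e = d - 1 + e + 1); [exact/homog_shift|rewrite addrAC subrK].
(* A module and its shift have the same elements, so every map is reused as it stands and only its
   degree is read in the new grading. *)
pose B := shift A; pose C := shift H.
pose dB : {linear B -> B} := cdiff A; pose dC : {linear C -> C} := cdiff H.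
pose p' : {linear B -> C} := p; pose i' : {linear C -> B} := i; pose h' : {linear B -> B} := h.
have msesq k : (0 < k)%N -> @conformal_sesquilinear _ B k (mu k).
  by move=> k0; apply: sesquilinear_shift; apply: Ainfty_sesquilinear.
have mdeg k : (0 < k)%N -> @fdeg _ B k (-1) (mu k).
  by move=> k0; apply/fdeg_shift => ds a sa da m; apply: Ainfty_degree.
have mrel n ds (a : seq B) : (0 < n)%N -> size a = n ->
    homogs [seq d + 1 | d <- ds] a -> @ainfty_sum _ B mu n ds a = 0.
  by move=> n0 sa /homogs_shift da; exact: (Ainfty_relation hmu n0 sa da).
have m1 (x : B) : mu 1%N [:: x] = mono mone (dB x) by rewrite mono_def.
have nu1' (y : C) : nu 1%N [:: y] = mono mone (dC y) by rewrite mono_def.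
have nuE' k (y : seq C) : (1 < k)%N -> size y = k ->
    coefmap p' (\sum_(t <- ptrees k) rho_tree (@koszul _ B mu) h' t (map i' y)) = @koszul _ C nu k y.
  by move=> k1 sy; rewrite coefmap_def; exact: (nuE k y k1 sy).
have dBK (x : B) : dB (dB x) = 0 by exact: cdiffK.
have dCK (x : C) : dC (dC x) = 0 by exact: cdiffK.
have dC_deg : has_degree (-1) dC by apply: shift_deg; exact: cdiff_degree.
have p_deg' : has_degree 0 p' by exact: shift_deg p_deg.
have i_deg' : has_degree 0 i' by exact: shift_deg i_deg.
have h_deg' : has_degree 1 h' by exact: shift_deg h_deg.
split=> [k k0|k ds a k0 sa da|n ds a n0 sa da].
- by apply: sesquilinear_unshift; apply: (@nu_sesquilinear _ B C mu nu h' dC p' i').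
- move: ds a sa da; apply/fdeg_shift.
  exact: (@nu_fdeg _ B C mu nu h' dC p' i').
apply: (@nu_relation _ B C mu nu dB h' dC p' i' _ _ _ _ _ _ _ _ _ _ _ _ _ _ _ n ds a n0 sa) => //.
exact/homogs_shift.
Qed.
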